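(* Work in $\mathsf{ZF}$ (without the axiom of choice). For every infinite set $A$, there is no boundedly finite-to-one function from $\mathcal{B}(A)$ to $\mathrm{fin}(A)$.
   Context: A function $f$ is boundedly finite-to-one if there is a natural number $k$ such that every point has at most $k$ preimages under $f$. For a set $A$, $\mathcal{B}(A)$ is the set of all partitions of $A$ all of whose blocks are finite, and $\mathrm{fin}(A)$ is the set of all finite subsets of $A$. *)

(* Defs.v *)
Set Implicit Arguments.

(* Rocq's logic, with the axioms usually assumed on top of it, proves forms of
   the axiom of choice.  "In ZF" is therefore rendered as "in every model of
   first-order ZF": Separation and Replacement range over first-order formulas
   with parameters only, and every set-theoretic notion below is a first-order
   property of the model, with all quantifiers ranging over its elements. *)

Record set_structure : Type := SetStructure {
  carrier :> Type;
  mem : carrier -> carrier -> Prop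
}.

Arguments mem {s} _ _.

Notation "x ∈ y" := (mem x y) (at level 70, no associativity).
Notation "x ∉ y" := (~ mem x y) (at level 70, no associativity).

(* Formulas of the language {=, ∈}; variables are de Bruijn indices. *)
Inductive formula : Type :=
| fEq (i j : nat)
| fMem (i j : nat)
| fFalse
| fAnd (p q : formula)
| fOr (p q : formula)
| fImp (p q : formula)
| fAll (p : formula)
| fEx (p : formula).

Definition scons (T : Type) (x : T) (rho : nat -> T) (i : nat) : T :=
  match i with
  | O => x
  | S j => rho j
  end.

Fixpoint sat (M : set_structure) (rho : nat -> M) (p : formula) : Prop :=
  match p with
  | fEq i j => rho i = rho j
  | fMem i j => rho i ∈ rho j
  | fFalse => False
  | fAnd p q => sat M rho p /\ sat M rho q
  | fOr p q => sat M rho p \/ sat M rho q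
  | fImp p q => sat M rho p -> sat M rho q
  | fAll p => forall x : M, sat M (scons x rho) p
  | fEx p => exists x : M, sat M (scons x rho) p
  end.

Arguments sat {M} rho p.

Section SetTheory.

Context {M : set_structure}.
Implicit Types (x y z w A B F P X Y S f g k n p : M).

Definition subset x y : Prop := forall z, z ∈ x -> z ∈ y.

Definition is_empty x : Prop := forall z, z ∉ x.

Definition is_successor y x : Prop := forall z, z ∈ y <-> z ∈ x \/ z = x.

Definition inductive_set w : Prop :=
  (exists x, is_empty x /\ x ∈ w) /\
  (forall x, x ∈ w -> exists y, is_successor y x /\ y ∈ w).

(* n belongs to ω, the least inductive set. *)
Definition is_natural n : Prop := forall w, inductive_set w -> n ∈ w.

Definition is_unordered_pair p x y : Prop := forall z, z ∈ p <-> z = x \/ z = y.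

(* Kuratowski pair: p = {{x}, {x, y}}. *)
Definition is_ordered_pair p x y : Prop :=
  exists s t, is_unordered_pair s x x /\ is_unordered_pair t x y /\
              is_unordered_pair p s t.

(* f(x) = y, for f a set of ordered pairs. *)
Definition maps_to f x y : Prop := exists p, is_ordered_pair p x y /\ p ∈ f.

Definition is_function f X Y : Prop :=
  (forall p, p ∈ f -> exists x y, x ∈ X /\ y ∈ Y /\ is_ordered_pair p x y) /\
  (forall x, x ∈ X -> exists! y, maps_to f x y).

Definition is_injection f X Y : Prop :=
  is_function f X Y /\
  forall x x' y, maps_to f x y -> maps_to f x' y -> x = x'.

Definition is_bijection f X Y : Prop :=
  is_injection f X Y /\ forall y, y ∈ Y -> exists x, maps_to f x y.

Definition finite_set x : Prop :=
  exists n g, is_natural n /\ is_bijection g x n.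

Definition infinite_set x : Prop := ~ finite_set x.

Definition has_at_most x k : Prop := exists g, is_injection g x k.

Definition is_preimage S f y : Prop := forall x, x ∈ S <-> maps_to f x y.

(* The bound k is a natural number of the model, as it must be for this to be a
   notion of set theory. *)
Definition boundedly_finite_to_one f Y : Prop :=
  exists k, is_natural k /\
    forall y, y ∈ Y -> exists S, is_preimage S f y /\ has_at_most S k.

Definition is_partition P A : Prop :=
  (forall x, x ∈ P -> subset x A /\ ~ is_empty x) /\
  (forall x y z, x ∈ P -> y ∈ P -> z ∈ x -> z ∈ y -> x = y) /\
  (forall z, z ∈ A -> exists x, x ∈ P /\ z ∈ x).

(* B is the set 𝓑(A). *)
Definition is_finite_block_partitions B A : Prop :=
  forall P, P ∈ B <-> is_partition P A /\ forall x, x ∈ P -> finite_set x.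

(* F is the set fin(A). *)
Definition is_finite_subsets F A : Prop :=
  forall x, x ∈ F <-> subset x A /\ finite_set x.

End SetTheory.

Record ZF (M : set_structure) : Prop := {
  ZF_extensionality :
    forall x y : M, (forall z, z ∈ x <-> z ∈ y) -> x = y;
  ZF_foundation :
    forall x : M, ~ is_empty x -> exists y, y ∈ x /\ forall z, z ∈ x -> z ∉ y;
  ZF_pairing :
    forall x y : M, exists z, is_unordered_pair z x y;
  ZF_union :
    forall x : M, exists u, forall z, z ∈ u <-> exists y, y ∈ x /\ z ∈ y;
  ZF_power_set :
    forall x : M, exists u, forall z, z ∈ u <-> subset z x;
  ZF_infinity :
    exists w : M, inductive_set w;
  ZF_separation :
    forall (phi : formula) (rho : nat -> M) (x : M),
      exists u, forall z, z ∈ u <-> z ∈ x /\ sat (scons z rho) phi;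
  ZF_replacement :
    forall (phi : formula) (rho : nat -> M) (a : M),
      (forall x y y', x ∈ a -> sat (scons y (scons x rho)) phi ->
         sat (scons y' (scons x rho)) phi -> y = y') ->
      exists b, forall y,
        y ∈ b <-> exists x, x ∈ a /\ sat (scons y (scons x rho)) phi
}.

(* Main.v *)
Require Import Defs.
From Stdlib Require Import Arith Lia Classical ClassicalEpsilon.

(** Suppose every fibre of [f : 𝓑(A) -> fin(A)] has at most [k] elements.

    For a finite [U ⊆ A] let [U⁺] be the union of [U] and all [f(P)], where [P] merges only points
    of [U].  A set [U] has more than [k * 2^|U|] partitions once it is large, so [U⁺ ≠ U],
    and iterating gives an infinite sequence of pairwise disjoint nonempty finite subsets of [A].

    Call an infinite well-ordered family [X] of pairwise disjoint nonempty finite subsets of [A],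
    with an injection [q : fin(X) -> X], a structure.  Given a structure, [q] provides for
    every [s ∈ fin(X)] its own infinite supply of members of [X].  Merging two of them,
    chosen least such that no partition with value inside [⋃ s] has this block, for all [s] at
    once, yields a partition whose value is not contained in [⋃ X].  This only uses that
    the fibres are finite, and no choice.  Repeating it along the well-order of [X]
    gives a disjoint copy of [X], and [X] together with its copy again carries a structure,
    which extends the old one.  Unions of chains of structures are structures, so the
    Bourbaki-Witt theorem gives a structure equal to its own doubling, which is absurd. *)

(* Nothing may be chosen inside the model, so every object must be the unique one with a first-order
   property of its inputs, and every separation comes with a proof that its predicate is definable.
   [epsilon] only names sets that extensionality makes unique.

   The diagonal step dictates what a structure contains. A single partition has to defeat every
   finite [s] at once, so the blocks made for different [s] must be disjoint, and each [s] needs its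
   own reserved supply of members; the injection [q] provides it. The well-order makes the block for
   [s] a least candidate instead of a chosen one. Keeping [q] and the order inside the structure
   means that they are extended at a doubling and united at a limit, never found anew.

   Towers, that is least families closed under a step and under unions of chains, replace recursion
   throughout: they iterate [U ↦ U⁺], they copy a family member by member, and they yield the final
   fixed point. The uniformity of the bound [k] matters only in the counting behind [U⁺ ≠ U]. *)
Existing Class ZF.

(* Sealed constants do not unfold during conversion; without this, failed comparisons of
   nested set-theoretic terms blow up. *)
Definition sealed {T : Type} (x : T) : {y : T | y = x}.
Proof. exists x. reflexivity. Qed.

Ltac unseal := repeat rewrite (proj2_sig (sealed _)); cbv beta.

(** * Definable predicates *)

Fixpoint ren (s : nat -> nat) (p : formula) : formula :=
  let up := fun i => match i with O => O | S j => S (s j) end in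
  match p with
  | fEq i j => fEq (s i) (s j)
  | fMem i j => fMem (s i) (s j)
  | fFalse => fFalse
  | fAnd p q => fAnd (ren s p) (ren s q)
  | fOr p q => fOr (ren s p) (ren s q)
  | fImp p q => fImp (ren s p) (ren s q)
  | fAll p => fAll (ren up p)
  | fEx p => fEx (ren up p)
  end.

Section Definability.

Context {M : set_structure} {HM : ZF M}.

Lemma sat_ren (p : formula) : forall (s : nat -> nat) (u v : nat -> M),
  (forall i, u (s i) = v i) -> (sat u (ren s p) <-> sat v p).
Proof.
  induction p; intros s u v E; simpl.
  - now rewrite !E.
  - now rewrite !E.
  - tauto.
  - now rewrite (IHp1 s u v E), (IHp2 s u v E).
  - now rewrite (IHp1 s u v E), (IHp2 s u v E).
  - now rewrite (IHp1 s u v E), (IHp2 s u v E).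
  - split; intros H x; specialize (H x); revert H;
      apply IHp; intros [|i]; simpl; auto.
  - split; intros [x H]; exists x; revert H;
      apply IHp; intros [|i]; simpl; auto.
Qed.

(* Even positions carry the variables, odd positions the parameters. *)
Definition mix (v ps : nat -> M) (i : nat) : M :=
  if Nat.even i then v (Nat.div2 i) else ps (Nat.div2 i).

(** The parameters form an infinite sequence, so definable predicates can be combined without
    tracking how many parameters each of them uses. *)
Definition Definable (Q : (nat -> M) -> Prop) : Prop :=
  exists (p : formula) (ps : nat -> M), forall v, Q v <-> sat (mix v ps) p.

Lemma mix_even v ps i : mix v ps (2 * i) = v i.
Proof.
  unfold mix. rewrite Nat.even_mul; simpl (Nat.even 2 || _)%bool; cbv iota.
  now rewrite Nat.div2_double.
Qed.

Lemma mix_odd v ps i : mix v ps (S (2 * i)) = ps i.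
Proof.
  unfold mix. rewrite Nat.even_succ, Nat.odd_mul; simpl (Nat.odd 2 && _)%bool; cbv iota.
  now rewrite Nat.div2_succ_double.
Qed.

Definition on_parity (s t : nat -> nat) (i : nat) : nat :=
  if Nat.even i then s (Nat.div2 i) else t (Nat.div2 i).

Lemma parity_cases i : (exists j, i = 2 * j) \/ (exists j, i = S (2 * j)).
Proof. destruct (Nat.Even_or_Odd i) as [[j H]|[j H]]; [left|right]; exists j; lia. Qed.

Lemma on_parity_even s t i : on_parity s t (2 * i) = s i.
Proof.
  unfold on_parity. rewrite Nat.even_mul; simpl (Nat.even 2 || _)%bool; cbv iota.
  now rewrite Nat.div2_double.
Qed.

Lemma on_parity_odd s t i : on_parity s t (S (2 * i)) = t i.
Proof.
  unfold on_parity. rewrite Nat.even_succ, Nat.odd_mul; simpl (Nat.odd 2 && _)%bool; cbv iota.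
  now rewrite Nat.div2_succ_double.
Qed.

Lemma sat_parity p s t (u v ps : nat -> M) :
  (forall i, u (s i) = v i) -> (forall i, u (t i) = ps i) ->
  (sat u (ren (on_parity s t) p) <-> sat (mix v ps) p).
Proof.
  intros H1 H2. apply sat_ren. intros i.
  destruct (parity_cases i) as [[j ->]|[j ->]].
  - now rewrite on_parity_even, mix_even.
  - now rewrite on_parity_odd, mix_odd.
Qed.

Lemma D_equiv (P Q : (nat -> M) -> Prop) :
  (forall v, P v <-> Q v) -> Definable Q -> Definable P.
Proof. intros H (p & ps & Hp). exists p, ps. intros v. now rewrite H. Qed.

Lemma D_ren (s : nat -> nat) Q : Definable Q -> Definable (fun v => Q (fun i => v (s i))).
Proof.
  intros (p & ps & Hp).
  exists (ren (on_parity (fun i => 2 * s i) (fun i => S (2 * i))) p), ps. intros v.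
  rewrite Hp. symmetry. apply sat_parity; intros i.
  - apply mix_even.
  - apply mix_odd.
Qed.

Lemma model_inhabited : inhabited M.
Proof. destruct (ZF_infinity HM) as [w _]. exact (inhabits w). Qed.

(** Classically, a proposition that does not depend on the assignment is equivalent to a true or to
    a false formula. Facts about fixed objects may therefore occur in a predicate without being
    written as formulas. *)
Lemma D_const (P : Prop) : Definable (fun _ => P).
Proof.
  destruct model_inhabited as [a].
  destruct (classic P).
  - exists (fImp fFalse fFalse), (fun _ => a). simpl. tauto.
  - exists fFalse, (fun _ => a). simpl. tauto.
Qed.

Lemma D_binary (conn : formula -> formula -> formula) (op : Prop -> Prop -> Prop) P Q :
  (forall u p q, sat (M := M) u (conn p q) <-> op (sat u p) (sat u q)) ->
  (forall A B A' B', (A <-> A') -> (B <-> B') -> (op A B <-> op A' B')) ->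
  Definable P -> Definable Q -> Definable (fun v => op (P v) (Q v)).
Proof.
  intros Hc Hop (p & ps & Hp) (q & qs & Hq).
  (* The two parameter sequences are interleaved once more: among the odd positions, [ps i] has
     index [2 * i] and [qs i] has index [S (2 * i)]. *)
  exists (conn (ren (on_parity (fun i => 2 * i) (fun i => S (2 * (2 * i)))) p)
               (ren (on_parity (fun i => 2 * i) (fun i => S (2 * S (2 * i)))) q)), (mix ps qs).
  intros v. rewrite Hc. apply Hop.
  - rewrite Hp. symmetry. apply sat_parity; intros i.
    + apply mix_even.
    + now rewrite mix_odd, mix_even.
  - rewrite Hq. symmetry. apply sat_parity; intros i.
    + apply mix_even.
    + now rewrite mix_odd, mix_odd.
Qed.

Lemma D_and P Q : Definable P -> Definable Q -> Definable (fun v => P v /\ Q v).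
Proof. apply (D_binary fAnd and); simpl; tauto. Qed.

Lemma D_or P Q : Definable P -> Definable Q -> Definable (fun v => P v \/ Q v).
Proof. apply (D_binary fOr or); simpl; tauto. Qed.

Lemma D_imp P Q : Definable P -> Definable Q -> Definable (fun v => P v -> Q v).
Proof. apply (D_binary fImp (fun A B => A -> B)); simpl; tauto. Qed.

Lemma D_iff P Q : Definable P -> Definable Q -> Definable (fun v => P v <-> Q v).
Proof. intros HP HQ. apply D_and; now apply D_imp. Qed.

Lemma D_not P : Definable P -> Definable (fun v => ~ P v).
Proof. intros HP. apply D_imp; [exact HP | apply D_const]. Qed.

Lemma sat_under_binder p (x : M) v ps :
  sat (scons x (mix v ps))
    (ren (on_parity (fun i => match i with O => O | S j => S (2 * j) end)
                    (fun i => S (S (2 * i)))) p)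
  <-> sat (mix (scons x v) ps) p.
Proof.
  apply sat_parity.
  - intros [|i]; [reflexivity | exact (mix_even v ps i)].
  - intros i. exact (mix_odd v ps i).
Qed.

Lemma D_all (Q : M -> (nat -> M) -> Prop) :
  Definable (fun v => Q (v 0) (fun i => v (S i))) -> Definable (fun v => forall x, Q x v).
Proof.
  intros (p & ps & Hp). eexists (fAll _), ps. intros v. simpl.
  split; intros H x; specialize (H x); revert H;
    rewrite (sat_under_binder p x v ps), <- Hp; exact (fun h => h).
Qed.

Lemma D_ex (Q : M -> (nat -> M) -> Prop) :
  Definable (fun v => Q (v 0) (fun i => v (S i))) -> Definable (fun v => exists x, Q x v).
Proof.
  intros (p & ps & Hp). eexists (fEx _), ps. intros v. simpl.
  split; intros [x H]; exists x; revert H;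
    rewrite (sat_under_binder p x v ps), <- Hp; exact (fun h => h).
Qed.

Definition Def1 (R : M -> Prop) := Definable (fun v => R (v 0)).
Definition Def2 (R : M -> M -> Prop) := Definable (fun v => R (v 0) (v 1)).
Definition Def3 (R : M -> M -> M -> Prop) := Definable (fun v => R (v 0) (v 1) (v 2)).
Definition Def4 (R : M -> M -> M -> M -> Prop) :=
  Definable (fun v => R (v 0) (v 1) (v 2) (v 3)).
Definition Def5 (R : M -> M -> M -> M -> M -> Prop) :=
  Definable (fun v => R (v 0) (v 1) (v 2) (v 3) (v 4)).

Definition DefTerm (t : (nat -> M) -> M) := Definable (fun v => v 0 = t (fun i => v (S i))).

Definition DefFun1 (F : M -> M) := Def2 (fun z x => z = F x).
Definition DefFun2 (F : M -> M -> M) := Def3 (fun z x y => z = F x y).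
Definition DefFun3 (F : M -> M -> M -> M) := Def4 (fun z x y w => z = F x y w).
Definition DefFun4 (F : M -> M -> M -> M -> M) := Def5 (fun z x y w u => z = F x y w u).

Lemma D_eq : Def2 (@eq M).
Proof.
  destruct model_inhabited as [a]. exists (fEq 0 2), (fun _ => a). intros v. reflexivity.
Qed.

Lemma D_mem : Def2 (@mem M).
Proof.
  destruct model_inhabited as [a]. exists (fMem 0 2), (fun _ => a). intros v. reflexivity.
Qed.

Lemma DefTerm_var i : DefTerm (fun v => v i).
Proof.
  apply (D_ren (fun j => match j with O => O | _ => S i end) _ D_eq).
Qed.

Lemma DefTerm_const a : DefTerm (fun _ => a).
Proof. exists (fEq 0 1), (fun _ => a). intros v. reflexivity. Qed.

(** The language has no function symbols, so a term is substituted through its graph: some [x]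
    equals [t v] and satisfies [Q]. *)
Lemma D_subst (Q : M -> (nat -> M) -> Prop) t :
  Definable (fun v => Q (v 0) (fun i => v (S i))) -> DefTerm t ->
  Definable (fun v => Q (t v) v).
Proof.
  intros HQ Ht. apply (D_equiv _ (fun v => exists x, x = t v /\ Q x v)).
  - intros v. split.
    + intros H. exists (t v). auto.
    + intros (x & -> & H). exact H.
  - apply D_ex. apply D_and; assumption.
Qed.

Lemma DefTerm_ren (s : nat -> nat) t : DefTerm t -> DefTerm (fun v => t (fun i => v (s i))).
Proof.
  intros H. apply (D_ren (fun j => match j with O => O | S j => S (s j) end) _ H).
Qed.

Lemma D_app1 R t : Def1 R -> DefTerm t -> Definable (fun v => R (t v)).
Proof. intros HR H. exact (D_subst (fun x _ => R x) t HR H). Qed.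

Lemma D_app2 R t1 t2 : Def2 R -> DefTerm t1 -> DefTerm t2 -> Definable (fun v => R (t1 v) (t2 v)).
Proof.
  intros HR H1 H2. apply (D_subst (fun x v => R x (t2 v))); [|exact H1].
  apply (D_subst (fun y v => R (v 0) y) (fun v => t2 (fun i => v (S i)))).
  - exact (D_ren (fun j => match j with O => 1 | _ => 0 end) _ HR).
  - now apply (DefTerm_ren S).
Qed.

Lemma D_app3 R t1 t2 t3 : Def3 R -> DefTerm t1 -> DefTerm t2 -> DefTerm t3 ->
  Definable (fun v => R (t1 v) (t2 v) (t3 v)).
Proof.
  intros HR H1 H2 H3. apply (D_subst (fun x v => R x (t2 v) (t3 v))); [|exact H1].
  apply (D_subst (fun y v => R (v 0) y (t3 (fun i => v (S i)))) (fun v => t2 (fun i => v (S i)))).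
  - apply (D_subst (fun z v => R (v 1) (v 0) z) (fun v => t3 (fun i => v (S (S i))))).
    + exact (D_ren (fun j => match j with O => 2 | 1 => 1 | _ => 0 end) _ HR).
    + now apply (DefTerm_ren (fun i => S (S i))).
  - now apply (DefTerm_ren S).
Qed.

Lemma D_app4 R t1 t2 t3 t4 : Def4 R -> DefTerm t1 -> DefTerm t2 -> DefTerm t3 -> DefTerm t4 ->
  Definable (fun v => R (t1 v) (t2 v) (t3 v) (t4 v)).
Proof.
  intros HR H1 H2 H3 H4. apply (D_subst (fun x v => R x (t2 v) (t3 v) (t4 v))); [|exact H1].
  apply (D_subst (fun y v => R (v 0) y (t3 (fun i => v (S i))) (t4 (fun i => v (S i))))
           (fun v => t2 (fun i => v (S i)))).
  - apply (D_subst (fun z v => R (v 1) (v 0) z (t4 (fun i => v (S (S i)))))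
             (fun v => t3 (fun i => v (S (S i))))).
    + apply (D_subst (fun w v => R (v 2) (v 1) (v 0) w) (fun v => t4 (fun i => v (S (S (S i)))))).
      * exact (D_ren (fun j => match j with O => 3 | 1 => 2 | 2 => 1 | _ => 0 end) _ HR).
      * now apply (DefTerm_ren (fun i => S (S (S i)))).
    + now apply (DefTerm_ren (fun i => S (S i))).
  - now apply (DefTerm_ren S).
Qed.

Lemma D_app5 R t1 t2 t3 t4 t5 : Def5 R ->
  DefTerm t1 -> DefTerm t2 -> DefTerm t3 -> DefTerm t4 -> DefTerm t5 ->
  Definable (fun v => R (t1 v) (t2 v) (t3 v) (t4 v) (t5 v)).
Proof.
  intros HR H1 H2 H3 H4 H5. apply (D_subst (fun x v => R x (t2 v) (t3 v) (t4 v) (t5 v))); [|exact H1].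
  apply (D_subst (fun y v => R (v 0) y (t3 (fun i => v (S i))) (t4 (fun i => v (S i)))
                               (t5 (fun i => v (S i))))
           (fun v => t2 (fun i => v (S i)))).
  - apply (D_subst (fun z v => R (v 1) (v 0) z (t4 (fun i => v (S (S i)))) (t5 (fun i => v (S (S i)))))
             (fun v => t3 (fun i => v (S (S i))))).
    + apply (D_subst (fun w v => R (v 2) (v 1) (v 0) w (t5 (fun i => v (S (S (S i))))))
               (fun v => t4 (fun i => v (S (S (S i)))))).
      * apply (D_subst (fun u v => R (v 3) (v 2) (v 1) (v 0) u)
                 (fun v => t5 (fun i => v (S (S (S (S i))))))).
        -- exact (D_ren (fun j => match j with O => 4 | 1 => 3 | 2 => 2 | 3 => 1 | _ => 0 end) _ HR).
        -- now apply (DefTerm_ren (fun i => S (S (S (S i))))).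
      * now apply (DefTerm_ren (fun i => S (S (S i)))).
    + now apply (DefTerm_ren (fun i => S (S i))).
  - now apply (DefTerm_ren S).
Qed.

Lemma DefTerm_app1 F t1 : DefFun1 F -> DefTerm t1 -> DefTerm (fun v => F (t1 v)).
Proof.
  intros HF H1. apply (D_app2 (fun z x => z = F x)).
  - exact HF.
  - apply DefTerm_var.
  - now apply (DefTerm_ren S).
Qed.

Lemma DefTerm_app2 F t1 t2 : DefFun2 F -> DefTerm t1 -> DefTerm t2 ->
  DefTerm (fun v => F (t1 v) (t2 v)).
Proof.
  intros HF H1 H2. apply (D_app3 (fun z x y => z = F x y)).
  - exact HF.
  - apply DefTerm_var.
  - now apply (DefTerm_ren S).
  - now apply (DefTerm_ren S).
Qed.

Lemma DefTerm_app3 F t1 t2 t3 : DefFun3 F -> DefTerm t1 -> DefTerm t2 -> DefTerm t3 ->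
  DefTerm (fun v => F (t1 v) (t2 v) (t3 v)).
Proof.
  intros HF H1 H2 H3. apply (D_app4 (fun z x y w => z = F x y w)).
  - exact HF.
  - apply DefTerm_var.
  - now apply (DefTerm_ren S).
  - now apply (DefTerm_ren S).
  - now apply (DefTerm_ren S).
Qed.

Lemma DefTerm_app4 F t1 t2 t3 t4 : DefFun4 F ->
  DefTerm t1 -> DefTerm t2 -> DefTerm t3 -> DefTerm t4 ->
  DefTerm (fun v => F (t1 v) (t2 v) (t3 v) (t4 v)).
Proof.
  intros HF H1 H2 H3 H4. apply (D_app5 (fun z x y w u => z = F x y w u)).
  - exact HF.
  - apply DefTerm_var.
  - now apply (DefTerm_ren S).
  - now apply (DefTerm_ren S).
  - now apply (DefTerm_ren S).
  - now apply (DefTerm_ren S).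
Qed.

(** All variables but the first are frozen and become additional parameters; this is the unary form
    that Separation accepts. *)
Lemma Def1_section (Q : M -> (nat -> M) -> Prop) v :
  Definable (fun v => Q (v 0) (fun i => v (S i))) -> Def1 (fun z => Q z v).
Proof.
  intros (p & ps & Hp).
  exists (ren (on_parity (fun i => match i with O => O | S j => S (2 * (2 * j)) end)
                         (fun i => S (2 * S (2 * i)))) p), (mix v ps).
  intros u. rewrite (Hp (scons (u 0) v)). symmetry. apply sat_parity.
  - intros [|i]; [reflexivity|]. now rewrite mix_odd, mix_even.
  - intros i. now rewrite mix_odd, mix_odd.
Qed.

Lemma extensionality (x y : M) : (forall z, z ∈ x <-> z ∈ y) -> x = y.
Proof. apply (ZF_extensionality HM). Qed.

(** For definable [P] the set is unique by extensionality, so [epsilon] brings no choice into the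
    model; for other [P] the value is arbitrary. *)
Definition sep : M -> (M -> Prop) -> M := proj1_sig (sealed (fun X P =>
  epsilon (inhabits X) (fun u => forall z, z ∈ u <-> z ∈ X /\ P z))).

Lemma sepP X P z : Def1 P -> (z ∈ sep X P <-> z ∈ X /\ P z).
Proof.
  intros (p & ps & Hp). unfold sep. unseal. revert z. apply epsilon_spec.
  destruct (ZF_separation HM (ren (on_parity (fun i => match i with O => O | S j => S (2 * j) end)
                         (fun i => S (S (2 * i)))) p) (mix (fun _ => X) ps) X) as [u Hu].
  exists u. intros z. rewrite Hu, sat_under_binder, <- Hp. reflexivity.
Qed.

Lemma DefTerm_sep X (Q : M -> (nat -> M) -> Prop) :
  DefTerm X -> Definable (fun v => Q (v 0) (fun i => v (S i))) ->
  DefTerm (fun v => sep (X v) (fun z => Q z v)).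
Proof.
  intros HX HQ.
  apply (D_equiv _ (fun v => forall z, z ∈ v 0 <-> z ∈ X (fun i => v (S i)) /\ Q z (fun i => v (S i)))).
  - intros v. split.
    + intros -> z. apply sepP. apply (Def1_section Q _ HQ).
    + intros H. apply extensionality. intros z. rewrite H. symmetry. apply sepP.
      apply (Def1_section Q _ HQ).
  - apply D_all, D_iff; [|apply D_and].
    + apply (D_app2 _ _ _ D_mem); apply DefTerm_var.
    + apply (D_app2 _ _ (fun v => X (fun i => v (S (S i)))) D_mem); [apply DefTerm_var|].
      now apply (DefTerm_ren (fun i => S (S i))).
    + exact (D_ren (fun j => match j with O => O | S j => S (S j) end) _ HQ).
Qed.

End Definability.

(* Automatic proofs of definability *)
Create HintDb defs.
#[global] Hint Resolve D_eq D_mem : defs.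

(** Recursion on the syntax of the predicate, with applied symbols looked up in [defs]. If a symbol
    is not found at full arity, its leading arguments are tried as fixed parameters; this handles
    symbols that depend on section variables such as [FA]. *)
Ltac defi :=
  cbv beta;
  lazymatch goal with
  | |- Def1 _ => unfold Def1; defi
  | |- Def2 _ => unfold Def2; defi
  | |- Def3 _ => unfold Def3; defi
  | |- Def4 _ => unfold Def4; defi
  | |- Def5 _ => unfold Def5; defi
  | |- DefFun1 _ => unfold DefFun1, Def2; defi
  | |- DefFun2 _ => unfold DefFun2, Def3; defi
  | |- DefFun3 _ => unfold DefFun3, Def4; defi
  | |- DefFun4 _ => unfold DefFun4, Def5; defi
  | |- Definable (fun _ => ?P) => apply D_const
  | |- Definable (fun _ => _ /\ _) => apply D_and; defi
  | |- Definable (fun _ => _ \/ _) => apply D_or; defi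
  | |- Definable (fun _ => _ <-> _) => apply D_iff; defi
  | |- Definable (fun _ => ~ _) => apply D_not; defi
  | |- Definable (fun _ => exists _, _) => apply D_ex; defi
  | |- Definable (fun _ => forall _, _) => first [apply D_imp; defi | apply D_all; defi]
  | |- DefTerm (fun _ => ?a) => apply DefTerm_const
  | |- DefTerm (fun v => v ?i) => apply DefTerm_var
  | |- DefTerm (fun v => sep _ _) => apply DefTerm_sep; defi
  | |- Definable (fun v => ?R (@?a v) (@?b v) (@?c v) (@?d v) (@?e v)) =>
      first [ apply (D_app5 R a b c d e); [solve [auto with defs nocore] | defi ..]
            | apply (D_app4 (R _) b c d e); [solve [auto with defs nocore] | defi ..]
            | apply (D_app3 (R _ _) c d e); [solve [auto with defs nocore] | defi ..]
            | apply (D_app2 (R _ _ _) d e); [solve [auto with defs nocore] | defi ..]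
            | apply (D_app1 (R _ _ _ _) e); [solve [auto with defs nocore] | defi ..] ]
  | |- Definable (fun v => ?R (@?a v) (@?b v) (@?c v) (@?d v)) =>
      first [ apply (D_app4 R a b c d); [solve [auto with defs nocore] | defi ..]
            | apply (D_app3 (R _) b c d); [solve [auto with defs nocore] | defi ..]
            | apply (D_app2 (R _ _) c d); [solve [auto with defs nocore] | defi ..]
            | apply (D_app1 (R _ _ _) d); [solve [auto with defs nocore] | defi ..] ]
  | |- Definable (fun v => ?R (@?a v) (@?b v) (@?c v)) =>
      first [ apply (D_app3 R a b c); [solve [auto with defs nocore] | defi ..]
            | apply (D_app2 (R _) b c); [solve [auto with defs nocore] | defi ..]
            | apply (D_app1 (R _ _) c); [solve [auto with defs nocore] | defi ..] ]
  | |- Definable (fun v => ?R (@?a v) (@?b v)) =>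
      first [ apply (D_app2 R a b); [solve [auto with defs nocore] | defi ..]
            | apply (D_app1 (R _) b); [solve [auto with defs nocore] | defi ..] ]
  | |- Definable (fun v => ?R (@?a v)) =>
      apply (D_app1 R a); [solve [auto with defs nocore] | defi]
  | |- DefTerm (fun v => ?R (@?a v) (@?b v) (@?c v) (@?d v)) =>
      first [ apply (DefTerm_app4 R a b c d); [solve [auto with defs nocore] | defi ..]
            | apply (DefTerm_app3 (R _) b c d); [solve [auto with defs nocore] | defi ..]
            | apply (DefTerm_app2 (R _ _) c d); [solve [auto with defs nocore] | defi ..]
            | apply (DefTerm_app1 (R _ _ _) d); [solve [auto with defs nocore] | defi ..] ]
  | |- DefTerm (fun v => ?R (@?a v) (@?b v) (@?c v)) =>
      first [ apply (DefTerm_app3 R a b c); [solve [auto with defs nocore] | defi ..]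
            | apply (DefTerm_app2 (R _) b c); [solve [auto with defs nocore] | defi ..]
            | apply (DefTerm_app1 (R _ _) c); [solve [auto with defs nocore] | defi ..] ]
  | |- DefTerm (fun v => ?R (@?a v) (@?b v)) =>
      first [ apply (DefTerm_app2 R a b); [solve [auto with defs nocore] | defi ..]
            | apply (DefTerm_app1 (R _) b); [solve [auto with defs nocore] | defi ..] ]
  | |- DefTerm (fun v => ?R (@?a v)) =>
      apply (DefTerm_app1 R a); [solve [auto with defs nocore] | defi]
  end.

(** * Basic sets *)

Section BasicSets.

Context {M : set_structure} {HM : ZF M}.
Implicit Types x y z a b s t X Y f g p : M.

(** Extensionality expresses the graph of [F] by the elements of its values, so an operation
    introduced by [epsilon] becomes definable as soon as its membership relation is. *)
Lemma DefFun1_ext (F : M -> M) (R : M -> M -> Prop) :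
  (forall x z, z ∈ F x <-> R z x) -> Def2 R -> DefFun1 F.
Proof.
  intros H HR. apply (D_equiv _ (fun v => forall z, z ∈ v 0 <-> R z (v 1))).
  - intros v. split.
    + intros -> z. apply H.
    + intros E. apply extensionality. intros z. now rewrite E, H.
  - defi.
Qed.

Lemma DefFun2_ext (F : M -> M -> M) (R : M -> M -> M -> Prop) :
  (forall x y z, z ∈ F x y <-> R z x y) -> Def3 R -> DefFun2 F.
Proof.
  intros H HR. apply (D_equiv _ (fun v => forall z, z ∈ v 0 <-> R z (v 1) (v 2))).
  - intros v. split.
    + intros -> z. apply H.
    + intros E. apply extensionality. intros z. now rewrite E, H.
  - defi.
Qed.

Lemma Def_subset : Def2 (@subset M).
Proof. unfold subset. defi. Qed.
Hint Resolve Def_subset : defs.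

Lemma subset_refl x : subset x x.
Proof. intros z; auto. Qed.

Lemma subset_trans x y z : subset x y -> subset y z -> subset x z.
Proof. intros H1 H2 w; auto. Qed.

Lemma subset_antisym x y : subset x y -> subset y x -> x = y.
Proof. intros H1 H2. apply extensionality. split; auto. Qed.

Definition upair : M -> M -> M :=
  proj1_sig (sealed (fun x y => epsilon (inhabits x) (fun z => is_unordered_pair z x y))).

Lemma in_upair x y z : z ∈ upair x y <-> z = x \/ z = y.
Proof.
  revert z. unfold upair. unseal. apply epsilon_spec. apply (ZF_pairing HM).
Qed.

Definition sing x := upair x x.

Lemma in_sing x z : z ∈ sing x <-> z = x.
Proof. unfold sing. rewrite in_upair. tauto. Qed.

Definition bigU : M -> M := proj1_sig (sealed (fun x =>
  epsilon (inhabits x) (fun u => forall z, z ∈ u <-> exists y, y ∈ x /\ z ∈ y))).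

Lemma in_bigU x z : z ∈ bigU x <-> exists y, y ∈ x /\ z ∈ y.
Proof. revert z. unfold bigU. unseal. apply epsilon_spec. apply (ZF_union HM). Qed.

Definition Pow : M -> M := proj1_sig (sealed (fun x =>
  epsilon (inhabits x) (fun u => forall z, z ∈ u <-> subset z x))).

Lemma in_Pow x z : z ∈ Pow x <-> subset z x.
Proof. revert z. unfold Pow. unseal. apply epsilon_spec. apply (ZF_power_set HM). Qed.

Definition un x y := bigU (upair x y).

Lemma in_un x y z : z ∈ un x y <-> z ∈ x \/ z ∈ y.
Proof.
  unfold un. rewrite in_bigU. split.
  - intros (w & Hw & Hz). apply in_upair in Hw. destruct Hw as [->| ->]; auto.
  - intros [H|H]; [exists x|exists y]; rewrite in_upair; auto.
Qed.

Definition ins a s := un s (sing a).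

Lemma in_ins a s z : z ∈ ins a s <-> z ∈ s \/ z = a.
Proof. unfold ins. now rewrite in_un, in_sing. Qed.

Lemma Def_upair : DefFun2 upair.
Proof. apply (DefFun2_ext _ (fun z x y => z = x \/ z = y)). exact in_upair. defi. Qed.
Hint Resolve Def_upair : defs.

Lemma Def_sing : DefFun1 sing.
Proof. unfold sing. defi. Qed.

Lemma Def_bigU : DefFun1 bigU.
Proof. apply (DefFun1_ext _ (fun z x => exists y, y ∈ x /\ z ∈ y)). exact in_bigU. defi. Qed.

Lemma Def_Pow : DefFun1 Pow.
Proof. apply (DefFun1_ext _ (fun z x => subset z x)). exact in_Pow. defi. Qed.
Hint Resolve Def_sing Def_bigU Def_Pow : defs.

Lemma Def_un : DefFun2 un.
Proof. unfold un. defi. Qed.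
Hint Resolve Def_un : defs.

Lemma Def_ins : DefFun2 ins.
Proof. unfold ins. defi. Qed.
Hint Resolve Def_ins : defs.

Definition emp : M := epsilon model_inhabited is_empty.

Lemma in_emp z : ~ z ∈ emp.
Proof.
  revert z. change (is_empty emp). unfold emp. apply epsilon_spec.
  destruct model_inhabited as [a]. exists (sep a (fun _ => False)).
  intros z Hz. apply sepP in Hz; [tauto|defi].
Qed.

Lemma emp_unique x : (forall z, ~ z ∈ x) -> x = emp.
Proof.
  intros H. apply extensionality. intros z. split; intros Hz.
  - destruct (H z Hz).
  - destruct (in_emp z Hz).
Qed.

Lemma nonempty x : x <> emp -> exists z, z ∈ x.
Proof.
  intros H. apply NNPP. intros N. apply H, emp_unique. intros z Hz. eauto.
Qed.

Definition diff x y := sep x (fun z => ~ z ∈ y).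

Lemma in_diff x y z : z ∈ diff x y <-> z ∈ x /\ ~ z ∈ y.
Proof. unfold diff. rewrite sepP by defi. reflexivity. Qed.

Definition pair x y := upair (sing x) (upair x y).

Lemma in_pair x y z : z ∈ pair x y <-> z = sing x \/ z = upair x y.
Proof. apply in_upair. Qed.

Lemma Def_diff : DefFun2 diff.
Proof. unfold diff. defi. Qed.

Lemma Def_pair : DefFun2 pair.
Proof. unfold pair. defi. Qed.
Hint Resolve Def_diff Def_pair : defs.

Lemma upair_inj_r a x y : upair a x = upair a y -> x = y.
Proof.
  intros H. assert (Hx : x ∈ upair a y) by (rewrite <- H, in_upair; auto).
  assert (Hy : y ∈ upair a x) by (rewrite H, in_upair; auto).
  rewrite in_upair in Hx, Hy. destruct Hx, Hy; congruence.
Qed.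

Lemma sing_inj x y : sing x = sing y -> x = y.
Proof.
  intros H. assert (Hx : x ∈ sing y) by (rewrite <- H; now apply in_sing). now apply in_sing.
Qed.

Lemma pair_inj x y x' y' : pair x y = pair x' y' -> x = x' /\ y = y'.
Proof.
  unfold pair. intros H.
  assert (E : x = x').
  { assert (H1 : sing x ∈ upair (sing x') (upair x' y')) by (rewrite <- H, in_upair; auto).
    apply in_upair in H1. destruct H1 as [H1|H1].
    - now apply sing_inj.
    - assert (H2 : x' ∈ sing x) by (rewrite H1, in_upair; auto).
      symmetry. now apply in_sing. }
  subst x'. split; [reflexivity|].
  apply upair_inj_r in H. now apply upair_inj_r in H.
Qed.

Lemma is_ordered_pairE p x y : is_ordered_pair p x y <-> p = pair x y.
Proof.
  assert (U : forall p a b, is_unordered_pair p a b <-> p = upair a b).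
  { intros q a b. split.
    - intros H. apply extensionality. intros z. now rewrite (H z), in_upair.
    - intros ->. exact (in_upair a b). }
  unfold is_ordered_pair. split.
  - intros (s & t & H1 & H2 & H3). apply U in H1, H2, H3. now subst.
  - intros ->. exists (sing x), (upair x y). rewrite !U. auto.
Qed.

Lemma maps_toE f x y : maps_to f x y <-> pair x y ∈ f.
Proof.
  unfold maps_to. split.
  - intros (p & Hp & H). apply is_ordered_pairE in Hp. now subst.
  - intros H. exists (pair x y). rewrite is_ordered_pairE. auto.
Qed.

Definition prod X Y :=
  sep (Pow (Pow (un X Y))) (fun p => exists x y, x ∈ X /\ y ∈ Y /\ p = pair x y).

Lemma in_prod X Y p : p ∈ prod X Y <-> exists x y, x ∈ X /\ y ∈ Y /\ p = pair x y.
Proof.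
  unfold prod. rewrite sepP by defi. split; [tauto|]. intros H. split; [|exact H].
  destruct H as (x & y & Hx & Hy & ->).
  apply in_Pow. intros z Hz. apply in_upair in Hz. apply in_Pow. intros w Hw. apply in_un.
  destruct Hz as [-> | ->].
  - apply in_sing in Hw. subst; auto.
  - apply in_upair in Hw. destruct Hw; subst; auto.
Qed.

Lemma in_prod_pair X Y x y : pair x y ∈ prod X Y <-> x ∈ X /\ y ∈ Y.
Proof.
  rewrite in_prod. split.
  - intros (x' & y' & Hx & Hy & E). apply pair_inj in E. destruct E; now subst.
  - intros []. eauto.
Qed.

Lemma Def_prod : DefFun2 prod.
Proof. unfold prod. defi. Qed.
Hint Resolve Def_prod : defs.

(* Definite description; junk unless exactly one element of [X] satisfies [P]. *)
Definition the X (P : M -> Prop) := bigU (sep X P).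

Lemma theP X (P : M -> Prop) y :
  Def1 P -> y ∈ X -> P y -> (forall y', y' ∈ X -> P y' -> y' = y) -> the X P = y.
Proof.
  intros HP Hy H U. unfold the. apply extensionality. intros z. rewrite in_bigU. split.
  - intros (w & Hw & Hz). apply sepP in Hw; [|exact HP]. destruct Hw as [Hw Pw].
    now rewrite <- (U w Hw Pw).
  - intros Hz. exists y. split; [|exact Hz]. now apply sepP.
Qed.

Lemma Def_is_empty : Def1 (@is_empty M).
Proof. unfold is_empty. defi. Qed.

Lemma Def_is_successor : Def2 (@is_successor M).
Proof. unfold is_successor. defi. Qed.
Hint Resolve Def_is_empty Def_is_successor : defs.

Lemma Def_inductive_set : Def1 (@inductive_set M).
Proof. unfold inductive_set. defi. Qed.
Hint Resolve Def_inductive_set : defs.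

Lemma Def_is_natural : Def1 (@is_natural M).
Proof. unfold is_natural. defi. Qed.
Hint Resolve Def_is_natural : defs.

Lemma Def_maps_to : Def3 (@maps_to M).
Proof.
  apply (D_equiv _ (fun v => pair (v 1) (v 2) ∈ v 0)).
  - intros v. apply maps_toE.
  - defi.
Qed.

Lemma Def_is_ordered_pair : Def3 (@is_ordered_pair M).
Proof.
  apply (D_equiv _ (fun v => v 0 = pair (v 1) (v 2))).
  - intros v. apply is_ordered_pairE.
  - defi.
Qed.
Hint Resolve Def_maps_to Def_is_ordered_pair : defs.

Lemma Def_is_function : Def3 (@is_function M).
Proof. unfold is_function, unique. defi. Qed.
Hint Resolve Def_is_function : defs.

Lemma Def_is_injection : Def3 (@is_injection M).
Proof. unfold is_injection. defi. Qed.
Hint Resolve Def_is_injection : defs.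

Lemma Def_is_bijection : Def3 (@is_bijection M).
Proof. unfold is_bijection. defi. Qed.
Hint Resolve Def_is_bijection : defs.

Lemma Def_finite_set : Def1 (@finite_set M).
Proof. unfold finite_set. defi. Qed.

End BasicSets.

#[global] Hint Resolve Def_subset Def_upair Def_sing Def_bigU Def_Pow Def_un Def_ins
  Def_diff Def_pair Def_prod Def_is_empty Def_is_natural Def_is_bijection Def_finite_set : defs.

(** * Finite sets *)

Section FiniteSets.

Context {M : set_structure} {HM : ZF M}.
Implicit Types x y z a b c s t X Y f g p n : M.

Lemma natural_emp : is_natural emp.
Proof.
  intros w [(x & Hx & Hw) _]. now rewrite <- (emp_unique x Hx).
Qed.

Lemma successorE y x : is_successor y x <-> y = ins x x.
Proof.
  split.
  - intros H. apply extensionality. intros z. now rewrite (H z), in_ins.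
  - intros ->. exact (in_ins x x).
Qed.

Lemma natural_succ n : is_natural n -> is_natural (ins n n).
Proof.
  intros H w Hw. destruct Hw as [H0 H1]. destruct (H1 n (H w (conj H0 H1))) as (y & Hy & Hyw).
  apply successorE in Hy. now subst.
Qed.

Lemma natural_induction (P : M -> Prop) : Def1 P -> P emp ->
  (forall n, is_natural n -> P n -> P (ins n n)) -> forall n, is_natural n -> P n.
Proof.
  intros HP P0 PS n Hn. destruct (ZF_infinity HM) as [w [(e & He & Hew) Hw]].
  assert (D : Def1 (fun x => is_natural x /\ P x)) by defi.
  assert (I : inductive_set (sep w (fun x => is_natural x /\ P x))).
  { split.
    - exists e. split; [exact He|]. rewrite (emp_unique e He) in *.
      apply sepP; [exact D|]. split; [exact Hew|]. split; [exact natural_emp|exact P0].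
    - intros x Hx. apply sepP in Hx; [|exact D]. destruct Hx as (Hxw & Nx & Px).
      destruct (Hw x Hxw) as (y & Hy & Hyw). exists y. split; [exact Hy|].
      apply successorE in Hy. subst y.
      apply sepP; [exact D|]. repeat split; auto using natural_succ. }
  specialize (Hn _ I). apply sepP in Hn; [tauto|exact D].
Qed.

Lemma mem_irrefl x : ~ x ∈ x.
Proof.
  intros H. destruct (ZF_foundation HM (x := sing x)) as (y & Hy & Hz).
  - intros E. apply (E x). now apply in_sing.
  - apply in_sing in Hy. subst y. apply (Hz x); [now apply in_sing|exact H].
Qed.

Lemma is_bijectionE g x y : is_bijection g x y <->
  (forall p, p ∈ g -> exists u v, u ∈ x /\ v ∈ y /\ p = pair u v) /\
  (forall u, u ∈ x -> exists v, pair u v ∈ g) /\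
  (forall u v v', pair u v ∈ g -> pair u v' ∈ g -> v = v') /\
  (forall u u' v, pair u v ∈ g -> pair u' v ∈ g -> u = u') /\
  (forall v, v ∈ y -> exists u, pair u v ∈ g).
Proof.
  split.
  - intros [[[H1 H2] H3] H4].
    assert (D : forall p, p ∈ g -> exists u v, u ∈ x /\ v ∈ y /\ p = pair u v).
    { intros p Hp. destruct (H1 p Hp) as (u & v & Hu & Hv & E). apply is_ordered_pairE in E.
      eauto 6. }
    assert (D1 : forall u v, pair u v ∈ g -> u ∈ x).
    { intros u v H. destruct (D _ H) as (u' & v' & Hu & _ & E). apply pair_inj in E.
      destruct E; now subst. }
    split; [exact D|]. split; [|split; [|split]].
    + intros u Hu. destruct (H2 u Hu) as (v & Hv & _). apply maps_toE in Hv. eauto.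
    + intros u v v' Hv Hv'. destruct (H2 u (D1 _ _ Hv)) as (w & _ & U).
      rewrite <- (U v), <- (U v'); [reflexivity| |]; now apply maps_toE.
    + intros u u' v Hu Hu'. apply (H3 u u' v); now apply maps_toE.
    + intros v Hv. destruct (H4 v Hv) as (u & Hu). apply maps_toE in Hu. eauto.
  - intros (H1 & H2 & H3 & H4 & H5). split; [split; [split|]|].
    + intros p Hp. destruct (H1 p Hp) as (u & v & Hu & Hv & ->). exists u, v.
      rewrite is_ordered_pairE. auto.
    + intros u Hu. destruct (H2 u Hu) as (v & Hv). exists v. split; [now apply maps_toE|].
      intros v' Hv'. apply maps_toE in Hv'. eauto.
    + intros u u' v Hu Hu'. apply maps_toE in Hu, Hu'. eauto.
    + intros v Hv. destruct (H5 v Hv) as (u & Hu). exists u. now apply maps_toE.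
Qed.

Lemma finite_emp : finite_set emp.
Proof.
  exists emp, emp. split; [exact natural_emp|]. apply is_bijectionE.
  repeat split; intros; exfalso; eapply in_emp; eassumption.
Qed.

Lemma ins_id a s : a ∈ s -> ins a s = s.
Proof.
  intros H. apply extensionality. intros z. rewrite in_ins. split; [|tauto].
  intros [H'|H']; [exact H'|now subst].
Qed.

Lemma finite_ins a s : finite_set s -> finite_set (ins a s).
Proof.
  intros Hs. destruct (classic (a ∈ s)) as [Ha|Ha]; [now rewrite ins_id|].
  destruct Hs as (n & g & Hn & Hg). apply is_bijectionE in Hg.
  destruct Hg as (H1 & H2 & H3 & H4 & H5).
  assert (D : forall u v, pair u v ∈ g -> u ∈ s /\ v ∈ n).
  { intros u v H. destruct (H1 _ H) as (u' & v' & Hu & Hv & E). apply pair_inj in E.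
    destruct E; now subst. }
  exists (ins n n), (ins (pair a n) g). split; [now apply natural_succ|].
  apply is_bijectionE. split; [|split; [|split; [|split]]].
  - intros p Hp. apply in_ins in Hp. destruct Hp as [Hp| ->].
    + destruct (H1 p Hp) as (u & v & Hu & Hv & ->). exists u, v. rewrite !in_ins. auto.
    + exists a, n. rewrite !in_ins. auto.
  - intros u Hu. apply in_ins in Hu. destruct Hu as [Hu| ->].
    + destruct (H2 u Hu) as [v Hv]. exists v. rewrite in_ins. auto.
    + exists n. rewrite in_ins. auto.
  - intros u v v' Hv Hv'. apply in_ins in Hv, Hv'.
    destruct Hv as [Hv|Hv], Hv' as [Hv'|Hv'].
    + eauto.
    + apply pair_inj in Hv'. destruct Hv'; subst. apply D in Hv. tauto.
    + apply pair_inj in Hv. destruct Hv; subst. apply D in Hv'. tauto.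
    + apply pair_inj in Hv, Hv'. intuition congruence.
  - intros u u' v Hu Hu'. apply in_ins in Hu, Hu'.
    destruct Hu as [Hu|Hu], Hu' as [Hu'|Hu'].
    + eauto.
    + apply pair_inj in Hu'. destruct Hu'; subst. apply D in Hu. destruct (mem_irrefl n); tauto.
    + apply pair_inj in Hu. destruct Hu; subst. apply D in Hu'. destruct (mem_irrefl n); tauto.
    + apply pair_inj in Hu, Hu'. intuition congruence.
  - intros v Hv. apply in_ins in Hv. destruct Hv as [Hv| ->].
    + destruct (H5 v Hv) as [u Hu]. exists u. rewrite in_ins. auto.
    + exists a. rewrite in_ins. auto.
Qed.

(** Induction on the natural number in bijection with [x]: the element sent to the last number is
    split off. Nearly all later finiteness arguments use this instead of numbers and bijections. *)
Lemma finite_induction (P : M -> Prop) : Def1 P -> P emp ->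
  (forall s a, finite_set s -> ~ a ∈ s -> P s -> P (ins a s)) ->
  forall x, finite_set x -> P x.
Proof.
  intros HP P0 PS.
  enough (G : forall n, is_natural n -> forall x g, is_bijection g x n -> finite_set x /\ P x).
  { intros x (n & g & Hn & Hg). now apply (G n Hn x g). }
  refine (natural_induction _ _ _ _).
  - defi.
  - intros x g Hg. apply is_bijectionE in Hg. destruct Hg as (H1 & H2 & _).
    rewrite (emp_unique x); [split; [exact finite_emp|exact P0]|].
    intros z Hz. destruct (H2 z Hz) as [v Hv]. destruct (H1 _ Hv) as (_ & w & _ & Hw & _).
    exact (in_emp w Hw).
  - intros n Hn IH x g Hg. apply is_bijectionE in Hg.
    destruct Hg as (H1 & H2 & H3 & H4 & H5).
    assert (D : forall u v, pair u v ∈ g -> u ∈ x /\ v ∈ ins n n).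
    { intros u v H. destruct (H1 _ H) as (u' & v' & Hu & Hv & E). apply pair_inj in E.
      destruct E; now subst. }
    destruct (H5 n) as [a Ha]; [apply in_ins; auto|].
    assert (Ex : x = ins a (diff x (sing a))).
    { apply extensionality. intros z. rewrite in_ins, in_diff, in_sing.
      destruct (classic (z = a)) as [->|N]; [|tauto]. apply D in Ha. tauto. }
    assert (F : finite_set (diff x (sing a)) /\ P (diff x (sing a))).
    { apply (IH _ (diff g (sing (pair a n)))). apply is_bijectionE.
      split; [|split; [|split; [|split]]].
      - intros p Hp. apply in_diff in Hp. destruct Hp as [Hp Np]. rewrite in_sing in Np.
        destruct (H1 p Hp) as (u & v & Hu & Hv & ->). exists u, v.
        rewrite in_diff, in_sing. apply in_ins in Hv. destruct Hv as [Hv| ->].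
        + repeat split; auto. intros ->. rewrite (H3 _ _ _ Hp Ha) in Hv. exact (mem_irrefl n Hv).
        + destruct Np. now rewrite (H4 _ _ _ Hp Ha).
      - intros u Hu. apply in_diff in Hu. destruct Hu as [Hu Nu]. rewrite in_sing in Nu.
        destruct (H2 u Hu) as [v Hv]. exists v. rewrite in_diff, in_sing. split; [exact Hv|].
        intros E. apply pair_inj in E. tauto.
      - intros u v v' Hv Hv'. apply in_diff in Hv, Hv'. eapply H3; [apply Hv|apply Hv'].
      - intros u v v' Hv Hv'. apply in_diff in Hv, Hv'. eapply H4; [apply Hv|apply Hv'].
      - intros v Hv. destruct (H5 v) as [u Hu]; [apply in_ins; auto|]. exists u.
        rewrite in_diff, in_sing. split; [exact Hu|]. intros E. apply pair_inj in E.
        destruct E; subst. exact (mem_irrefl n Hv). }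
    destruct F as [F1 F2]. rewrite Ex. split; [now apply finite_ins|].
    apply PS; auto. rewrite in_diff, in_sing. tauto.
Qed.

Lemma finite_subset x y : finite_set x -> subset y x -> finite_set y.
Proof.
  intros Hx. revert y. pattern x. revert x Hx. refine (finite_induction _ _ _ _).
  - defi.
  - intros y Hy. rewrite (emp_unique y); [exact finite_emp|].
    intros z Hz. exact (in_emp z (Hy z Hz)).
  - intros s a Hs Ha IH y Hy. destruct (classic (a ∈ y)) as [Hay|Hay].
    + replace y with (ins a (diff y (sing a))).
      * apply finite_ins, IH. intros z Hz. apply in_diff in Hz. rewrite in_sing in Hz.
        destruct Hz as [Hz Nz]. specialize (Hy z Hz). apply in_ins in Hy. tauto.
      * apply extensionality. intros z. rewrite in_ins, in_diff, in_sing.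
        destruct (classic (z = a)); [subst; tauto|tauto].
    + apply IH. intros z Hz. specialize (Hy z Hz). apply in_ins in Hy.
      destruct Hy as [Hy| ->]; tauto.
Qed.

Lemma ins_emp a : ins a emp = sing a.
Proof.
  apply extensionality. intros z. rewrite in_ins, in_sing. split; [|tauto].
  intros [H|H]; [destruct (in_emp z H)|exact H].
Qed.

Lemma finite_sing a : finite_set (sing a).
Proof. rewrite <- ins_emp. apply finite_ins, finite_emp. Qed.

Lemma finite_un x y : finite_set x -> finite_set y -> finite_set (un x y).
Proof.
  intros Hx Hy. pattern x. revert x Hx. refine (finite_induction _ _ _ _).
  - defi.
  - apply (finite_subset y); [exact Hy|]. intros z Hz. apply in_un in Hz.
    destruct Hz as [Hz|Hz]; [destruct (in_emp z Hz)|exact Hz].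
  - intros s a _ _ IH. apply (finite_subset (ins a (un s y))); [now apply finite_ins|].
    intros z. rewrite !in_ins, !in_un, in_ins. tauto.
Qed.

Lemma finite_upair a b : finite_set (upair a b).
Proof.
  apply (finite_subset (un (sing a) (sing b))); [apply finite_un; apply finite_sing|].
  intros z. rewrite in_upair, in_un, !in_sing. tauto.
Qed.

(** The pieces are the sections of one relation, so induction on the index set can add one section
    at a time without choosing enumerations of them. *)
Lemma finite_Union (R : M -> M -> Prop) Y x : Def2 R -> finite_set x ->
  (forall u, u ∈ x -> finite_set (sep Y (R u))) ->
  finite_set (sep Y (fun z => exists u, u ∈ x /\ R u z)).
Proof.
  intros HR Hx H.
  assert (HR1 : forall u, Def1 (R u)) by (intros u; defi).
  enough (G : forall s, finite_set s -> subset s x ->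
                finite_set (sep Y (fun z => exists u, u ∈ s /\ R u z))).
  { apply G; [exact Hx|apply subset_refl]. }
  refine (finite_induction _ _ _ _).
  - defi.
  - intros _. apply (finite_subset emp); [exact finite_emp|]. intros z Hz.
    apply sepP in Hz; [|defi]. destruct Hz as (_ & u & Hu & _). destruct (in_emp u Hu).
  - intros s a _ _ IH Hs.
    apply (finite_subset (un (sep Y (fun z => exists u, u ∈ s /\ R u z)) (sep Y (R a)))).
    + apply finite_un.
      * apply IH. intros z Hz. apply Hs, in_ins. auto.
      * apply H, Hs, in_ins. auto.
    + intros z Hz. rewrite in_un. apply sepP in Hz; [|defi]. destruct Hz as (Hz & u & Hu & HRu).
      apply in_ins in Hu. rewrite !sepP by (exact (HR1 a) || defi).
      destruct Hu as [Hu| ->]; eauto.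
Qed.

Lemma finite_image (R : M -> M -> Prop) x y : Def2 R -> finite_set y ->
  (forall u u' v, u ∈ x -> u' ∈ x -> v ∈ y -> R v u -> R v u' -> u = u') ->
  (forall u, u ∈ x -> exists v, v ∈ y /\ R v u) -> finite_set x.
Proof.
  intros HR Hy Hf Ht.
  assert (HR1 : forall v, Def1 (R v)) by (intros v; defi).
  apply (finite_subset (sep x (fun u => exists v, v ∈ y /\ R v u))).
  - apply finite_Union; [exact HR|exact Hy|]. intros v Hv.
    destruct (classic (exists u, u ∈ x /\ R v u)) as [(u & Hu & HRu)|N].
    + apply (finite_subset (sing u)); [apply finite_sing|]. intros u' Hu'.
      apply sepP in Hu'; [|exact (HR1 v)]. apply in_sing. apply (Hf u' u v); tauto.
    + apply (finite_subset emp); [exact finite_emp|]. intros u' Hu'.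
      apply sepP in Hu'; [|exact (HR1 v)]. destruct N. eauto.
  - intros u Hu. apply sepP; [defi|]. auto.
Qed.

Lemma finite_Pow x : finite_set x -> finite_set (Pow x).
Proof.
  intros Hx. pattern x. revert x Hx. refine (finite_induction _ _ _ _).
  - defi.
  - apply (finite_subset (sing emp)); [apply finite_sing|]. intros z Hz. apply in_Pow in Hz.
    apply in_sing, emp_unique. intros w Hw. exact (in_emp w (Hz w Hw)).
  - intros s a _ Ha IH.
    apply (finite_subset (sep (Pow (ins a s)) (fun z => exists t, t ∈ Pow s /\ (z = t \/ z = ins a t)))).
    + apply finite_Union with (R := fun t z => z = t \/ z = ins a t); [defi|exact IH|].
      intros t Ht. apply (finite_subset (upair t (ins a t))); [apply finite_upair|].
      intros z Hz. apply sepP in Hz; [|defi]. apply in_upair. tauto.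
    + intros z Hz. apply sepP; [defi|]. split; [exact Hz|]. apply in_Pow in Hz.
      exists (diff z (sing a)). split.
      * apply in_Pow. intros w Hw. apply in_diff in Hw. destruct Hw as [Hw Nw].
        rewrite in_sing in Nw. specialize (Hz w Hw). apply in_ins in Hz. tauto.
      * destruct (classic (a ∈ z)) as [Haz|Haz]; [right|left]; apply extensionality; intros w;
          rewrite ?in_ins, in_diff, in_sing; destruct (classic (w = a)); subst; tauto.
Qed.

Lemma finite_prod x y : finite_set x -> finite_set y -> finite_set (prod x y).
Proof.
  intros Hx Hy.
  apply (finite_subset (sep (prod x y) (fun p => exists u, u ∈ x /\ exists v, v ∈ y /\ p = pair u v))).
  - apply finite_Union with (R := fun u p => exists v, v ∈ y /\ p = pair u v); [defi|exact Hx|].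
    intros u Hu. apply (finite_image (fun v p => p = pair u v) _ y); [defi|exact Hy| |].
    + intros; congruence.
    + intros p Hp. apply sepP in Hp; [tauto|defi].
  - intros p Hp. apply sepP; [defi|]. split; [exact Hp|]. apply in_prod in Hp.
    destruct Hp as (u & v & Hu & Hv & ->). eauto.
Qed.

Lemma finite_natural n : is_natural n -> finite_set n.
Proof.
  apply natural_induction; [defi|exact finite_emp|]. intros; now apply finite_ins.
Qed.

(* Multivalued injections: for finite sets these compare cardinalities just as well
   as functions, and no choice is needed to build them. *)
Definition Emb x y := exists g,
  (forall u, u ∈ x -> exists v, v ∈ y /\ pair u v ∈ g) /\
  (forall u u' v, u ∈ x -> u' ∈ x -> v ∈ y -> pair u v ∈ g -> pair u' v ∈ g -> u = u').

Lemma Def_Emb : Def2 Emb.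
Proof. unfold Emb. defi. Qed.

Lemma Emb_rel (R : M -> M -> Prop) x y : Def2 R ->
  (forall u, u ∈ x -> exists v, v ∈ y /\ R u v) ->
  (forall u u' v, u ∈ x -> u' ∈ x -> v ∈ y -> R u v -> R u' v -> u = u') -> Emb x y.
Proof.
  intros HR H1 H2. exists (sep (prod x y) (fun p => exists u v, p = pair u v /\ R u v)).
  assert (E : forall u v, pair u v ∈ sep (prod x y) (fun p => exists u v, p = pair u v /\ R u v)
              <-> u ∈ x /\ v ∈ y /\ R u v).
  { intros u v. rewrite sepP, in_prod_pair by defi. split.
    - intros ([Hu Hv] & u' & v' & E & H). apply pair_inj in E. destruct E; subst; auto.
    - intros (? & ? & ?). eauto 6. }
  split.
  - intros u Hu. destruct (H1 u Hu) as (v & Hv & H). exists v. rewrite E. auto.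
  - intros u u' v Hu Hu' Hv. rewrite !E. intros. eapply H2 with (v := v); tauto.
Qed.

Lemma Emb_trans x y z : Emb x y -> Emb y z -> Emb x z.
Proof.
  intros (g & G1 & G2) (h & H1 & H2).
  apply (Emb_rel (fun u w => exists v, v ∈ y /\ pair u v ∈ g /\ pair v w ∈ h)); [defi| |].
  - intros u Hu. destruct (G1 u Hu) as (v & Hv & Hg). destruct (H1 v Hv) as (w & Hw & Hh). eauto 6.
  - intros u u' w Hu Hu' Hw (v & Hv & Hg & Hh) (v' & Hv' & Hg' & Hh').
    assert (v = v') by eauto. subst. eauto.
Qed.

Lemma Emb_subset x y : subset x y -> Emb x y.
Proof.
  intros H. apply (Emb_rel (fun u v => u = v)); [defi| |].
  - intros u Hu. exists u. auto.
  - intros; congruence.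
Qed.

Lemma Emb_ins s t a c : Emb s t -> ~ a ∈ s -> ~ c ∈ t -> Emb (ins a s) (ins c t).
Proof.
  intros (g & G1 & G2) Ha Hc.
  apply (Emb_rel (fun u v => (u ∈ s /\ v ∈ t /\ pair u v ∈ g) \/ (u = a /\ v = c))); [defi| |].
  - intros u Hu. apply in_ins in Hu. destruct Hu as [Hu| ->].
    + destruct (G1 u Hu) as (v & Hv & H). exists v. rewrite in_ins. auto.
    + exists c. rewrite in_ins. auto.
  - intros u u' v _ _ _ [(H1 & H2 & H3)|[-> ->]] [(H1' & H2' & H3')|[E1 E2]]; subst; eauto; tauto.
Qed.

(** The induction removes one element from each side. The conclusion is an equality of sets because
    later counting arguments always compare a set with a subset of itself. *)
Lemma pigeonhole x y : finite_set x -> subset y x -> Emb x y -> y = x.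
Proof.
  enough (G : forall x, finite_set x -> forall y, subset y x -> Emb x y -> y <> x -> False).
  { intros Hx Hy HE. apply NNPP. exact (G x Hx y Hy HE). }
  clear x y.
  refine (finite_induction _ _ _ _).
  - pose proof Def_Emb. defi.
  - intros y Hy _ N. apply N, emp_unique. intros z Hz. exact (in_emp z (Hy z Hz)).
  - intros s a Hs Ha IH y Hy (g & G1 & G2) N.
    destruct (classic (a ∈ y)) as [Hay|Hay].
    + assert (C : exists c, c ∈ s /\ ~ c ∈ y).
      { apply NNPP. intros C. apply N, subset_antisym; [exact Hy|]. intros z Hz. apply in_ins in Hz.
        destruct Hz as [Hz| ->]; [|exact Hay]. apply NNPP. intros Nz. eauto. }
      destruct C as (c & Hc & Nc).
      apply (IH (diff y (sing a))).
      * intros z Hz. rewrite in_diff, in_sing in Hz. destruct Hz as [Hz Nz].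
        specialize (Hy z Hz). apply in_ins in Hy. tauto.
      (* To free the value [a], an element that was sent to [a] is rerouted to an image of [a]. *)
      * apply (Emb_rel (fun u v => pair u v ∈ g \/ (pair u a ∈ g /\ pair a v ∈ g))); [defi| |].
        -- intros u Hu. destruct (G1 u) as (v & Hv & Hg); [apply in_ins; auto|].
           destruct (classic (v = a)) as [->|Nv].
           ++ destruct (G1 a) as (w & Hw & Hg'); [apply in_ins; auto|].
              exists w. rewrite in_diff, in_sing. repeat split; auto. intros ->.
              assert (u = a) by (apply (G2 u a a); rewrite ?in_ins; auto). subst; tauto.
           ++ exists v. rewrite in_diff, in_sing. auto.
        -- intros u u' v Hu Hu' Hv H H'. rewrite in_diff, in_sing in Hv. destruct Hv as [Hv Nv].
           assert (Hu1 : u ∈ ins a s) by (rewrite in_ins; auto).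
           assert (Hu1' : u' ∈ ins a s) by (rewrite in_ins; auto).
           assert (Ha1 : a ∈ ins a s) by (rewrite in_ins; auto).
           destruct H as [H|[H1 H2]], H' as [H'|[H1' H2']].
           ++ eauto.
           ++ assert (u = a) by eauto. subst; tauto.
           ++ assert (u' = a) by eauto. subst; tauto.
           ++ eauto.
      * intros E. apply Nc. assert (Hc' : c ∈ diff y (sing a)) by now rewrite E.
        apply in_diff in Hc'. tauto.
    + assert (Hys : subset y s).
      { intros z Hz. specialize (Hy z Hz). apply in_ins in Hy. destruct Hy as [Hy| ->]; tauto. }
      destruct (G1 a) as (c & Hc & Hg); [apply in_ins; auto|].
      apply (IH (diff y (sing c))).
      * intros z Hz. apply in_diff in Hz. apply Hys. tauto.
      * exists g. split.
        -- intros u Hu. destruct (G1 u) as (v & Hv & Hg'); [apply in_ins; auto|]. exists v.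
           rewrite in_diff, in_sing. repeat split; auto. intros ->.
           assert (u = a) by (apply (G2 u a c); rewrite ?in_ins; auto). subst; tauto.
        -- intros u u' v Hu Hu' Hv. apply in_diff in Hv. apply G2; rewrite ?in_ins; tauto.
      * intros E. assert (Hc' : c ∈ diff y (sing c)) by (rewrite E; auto).
        rewrite in_diff, in_sing in Hc'. tauto.
Qed.

Lemma finite_Emb x y : Emb x y -> finite_set y -> finite_set x.
Proof.
  intros (g & G1 & G2) Hy. apply (finite_image (fun v u => pair u v ∈ g) x y); [defi|exact Hy| |].
  - intros u u' v ? ? ?. now apply G2.
  - exact G1.
Qed.

Lemma has_at_most_Emb x n : has_at_most x n -> Emb x n.
Proof.
  intros (g & [G1 G2] & G3). exists g. split.
  - intros u Hu. destruct (G2 u Hu) as (v & Hv & _). exists v. apply maps_toE in Hv.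
    split; [|exact Hv]. destruct (G1 _ Hv) as (u' & v' & _ & Hv' & E).
    apply is_ordered_pairE, pair_inj in E. destruct E; now subst.
  - intros u u' v _ _ _ H H'. apply maps_toE in H, H'. eauto.
Qed.

Lemma infinite_diff x y : infinite_set x -> finite_set y -> infinite_set (diff x y).
Proof.
  intros Hx Hy H. apply Hx. apply (finite_subset (un (diff x y) y)); [now apply finite_un|].
  intros z Hz. rewrite in_un, in_diff. tauto.
Qed.

Lemma infinite_nonempty x : infinite_set x -> exists z, z ∈ x.
Proof. intros H. apply nonempty. intros ->. exact (H finite_emp). Qed.

(** The finitely many choices are absorbed by finite induction. Unlike in [Emb], the relation is
    single-valued, which later keeps the set of all its values finite. *)
Lemma finite_into_infinite x Y : finite_set x -> infinite_set Y -> exists g,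
  (forall u, u ∈ x -> exists v, v ∈ Y /\ pair u v ∈ g) /\
  (forall u u' v, pair u v ∈ g -> pair u' v ∈ g -> u = u') /\
  (forall u v v', pair u v ∈ g -> pair u v' ∈ g -> v = v') /\
  (forall u v, pair u v ∈ g -> u ∈ x /\ v ∈ Y).
Proof.
  intros Hx HY. pattern x. revert x Hx. refine (finite_induction _ _ _ _).
  - defi.
  - exists emp. repeat split; intros; exfalso; eapply in_emp; eassumption.
  - intros s a Hs Ha (g & G1 & G2 & G3 & G4).
    assert (F : finite_set (sep Y (fun v => exists u, u ∈ s /\ pair u v ∈ g))).
    { apply (finite_image (fun u v => pair u v ∈ g) _ s); [defi|exact Hs| |].
      - intros v v' u _ _ _. apply G3.
      - intros v Hv. apply sepP in Hv; [tauto|defi]. }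
    destruct (infinite_nonempty _ (infinite_diff _ _ HY F)) as [c Hc].
    apply in_diff in Hc. destruct Hc as [Hc Nc].
    assert (Nc' : forall u, ~ pair u c ∈ g).
    { intros u Hu. apply Nc, sepP; [defi|]. split; [exact Hc|]. exists u. split; [|exact Hu].
      now apply G4 in Hu. }
    exists (ins (pair a c) g).
    assert (E : forall u v, pair u v ∈ ins (pair a c) g <-> pair u v ∈ g \/ (u = a /\ v = c)).
    { intros u v. rewrite in_ins. split; intros [H|H]; auto.
      - apply pair_inj in H. auto.
      - destruct H; subst; auto. }
    split; [|split; [|split]].
    + intros u Hu. apply in_ins in Hu. destruct Hu as [Hu| ->].
      * destruct (G1 u Hu) as (v & Hv & H). exists v. rewrite E. auto.
      * exists c. rewrite E. auto.
    + intros u u' v. rewrite !E.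
      intros [H|[-> ->]] [H'|[E1 E2]]; subst; eauto; exfalso; eapply Nc'; eassumption.
    + intros u v v'. rewrite !E. intros [H|[-> ->]] [H'|[E1 E2]]; subst; eauto;
        exfalso; apply Ha; eapply G4; eassumption.
    + intros u v. rewrite E, in_ins. intros [H|[-> ->]]; [apply G4 in H; tauto|auto].
Qed.

End FiniteSets.

#[global] Hint Resolve Def_Emb : defs.

(** * Towers *)

Section Towers.

Context {M : set_structure} {HM : ZF M}.

Definition chain (C : M) := forall x y, x ∈ C -> y ∈ C -> subset x y \/ subset y x.

Lemma Def_chain : Def1 chain.
Proof. unfold chain. defi. Qed.
Hint Resolve Def_chain : defs.

(** Unions of chains are demanded only when they stay in [P]. This covers iterations of length ω,
    where [P] consists of finite sets and the union of an infinite chain leaves [P], as well as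
    transfinite ones, where [P] is closed under such unions. *)
Definition admissible (P b : M) (Phi : M -> M) (T : M) :=
  b ∈ T /\ (forall x, x ∈ T -> Phi x ∈ T) /\
  (forall C, subset C T -> C <> emp -> chain C -> bigU C ∈ P -> bigU C ∈ T).

(** The least admissible subset of [P], which plays the role of a transfinite iteration of [Phi]
    from [b] without ordinals. *)
Definition tower (P b : M) (Phi : M -> M) :=
  sep P (fun x => forall T, subset T P -> admissible P b Phi T -> x ∈ T).

(** Definability in a varying parameter is required because each structure runs a tower of its own
    when its family is copied. *)
Lemma Def_tower (P b : M -> M) (Phi : M -> M -> M) :
  DefFun1 P -> DefFun1 b -> DefFun2 Phi -> DefFun1 (fun s => tower (P s) (b s) (Phi s)).
Proof. intros. unfold tower, admissible. defi. Qed.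

Section OneTower.

Variables (P b : M) (Phi : M -> M).
Hypothesis (HPhi : DefFun1 Phi) (HbP : b ∈ P) (Hb : forall x, x ∈ P -> subset b x).
Hypothesis (HP : forall x, x ∈ P -> Phi x ∈ P) (Hinc : forall x, x ∈ P -> subset x (Phi x)).

Notation T := (tower P b Phi).

Lemma in_tower x : x ∈ T <-> x ∈ P /\ forall T', subset T' P -> admissible P b Phi T' -> x ∈ T'.
Proof. unfold tower, admissible. rewrite sepP by defi. reflexivity. Qed.

Lemma tower_sub x : x ∈ T -> x ∈ P.
Proof. intros H. now apply in_tower in H. Qed.

Lemma tower_admissible : admissible P b Phi T.
Proof.
  split; [|split].
  - apply in_tower. split; [exact HbP|]. intros T' _ HT'. apply HT'.
  - intros x Hx. apply in_tower in Hx. destruct Hx as [Hx HT]. apply in_tower. split; [auto|].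
    intros T' S' HT'. apply HT'. now apply HT.
  - intros C HC NC CC UC. apply in_tower. split; [exact UC|]. intros T' S' HT'.
    apply HT'; auto. intros x Hx. apply HC, in_tower in Hx. now apply Hx.
Qed.

Lemma tower_induction (Q : M -> Prop) : Def1 Q -> Q b ->
  (forall x, x ∈ T -> Q x -> Phi x ∈ T -> Q (Phi x)) ->
  (forall C, subset C T -> C <> emp -> chain C -> bigU C ∈ T ->
     (forall x, x ∈ C -> Q x) -> Q (bigU C)) ->
  forall x, x ∈ T -> Q x.
Proof.
  intros HQ Qb QS QU x Hx.
  destruct tower_admissible as (T1 & T2 & T3).
  assert (S1 : subset (sep T Q) T) by (intros z Hz; apply sepP in Hz; tauto).
  assert (A : admissible P b Phi (sep T Q)).
  { split; [|split].
    - apply sepP; auto.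
    - intros z Hz. apply sepP in Hz; [|exact HQ]. apply sepP; [exact HQ|]. split; [|apply QS]; intuition.
    - intros C HC NC CC UC.
      assert (UT : bigU C ∈ T) by (apply T3; eauto using subset_trans).
      apply sepP; [exact HQ|]. split; [exact UT|]. apply QU; auto.
      + eauto using subset_trans.
      + intros z Hz. apply HC, sepP in Hz; tauto. }
  apply in_tower in Hx. destruct Hx as [_ Hx].
  assert (H : x ∈ sep T Q).
  { apply Hx; [|exact A]. intros z Hz. apply tower_sub. auto. }
  apply sepP in H; tauto.
Qed.

(** No step from strictly below [c] jumps over [c]. This is the classical auxiliary notion for
    proving that the tower is a chain. *)
Let extreme c := forall x, x ∈ T -> subset x c -> x <> c -> subset (Phi x) c.

Lemma extreme_cmp c : c ∈ T -> extreme c -> forall x, x ∈ T -> subset x c \/ subset (Phi c) x.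
Proof.
  intros Hc Ec. refine (tower_induction _ _ _ _ _).
  - defi.
  - left. apply Hb. now apply tower_sub.
  - intros x Hx [H|H] _.
    + destruct (classic (x = c)) as [->|N]; [right; apply subset_refl|left; auto].
    + right. eapply subset_trans; [exact H|]. apply Hinc. now apply tower_sub.
  - intros C HC NC CC UC IH.
    destruct (classic (exists x, x ∈ C /\ subset (Phi c) x)) as [(x & Hx & H)|N].
    + right. intros z Hz. apply in_bigU. eauto.
    + left. intros z Hz. apply in_bigU in Hz. destruct Hz as (x & Hx & Hz).
      destruct (IH x Hx) as [H|H]; [auto|]. destruct N. eauto.
Qed.

Lemma all_extreme : forall c, c ∈ T -> extreme c.
Proof.
  refine (tower_induction _ _ _ _ _).
  - unfold extreme. defi.
  - intros x Hx Hxb N. destruct N. apply subset_antisym; auto. apply Hb. now apply tower_sub.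
  - intros c Hc Ec HPc x Hx Hxc N.
    destruct (extreme_cmp c Hc Ec x Hx) as [H|H].
    + destruct (classic (x = c)) as [->|N']; [apply subset_refl|].
      eapply subset_trans; [apply Ec; auto|]. apply Hinc. now apply tower_sub.
    + destruct N. now apply subset_antisym.
  - intros C HC NC CC UC IH x Hx HxC N.
    assert (E : exists c, c ∈ C /\ ~ subset (Phi c) x).
    { apply NNPP. intros E. apply N, subset_antisym; [exact HxC|]. intros z Hz.
      apply in_bigU in Hz. destruct Hz as (c & Hc & Hz).
      destruct (classic (subset (Phi c) x)) as [H|H]; [|destruct E; eauto].
      apply H. assert (HcP : c ∈ P) by (apply tower_sub; auto). now apply (Hinc c HcP). }
    destruct E as (c & Hc & NcC).
    assert (HcU : subset c (bigU C)) by (intros z Hz; apply in_bigU; eauto).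
    destruct (extreme_cmp c (HC c Hc) (IH c Hc) x Hx) as [H|H]; [|tauto].
    destruct (classic (x = c)) as [->|N'].
    + destruct (extreme_cmp c (HC c Hc) (IH c Hc) _ UC) as [H'|H']; [|exact H'].
      destruct N. now apply subset_antisym.
    + eapply subset_trans; [apply (IH c Hc); auto|exact HcU].
Qed.

Lemma tower_cmp x y : x ∈ T -> y ∈ T -> subset x y \/ subset (Phi y) x.
Proof. intros Hx Hy. apply extreme_cmp; auto. now apply all_extreme. Qed.

Lemma tower_chain : chain T.
Proof.
  intros x y Hx Hy. destruct (tower_cmp x y Hx Hy) as [H|H]; [auto|].
  right. eapply subset_trans; [|exact H]. apply Hinc. now apply tower_sub.
Qed.

Lemma tower_fixpoint : bigU T ∈ P -> bigU T ∈ T /\ Phi (bigU T) = bigU T.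
Proof.
  intros HU. destruct tower_admissible as (T1 & T2 & T3).
  assert (HT : bigU T ∈ T).
  { apply T3; auto using subset_refl, tower_chain. intros E. rewrite E in T1. exact (in_emp b T1). }
  split; [exact HT|]. apply subset_antisym; [|now apply Hinc].
  intros z Hz. apply in_bigU. eauto.
Qed.

End OneTower.

(** The tower is a chain, so its union is in [P] and thus is the top of the tower; applying [Phi] to
    the top stays in the tower and cannot exceed it. The fixed point is given by an explicit term,
    so it can be used definably. *)
Theorem bourbaki_witt P b Phi :
  DefFun1 Phi -> b ∈ P -> (forall x, x ∈ P -> subset b x) ->
  (forall x, x ∈ P -> Phi x ∈ P) -> (forall x, x ∈ P -> subset x (Phi x)) ->
  (forall C, subset C P -> C <> emp -> chain C -> bigU C ∈ P) ->
  bigU (tower P b Phi) ∈ P /\ Phi (bigU (tower P b Phi)) = bigU (tower P b Phi).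
Proof.
  intros HPhi HbP Hb HP Hinc HU.
  assert (U : bigU (tower P b Phi) ∈ P).
  { apply HU.
    - intros x. apply tower_sub; auto.
    - intros E. apply (in_emp b). rewrite <- E. now apply tower_admissible.
    - apply tower_chain; auto. }
  split; [exact U|]. apply tower_fixpoint; auto.
Qed.

End Towers.

#[global] Hint Resolve Def_chain : defs.

(** * Counting partitions: [U⁺] differs from [U] once [U] is large *)

Section Growth.

Context {M : set_structure} {HM : ZF M}.

(** A set whose fibres over [Q] have at most [n] elements has at most [|Q| * n] elements. Embeddings
    of all fibres cannot be chosen simultaneously, so they are joined one by one by induction on
    [Q]. *)
Lemma Emb_fibers (R : M -> M -> Prop) W Q n : Def2 R -> finite_set Q ->
  (forall u, u ∈ W -> exists E, E ∈ Q /\ R u E) ->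
  (forall E, E ∈ Q -> Emb (sep W (fun u => R u E)) n) -> Emb W (prod Q n).
Proof.
  intros HR HQ Ht Hfib.
  enough (G : forall s, finite_set s -> subset s Q ->
                Emb (sep W (fun u => exists E, E ∈ s /\ R u E)) (prod s n)).
  { eapply Emb_trans; [|exact (G Q HQ (subset_refl Q))]. apply Emb_subset.
    intros u Hu. apply sepP; [defi|]. auto. }
  refine (finite_induction _ _ _ _).
  - defi.
  - intros _. apply (Emb_rel (fun u v => u = v)); [defi| |congruence].
    intros u Hu. apply sepP in Hu; [|defi]. destruct Hu as (_ & E & HE & _). destruct (in_emp E HE).
  - intros s a Hs Ha IH Hsub.
    destruct IH as (g & G1 & G2). { intros z Hz. apply Hsub, in_ins. auto. }
    destruct (Hfib a) as (h & H1 & H2). { apply Hsub, in_ins. auto. }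
    assert (D1 : Def1 (fun u => exists E, E ∈ s /\ R u E)) by defi.
    assert (D2 : Def1 (fun u => R u a)) by defi.
    apply (Emb_rel (fun u p => (exists E, E ∈ s /\ R u E) /\ p ∈ prod s n /\ pair u p ∈ g
                     \/ R u a /\ exists i, i ∈ n /\ p = pair a i /\ pair u i ∈ h)); [defi| |].
    + intros u Hu. apply sepP in Hu; [|defi]. destruct Hu as (Hu & E & HE & HRE).
      apply in_ins in HE. destruct HE as [HE| ->].
      * destruct (G1 u) as (p & Hp & Hg); [apply sepP; eauto|].
        exists p. split; [|left; eauto]. apply in_prod in Hp.
        destruct Hp as (x & y & Hx & Hy & ->). apply in_prod_pair. rewrite in_ins. auto.
      * destruct (H1 u) as (i & Hi & Hh); [apply sepP; eauto|].
        exists (pair a i). split; [apply in_prod_pair; rewrite in_ins; auto|]. right. eauto 6.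
    + intros u u' p Hu Hu' _ H H'. apply sepP in Hu, Hu'; [|defi|defi].
      destruct Hu as [Hu _], Hu' as [Hu' _].
      assert (X : forall i, ~ pair a i ∈ prod s n) by (intros i Hi; apply in_prod_pair in Hi; tauto).
      destruct H as [(K1 & K2 & K3)|(K1 & i & K2 & -> & K3)],
               H' as [(L1 & L2 & L3)|(L1 & j & L2 & L3 & L4)].
      * apply (G2 u u' p); auto; apply sepP; auto.
      * subst p. destruct (X _ K2).
      * destruct (X _ L2).
      * apply pair_inj in L3. destruct L3 as [_ <-].
        apply (H2 u u' i); auto; apply sepP; auto.
Qed.

Context {A BA FA f k : M}.
Hypothesis (HA : infinite_set A).
Hypothesis (HBA : is_finite_block_partitions BA A) (HFA : is_finite_subsets FA A).
Hypothesis (f_total : forall P, P ∈ BA -> exists E, E ∈ FA /\ pair P E ∈ f).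
Hypothesis (f_fun : forall P E E', pair P E ∈ f -> pair P E' ∈ f -> E = E').
Hypothesis (f_dom : forall P E, pair P E ∈ f -> P ∈ BA /\ E ∈ FA).
Hypothesis (Hk : is_natural k).
Hypothesis (f_fib : forall E, E ∈ FA -> exists S, (forall P, P ∈ S <-> pair P E ∈ f) /\ Emb S k).

Definition fill (A F : M) :=
  sep (Pow A) (fun B => B ∈ F \/ exists a, a ∈ A /\ B = sing a /\ forall B', B' ∈ F -> ~ a ∈ B').

Lemma in_fill A' F B : B ∈ fill A' F <-> subset B A' /\
  (B ∈ F \/ exists a, a ∈ A' /\ B = sing a /\ forall B', B' ∈ F -> ~ a ∈ B').
Proof. unfold fill. rewrite sepP, in_Pow by defi. reflexivity. Qed.

Lemma Def_fill : DefFun2 fill.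
Proof. unfold fill. defi. Qed.

Lemma fill_BA F :
  (forall B, B ∈ F -> B ∈ FA /\ exists a, a ∈ B) ->
  (forall B B' a, B ∈ F -> B' ∈ F -> a ∈ B -> a ∈ B' -> B = B') -> fill A F ∈ BA.
Proof.
  intros H1 H2. apply HBA. split; [split; [|split]|].
  - intros B HB. apply in_fill in HB. destruct HB as [HB HB']. split; [exact HB|].
    intros E. destruct HB' as [HF|(a & _ & -> & _)].
    + destruct (H1 B HF) as [_ [a Ha]]. exact (E a Ha).
    + apply (E a). now apply in_sing.
  - intros B B' z HB HB' Hz Hz'. apply in_fill in HB, HB'.
    destruct HB as [_ [HF|(a & _ & -> & N)]], HB' as [_ [HF'|(a' & _ & -> & N')]].
    + eauto.
    + apply in_sing in Hz'. subst z. destruct (N' B HF Hz).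
    + apply in_sing in Hz. subst z. destruct (N B' HF' Hz').
    + apply in_sing in Hz, Hz'. congruence.
  - intros z Hz. destruct (classic (exists B, B ∈ F /\ z ∈ B)) as [(B & HB & Hz')|N].
    + exists B. split; [|exact Hz']. apply in_fill. split; [|auto].
      destruct (H1 B HB) as [HBF _]. apply HFA in HBF. tauto.
    + exists (sing z). split; [|now apply in_sing]. apply in_fill. split.
      * intros w Hw. apply in_sing in Hw. now subst.
      * right. exists z. split; [exact Hz|]. split; [reflexivity|]. intros B HB HzB. eauto.
  - intros B HB. apply in_fill in HB. destruct HB as [_ [HF|(a & _ & -> & _)]].
    + destruct (H1 B HF) as [HBF _]. apply HFA in HBF. tauto.
    + apply finite_sing.
Qed.

Definition parts (BA U : M) :=
  sep BA (fun P => forall B, B ∈ P -> subset B U \/ exists a, B = sing a).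

Lemma in_parts B' U P : P ∈ parts B' U <->
  P ∈ B' /\ forall B, B ∈ P -> subset B U \/ exists a, B = sing a.
Proof. unfold parts. rewrite sepP by defi. reflexivity. Qed.

Lemma Def_parts : DefFun2 parts.
Proof. unfold parts. defi. Qed.
Hint Resolve Def_parts : defs.

(** Such a partition is determined by its blocks inside [U], since every point outside these blocks
    forms a singleton block. The partitions are thus told apart by elements of [Pow (Pow U)]. *)
Lemma finite_parts U : U ∈ FA -> finite_set (parts BA U).
Proof.
  intros HU. apply HFA in HU. destruct HU as [_ HU].
  apply (finite_image (fun v P => v = sep P (fun B => subset B U)) _ (Pow (Pow U))); [defi| | |].
  - now apply finite_Pow, finite_Pow.
  - assert (G : forall P P' v, P ∈ parts BA U -> P' ∈ parts BA U ->
        v = sep P (fun B => subset B U) -> v = sep P' (fun B => subset B U) -> subset P P').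
    { intros P P' v HP HP' E E' B HB. apply in_parts in HP, HP'.
      destruct HP as [HP HP1], HP' as [HP' HP1'].
      apply HBA in HP, HP'. destruct HP as [[Q1 _] _], HP' as [(_ & _ & Q3) _].
      destruct (classic (subset B U)) as [HBU|HBU].
      - assert (HBv : B ∈ v) by (rewrite E; apply sepP; [defi|auto]).
        rewrite E' in HBv. apply sepP in HBv; [tauto|defi].
      - destruct (HP1 B HB) as [H|[a ->]]; [tauto|].
        destruct (Q3 a) as (B' & HB' & Ha). { apply (proj1 (Q1 _ HB)), in_sing. reflexivity. }
        destruct (HP1' B' HB') as [H|[a' ->]].
        + destruct HBU. intros z Hz. apply in_sing in Hz. subst z. auto.
        + apply in_sing in Ha. now subst. }
    intros P P' v HP HP' _ E E'. apply subset_antisym; eauto.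
  - intros P HP. exists (sep P (fun B => subset B U)). split; [|reflexivity].
    apply in_Pow. intros B HB. apply sepP in HB; [|defi]. now apply in_Pow.
Qed.

Definition plus (A BA f U : M) :=
  sep A (fun a => a ∈ U \/ exists P E, P ∈ parts BA U /\ pair P E ∈ f /\ a ∈ E).

Lemma in_plus A' B' f' U a : a ∈ plus A' B' f' U <->
  a ∈ A' /\ (a ∈ U \/ exists P E, P ∈ parts B' U /\ pair P E ∈ f' /\ a ∈ E).
Proof. unfold plus. rewrite sepP by defi. reflexivity. Qed.

Lemma Def_plus : DefFun4 plus.
Proof. unfold plus. defi. Qed.

Lemma plus_FA U : U ∈ FA -> plus A BA f U ∈ FA /\ subset U (plus A BA f U).
Proof.
  intros HU. split.
  - apply HFA. split; [intros a Ha; now apply in_plus in Ha|].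
    apply (finite_subset (un U (sep A (fun a => exists P, P ∈ parts BA U /\
              exists E, pair P E ∈ f /\ a ∈ E)))).
    + apply finite_un; [apply HFA in HU; tauto|].
      apply finite_Union with (R := fun P a => exists E, pair P E ∈ f /\ a ∈ E);
        [defi|now apply finite_parts|].
      intros P HP. apply in_parts in HP. destruct HP as [HP _].
      destruct (f_total P HP) as (E & HE & HPE). apply (finite_subset E).
      * apply HFA in HE. tauto.
      * intros a Ha. apply sepP in Ha; [|defi]. destruct Ha as (_ & E' & HE' & Ha).
        now rewrite (f_fun _ _ _ HPE HE').
    + intros a Ha. apply in_plus in Ha. destruct Ha as [HaA [Ha|(P & E & H1 & H2 & H3)]];
        apply in_un; [now left|right]. apply sepP; [defi|]. eauto 6.
  - intros a Ha. apply in_plus. split; [|auto]. apply HFA in HU. now apply HU.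
Qed.

Definition inter (x y : M) := sep x (fun z => z ∈ y).

Lemma in_inter x y z : z ∈ inter x y <-> z ∈ x /\ z ∈ y.
Proof. unfold inter. rewrite sepP by defi. reflexivity. Qed.

Lemma Def_inter : DefFun2 inter.
Proof. unfold inter. defi. Qed.
Hint Resolve Def_inter Def_fill : defs.

(** * Coding pairs of a subset of [U] and a number up to [k] by partitions *)

Section Counting.

Variables r1 r2 r3 R e U : M.
Hypothesis (HR : forall z, z ∈ R <-> z = r1 \/ z = r2 \/ z = r3).
Hypothesis (H12 : r1 <> r2) (H13 : r1 <> r3) (H23 : r2 <> r3).
Hypothesis (e_total : forall i t, i ∈ ins k k -> subset t R ->
  exists w, w ∈ diff A R /\ pair (pair i t) w ∈ e).
Hypothesis (e_inj : forall p p' w, pair p w ∈ e -> pair p' w ∈ e -> p = p').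
Hypothesis (e_ran : forall p w, pair p w ∈ e -> w ∈ diff A R /\ w ∈ U).
Hypothesis (HU : U ∈ FA) (HRU : subset R U).

(* The witness [w] records [i] and the trace of [T] on [R], its partner in [R] records whether
   [w ∈ T], and the block of [r3] records the rest of [T]. *)
Let rest T w := ins r3 (diff (diff T R) (sing w)).
Let code T i P := exists w r, pair (pair i (inter T R)) w ∈ e /\
  (w ∈ T /\ r = r1 \/ ~ w ∈ T /\ r = r2) /\ P = fill A (upair (upair w r) (rest T w)).

Lemma code_parts T i P : subset T U -> code T i P -> P ∈ parts BA U.
Proof.
  intros HT (w & r & Hw & Hr & ->). apply e_ran in Hw. destruct Hw as [Hw HwU].
  apply in_diff in Hw. destruct Hw as [HwA HwR].
  assert (HrR : r ∈ R) by (apply HR; intuition).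
  assert (Hr3 : r <> r3) by (intuition congruence).
  assert (Hw3 : w <> r3) by (intros ->; apply HwR, HR; auto).
  assert (S1 : subset (upair w r) U).
  { intros z Hz. apply in_upair in Hz. destruct Hz as [->| ->]; auto. }
  assert (S2 : subset (rest T w) U).
  { intros z Hz. apply in_ins in Hz. destruct Hz as [Hz| ->].
    - rewrite !in_diff in Hz. apply HT. tauto.
    - apply HRU, HR. auto. }
  assert (SF : forall B, subset B U -> B ∈ FA).
  { intros B HB. apply HFA in HU. apply HFA. destruct HU as [HU1 HU2].
    split; [eapply subset_trans; eassumption|eapply finite_subset; eassumption]. }
  assert (DJ : forall a, a ∈ upair w r -> ~ a ∈ rest T w).
  { intros a Ha Ha'. apply in_upair in Ha. unfold rest in Ha'.
    rewrite in_ins, !in_diff, in_sing in Ha'. destruct Ha as [->| ->]; tauto. }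
  apply in_parts. split.
  - apply fill_BA.
    + intros B HB. apply in_upair in HB. destruct HB as [->| ->]; split; auto.
      * exists w. apply in_upair. auto.
      * exists r3. unfold rest. apply in_ins. auto.
    + intros B B' a HB HB' Ha Ha'. apply in_upair in HB, HB'.
      destruct HB as [->| ->], HB' as [->| ->]; auto; exfalso; eapply DJ; eassumption.
  - intros B HB. apply in_fill in HB. destruct HB as [_ [HB|(a & _ & -> & _)]]; [|eauto].
    apply in_upair in HB. destruct HB as [->| ->]; auto.
Qed.

Lemma code_total T i : i ∈ ins k k -> exists P, code T i P.
Proof.
  intros Hi. destruct (e_total i (inter T R) Hi) as (w & Hw & Hwe).
  { intros z Hz. apply in_inter in Hz. tauto. }
  destruct (classic (w ∈ T)); eexists; [exists w, r1|exists w, r2]; eauto 6.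
Qed.

(** The code can be read off the partition. The block of [r3] is [rest]. The block [{w, r}] is
    neither a singleton nor the block of [r3], and [w] is its point outside [R]. By injectivity of
    [e], [w] gives [i] and the trace on [R]; whether [r] is [r1] or [r2] decides [w ∈ T], and [rest]
    gives the remaining points. *)
Lemma code_inj T i T' i' P : subset T U -> subset T' U -> code T i P -> code T' i' P ->
  T = T' /\ i = i'.
Proof.
  intros HT HT' HP HP'. assert (Part := code_parts T i P HT HP).
  apply in_parts in Part. destruct Part as [Part _]. apply HBA in Part.
  destruct Part as [(_ & Disj & _) _].
  destruct HP as (w & r & Hw & Hr & EP), HP' as (w' & r' & Hw' & Hr' & EP').
  destruct (e_ran _ _ Hw) as [HwA HwU], (e_ran _ _ Hw') as [HwA' HwU'].
  apply in_diff in HwA, HwA'. destruct HwA as [HwA HwR], HwA' as [HwA' HwR'].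
  assert (HrR : r ∈ R) by (apply HR; intuition).
  assert (HrR' : r' ∈ R) by (apply HR; intuition).
  assert (Hr3 : r <> r3) by (intuition congruence).
  assert (Hr3' : r' <> r3) by (intuition congruence).
  assert (H3R : r3 ∈ R) by (apply HR; auto).
  assert (UA : subset U A) by (apply HFA in HU; tauto).
  assert (B2 : forall T w P, subset T U -> P = fill A (upair (upair w r) (rest T w)) -> rest T w ∈ P).
  { intros T0 w0 P0 HT0 ->. apply in_fill. split; [|left; apply in_upair; auto].
    intros z Hz. apply in_ins in Hz. destruct Hz as [Hz| ->]; auto.
    rewrite !in_diff in Hz. apply UA, HT0. tauto. }
  assert (B2' : rest T' w' ∈ P).
  { subst P. rewrite EP'. apply in_fill. split; [|left; apply in_upair; auto].
    intros z Hz. apply in_ins in Hz. destruct Hz as [Hz| ->]; auto.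
    rewrite !in_diff in Hz. apply UA, HT'. tauto. }
  assert (E2 : rest T w = rest T' w').
  { apply (Disj _ _ r3); [eapply B2; eassumption|exact B2'| |]; apply in_ins; auto. }
  assert (B1 : upair w r ∈ P).
  { rewrite EP. apply in_fill. split; [|left; apply in_upair; auto].
    intros z Hz. apply in_upair in Hz. destruct Hz as [->| ->]; auto. }
  assert (E1 : w = w' /\ r = r').
  { rewrite EP' in B1. apply in_fill in B1. destruct B1 as [_ [B1|(a & _ & B1 & _)]].
    - apply in_upair in B1. destruct B1 as [B1|B1].
      + assert (H1 : w ∈ upair w' r') by (rewrite <- B1, in_upair; auto).
        assert (H2 : r ∈ upair w' r') by (rewrite <- B1, in_upair; auto).
        apply in_upair in H1, H2. destruct H1 as [->| ->]; [|tauto].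
        destruct H2 as [->| ->]; tauto.
      + assert (H1 : r ∈ rest T' w') by (rewrite <- B1, in_upair; auto).
        apply in_ins in H1. rewrite !in_diff in H1. tauto.
    - assert (H1 : w ∈ sing a) by (rewrite <- B1, in_upair; auto).
      assert (H2 : r ∈ sing a) by (rewrite <- B1, in_upair; auto).
      apply in_sing in H1, H2. subst. tauto. }
  destruct E1 as [<- <-]. assert (E3 := e_inj _ _ _ Hw Hw'). apply pair_inj in E3.
  destruct E3 as [<- E3]. split; [|reflexivity].
  apply extensionality. intros z.
  destruct (classic (z ∈ R)) as [HzR|HzR].
  - assert (Z : z ∈ inter T R <-> z ∈ inter T' R) by now rewrite E3.
    rewrite !in_inter in Z. tauto.
  - destruct (classic (z = w)) as [->|Nz].
    + intuition congruence.
    + assert (Z : z ∈ rest T w <-> z ∈ rest T' w) by now rewrite E2.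
      unfold rest in Z. rewrite !in_ins, !in_diff, in_sing in Z.
      assert (z <> r3) by congruence. tauto.
Qed.

(** If all values were subsets of [U], then [(k + 1) * 2^|U|] distinct codes would be distributed
    over [2^|U|] values, with at most [k] codes for each. *)
Lemma parts_escape : exists P E, P ∈ parts BA U /\ pair P E ∈ f /\ ~ subset E U.
Proof.
  apply NNPP. intros N.
  assert (HUfin : finite_set (Pow U)) by (apply finite_Pow; apply HFA in HU; tauto).
  assert (EM : Emb (prod (Pow U) (ins k k)) (prod (Pow U) k)).
  { apply (Emb_fibers (fun p E => exists T i P, p = pair T i /\ code T i P /\ pair P E ∈ f)).
    - unfold code, rest. defi.
    - exact HUfin.
    - intros p Hp. apply in_prod in Hp. destruct Hp as (T & i & HT & Hi & ->). apply in_Pow in HT.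
      destruct (code_total T i Hi) as [P HP]. assert (PP := code_parts T i P HT HP).
      destruct (f_total P) as (E & HE & HPE); [apply in_parts in PP; tauto|].
      exists E. split; [|eauto 7]. apply in_Pow. apply NNPP. intros NE. apply N. eauto.
    - intros E HE. apply in_Pow in HE.
      assert (HEF : E ∈ FA).
      { apply HFA. apply HFA in HU. destruct HU.
        split; [eapply subset_trans; eassumption|eapply finite_subset; eassumption]. }
      destruct (f_fib E HEF) as (S & HS & HSk). eapply Emb_trans; [|exact HSk].
      apply (Emb_rel (fun p P => exists T i, p = pair T i /\ code T i P)).
      + unfold code, rest. defi.
      + intros p Hp. apply sepP in Hp; [|unfold code, rest; defi].
        destruct Hp as (_ & T & i & P & -> & HP & HPE). exists P. rewrite HS. eauto.
      + intros p p' P Hp Hp' _ (T & i & -> & HP) (T' & i' & -> & HP').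
        assert (DD : Def1 (fun p => exists T i P, p = pair T i /\ code T i P /\ pair P E ∈ f))
          by (unfold code, rest; defi).
        apply sepP in Hp; [|exact DD]. apply sepP in Hp'; [|exact DD].
        destruct Hp as [Hp _], Hp' as [Hp' _]. apply in_prod_pair in Hp, Hp'.
        rewrite in_Pow in Hp, Hp'.
        destruct (code_inj T i T' i' P) as [-> ->]; tauto. }
  apply pigeonhole in EM.
  (* The pair of the empty set and [k] lies in the larger product only, because [k ∉ k]. *)
  - assert (H : pair emp k ∈ prod (Pow U) k).
    { rewrite EM. apply in_prod_pair. rewrite in_Pow, in_ins. split; [|auto].
      intros z Hz. destruct (in_emp z Hz). }
    apply in_prod_pair in H. destruct (mem_irrefl k). tauto.
  - apply finite_prod; [exact HUfin|]. apply finite_ins. now apply finite_natural.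
  - intros p Hp. apply in_prod in Hp. destruct Hp as (T & i & HT & Hi & ->).
    apply in_prod_pair. rewrite in_ins. auto.
Qed.

End Counting.

(** [U0] holds the three marks in [R] and one witness for each of the [8 * (k + 1)] pairs of a
    number [i ≤ k] and a trace [t ⊆ R]. These witnesses serve every larger [U] as well. *)
Lemma plus_grows : exists U0, U0 ∈ FA /\
  forall U, U ∈ FA -> subset U0 U -> plus A BA f U <> U.
Proof.
  destruct (infinite_nonempty _ HA) as [r1 Hr1].
  destruct (infinite_nonempty _ (infinite_diff _ _ HA (finite_sing r1))) as [r2 Hr2].
  destruct (infinite_nonempty _ (infinite_diff _ _ HA (finite_upair r1 r2))) as [r3 Hr3].
  rewrite in_diff, in_sing in Hr2. rewrite in_diff, in_upair in Hr3.
  set (R := ins r3 (upair r1 r2)).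
  assert (HR : forall z, z ∈ R <-> z = r1 \/ z = r2 \/ z = r3).
  { intros z. unfold R. rewrite in_ins, in_upair. tauto. }
  assert (FR : finite_set R) by (apply finite_ins, finite_upair).
  set (K := prod (ins k k) (Pow R)).
  assert (FK : finite_set K).
  { apply finite_prod; [apply finite_ins; now apply finite_natural|now apply finite_Pow]. }
  destruct (finite_into_infinite K (diff A R) FK (infinite_diff _ _ HA FR))
    as (e & E1 & E2 & E3 & E4).
  set (U0 := un R (sep A (fun w => exists p, p ∈ K /\ pair p w ∈ e))).
  assert (FU0 : finite_set U0).
  { apply finite_un; [exact FR|]. apply finite_Union; [defi|exact FK|]. intros p Hp.
    destruct (E1 p Hp) as (w & _ & Hw). apply (finite_subset (sing w)); [apply finite_sing|].
    intros w' Hw'. apply sepP in Hw'; [|defi]. apply in_sing. eapply E3; [apply Hw'|exact Hw]. }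
  exists U0. split.
  - apply HFA. split; [|exact FU0]. intros z Hz. apply in_un in Hz. destruct Hz as [Hz|Hz].
    + apply HR in Hz. destruct Hz as [->|[->| ->]]; tauto.
    + apply sepP in Hz; [tauto|defi].
  - intros U HU HU0 EU.
    destruct (parts_escape r1 r2 r3 R e U) as (P & E & HP & HPE & N); auto.
    + intros ->. tauto.
    + intros ->. tauto.
    + intros ->. tauto.
    + intros i t Hi Ht. apply E1. apply in_prod_pair. rewrite in_Pow. auto.
    + intros p w Hpw. destruct (E4 _ _ Hpw) as [Hp Hw]. split; [exact Hw|].
      apply HU0, in_un. right. apply sepP; [defi|]. apply in_diff in Hw.
      split; [tauto|]. eauto.
    + intros z Hz. apply HU0, in_un. auto.
    + apply N. intros a Ha. rewrite <- EU. apply in_plus. split.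
      * apply f_dom in HPE. destruct HPE as [_ HE]. apply HFA in HE. now apply HE.
      * right. eauto.
Qed.

End Growth.

#[global] Hint Resolve Def_plus Def_inter Def_fill : defs.

(** * A tower of finite sets embeds its own finite subsets *)

Section FiniteTower.

Context {M : set_structure} {HM : ZF M}.

Lemma finite_bigU (s : M) : finite_set s -> (forall x, x ∈ s -> finite_set x) -> finite_set (bigU s).
Proof.
  intros Hs Hx. apply (finite_subset (sep (bigU s) (fun z => exists u, u ∈ s /\ z ∈ u))).
  - apply finite_Union with (R := fun u z => z ∈ u); [defi|exact Hs|]. intros u Hu.
    apply (finite_subset u); [auto|]. intros z Hz. apply sepP in Hz; [tauto|defi].
  - intros z Hz. apply sepP; [defi|]. split; [exact Hz|]. now apply in_bigU.
Qed.

Lemma finite_chain_max (s : M) : finite_set s -> chain s -> s <> emp ->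
  exists m, m ∈ s /\ forall y, y ∈ s -> subset y m.
Proof.
  revert s. refine (finite_induction _ _ _ _).
  - defi.
  - intros _ N. now destruct N.
  - intros s a Hs Ha IH Hc _. destruct (classic (s = emp)) as [->|N].
    + exists a. split; [apply in_ins; auto|]. intros y Hy. apply in_ins in Hy.
      destruct Hy as [Hy| ->]; [destruct (in_emp y Hy)|apply subset_refl].
    + destruct IH as (m & Hm & Hmax); auto.
      { intros x y Hx Hy. apply Hc; apply in_ins; auto. }
      destruct (Hc m a) as [H|H]; [apply in_ins; auto|apply in_ins; auto| |].
      * exists a. split; [apply in_ins; auto|]. intros y Hy. apply in_ins in Hy.
        destruct Hy as [Hy| ->]; eauto using subset_trans, subset_refl.
      * exists m. split; [apply in_ins; auto|]. intros y Hy. apply in_ins in Hy.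
        destruct Hy as [Hy| ->]; auto.
Qed.

Context (P b : M) (Phi : M -> M).
Hypothesis (HPhi : DefFun1 Phi) (HbP : b ∈ P) (Hb : forall x, x ∈ P -> subset b x).
Hypothesis (HP : forall x, x ∈ P -> Phi x ∈ P) (Hinc : forall x, x ∈ P -> subset x (Phi x)).
Hypothesis (Hstrict : forall x, x ∈ P -> Phi x <> x).
Hypothesis (Hfin : forall x, x ∈ P -> finite_set x).
Hypothesis (Hdown : forall x y, subset b x -> subset x y -> y ∈ P -> x ∈ P).
Hypothesis (HU : forall C, subset C P -> C <> emp -> finite_set C -> bigU C ∈ P).

Notation T := (tower P b Phi).

Local Lemma T_P x : x ∈ T -> x ∈ P.
Proof. now apply tower_sub. Qed.

Local Lemma T_b : b ∈ T.
Proof. now apply tower_admissible. Qed.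

Local Lemma T_Phi x : x ∈ T -> Phi x ∈ T.
Proof. now apply tower_admissible. Qed.

Local Lemma T_chain x y : x ∈ T -> y ∈ T -> subset x y \/ subset y x.
Proof. apply tower_chain; auto. Qed.

Local Lemma T_cmp x y : x ∈ T -> y ∈ T -> subset x y \/ subset (Phi y) x.
Proof. apply tower_cmp; auto. Qed.

(** Let [C] be the common lower bounds of [Y] in the tower. If [bigU C] were not in [Y],
    comparability would make [Phi (bigU C)] another common lower bound, against strictness of
    [Phi]. *)
Lemma finite_tower_least Y : subset Y T -> Y <> emp ->
  exists u, u ∈ Y /\ forall y, y ∈ Y -> subset u y.
Proof.
  intros HY NY. destruct (nonempty Y NY) as [y0 Hy0].
  set (C := sep T (fun x => forall y, y ∈ Y -> subset x y)).
  assert (CP : forall x, x ∈ C <-> x ∈ T /\ forall y, y ∈ Y -> subset x y)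
    by (intros x; unfold C; rewrite sepP by defi; reflexivity).
  assert (Cb : b ∈ C).
  { apply CP. split; [exact T_b|]. intros y Hy. apply Hb, T_P. auto. }
  assert (Low : forall y, y ∈ Y -> subset (bigU C) y).
  { intros y Hy z Hz. apply in_bigU in Hz. destruct Hz as (x & Hx & Hz). apply CP in Hx.
    destruct Hx as [_ Hx]. now apply (Hx y Hy). }
  assert (UT : bigU C ∈ T).
  { apply tower_admissible; auto.
    - intros x Hx. now apply CP in Hx.
    - intros E. rewrite E in Cb. exact (in_emp b Cb).
    - intros x y Hx Hy. apply CP in Hx, Hy. now apply T_chain.
    - apply (Hdown _ y0); auto; [|now apply T_P, HY]. intros z Hz. apply in_bigU. eauto. }
  exists (bigU C). split; [|exact Low]. apply NNPP. intros N.
  apply (Hstrict (bigU C)); [now apply T_P|]. apply subset_antisym; [|now apply Hinc, T_P].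
  intros z Hz. apply in_bigU. exists (Phi (bigU C)). split; [|exact Hz].
  apply CP. split; [now apply T_Phi|]. intros y Hy.
  destruct (T_cmp y (bigU C)) as [H|H]; auto.
  destruct N. replace (bigU C) with y; [exact Hy|]. now apply subset_antisym; [|apply Low].
Qed.

Lemma finite_tower_infinite : infinite_set T.
Proof.
  intros F. assert (UP : bigU T ∈ P).
  { apply HU; auto using T_P.
    - intros x. apply T_P.
    - intros E. apply (in_emp b). rewrite <- E. exact T_b. }
  apply (Hstrict _ UP). apply tower_fixpoint; auto.
Qed.

(** * Ranking the finite subsets of the tower *)

Definition seg x := sep T (fun y => subset y x /\ y <> x).

Lemma in_seg x y : y ∈ seg x <-> y ∈ T /\ subset y x /\ y <> x.
Proof. unfold seg. rewrite sepP by defi. reflexivity. Qed.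

Lemma finite_seg x : x ∈ T -> finite_set (seg x).
Proof.
  intros Hx. apply (finite_subset (Pow x)); [now apply finite_Pow, Hfin, T_P|].
  intros y Hy. apply in_seg in Hy. now apply in_Pow.
Qed.

Lemma seg_b : seg b = emp.
Proof.
  apply emp_unique. intros y Hy. apply in_seg in Hy. destruct Hy as (H1 & H2 & H3).
  apply H3, subset_antisym; [exact H2|]. now apply Hb, T_P.
Qed.

Lemma seg_Phi x : x ∈ T -> seg (Phi x) = ins x (seg x).
Proof.
  intros Hx. apply extensionality. intros y. rewrite in_ins, !in_seg. split.
  - intros (H1 & H2 & H3). destruct (T_cmp y x H1 Hx) as [H|H].
    + destruct (classic (y = x)); auto.
    + destruct H3. now apply subset_antisym.
  - intros [(H1 & H2 & H3)| ->].
    + split; [exact H1|]. split; [eapply subset_trans; [exact H2|]; now apply Hinc, T_P|].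
      intros ->. apply H3, subset_antisym; [exact H2|]. now apply Hinc, T_P.
    + split; [exact Hx|]. split; [now apply Hinc, T_P|]. intros E. now apply (Hstrict x); [apply T_P|].
Qed.

Lemma seg_self x : ~ x ∈ seg x.
Proof. rewrite in_seg. tauto. Qed.

(** Together with [seg_inj] this says that every finite cardinality is realized by exactly one
    segment, so the tower can stand in for ω. *)
Lemma seg_exists B : finite_set B -> exists x, x ∈ T /\ Emb B (seg x) /\ Emb (seg x) B.
Proof.
  revert B. refine (finite_induction _ _ _ _).
  - unfold seg. defi.
  - exists b. rewrite seg_b. split; [exact T_b|]. split; apply Emb_subset, subset_refl.
  - intros s a Hs Ha (x & Hx & H1 & H2). exists (Phi x). rewrite seg_Phi by exact Hx.
    split; [now apply T_Phi|]. split; apply Emb_ins; auto using seg_self.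
Qed.

Lemma seg_inj x y : x ∈ T -> y ∈ T -> Emb (seg x) (seg y) -> Emb (seg y) (seg x) -> x = y.
Proof.
  assert (G : forall x y, x ∈ T -> y ∈ T -> Emb (seg y) (seg x) -> subset x y -> x = y).
  { intros x' y' Hx Hy E H. apply NNPP. intros N.
    assert (S1 : subset (seg x') (seg y')).
    { intros z Hz. apply in_seg in Hz. destruct Hz as (Hz & Hzx & Nz). apply in_seg.
      split; [exact Hz|]. split; [eapply subset_trans; eassumption|].
      intros ->. apply N. now apply subset_antisym. }
    apply pigeonhole in E; [|now apply finite_seg|exact S1].
    apply (seg_self x'). rewrite E. now apply in_seg. }
  intros Hx Hy E1 E2. destruct (T_chain x y Hx Hy); [|symmetry]; auto.
Qed.

(** The colexicographic order: the largest point of difference decides. Comparing from the top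
    leaves only finitely many finite sets before a given one, which a lexicographic comparison from
    the bottom would not. *)
Definition colex s t := exists x, x ∈ T /\ x ∈ t /\ ~ x ∈ s /\
  forall y, y ∈ T -> subset x y -> x <> y -> (y ∈ s <-> y ∈ t).

Lemma colex_irrefl s : ~ colex s s.
Proof. intros (x & _ & H1 & H2 & _). tauto. Qed.

Lemma colex_trans s t u : colex s t -> colex t u -> colex s u.
Proof.
  intros (x & Tx & X1 & X2 & X3) (y & Ty & Y1 & Y2 & Y3).
  assert (Nxy : x <> y) by congruence.
  destruct (T_chain x y Tx Ty) as [H|H].
  - exists y. split; [exact Ty|]. split; [exact Y1|]. split; [rewrite (X3 y); auto|].
    intros z Tz Hz Nz. rewrite X3; auto.
    + eapply subset_trans; eassumption.
    + intros ->. apply Nz. now apply subset_antisym.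
  - exists x. split; [exact Tx|]. split; [apply Y3; auto|]. split; [exact X2|].
    intros z Tz Hz Nz. rewrite X3; auto. apply Y3; auto.
    + eapply subset_trans; eassumption.
    + intros ->. apply Nxy. now apply subset_antisym.
Qed.

Lemma colex_total s t : finite_set s -> finite_set t -> subset s T -> subset t T -> s <> t ->
  colex s t \/ colex t s.
Proof.
  intros Fs Ft Hs Ht N. set (d := un (diff s t) (diff t s)).
  assert (D : forall z, z ∈ d <-> z ∈ s /\ ~ z ∈ t \/ z ∈ t /\ ~ z ∈ s)
    by (intros z; unfold d; rewrite in_un, !in_diff; reflexivity).
  destruct (finite_chain_max d) as (m & Hm & Hmax).
  - apply (finite_subset (un s t)); [now apply finite_un|]. intros z Hz. apply D in Hz.
    apply in_un. tauto.
  - intros x y Hx Hy. apply D in Hx, Hy.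
    apply T_chain; [destruct Hx as [[]|[]]|destruct Hy as [[]|[]]]; auto.
  - intros E. apply N, extensionality. intros z. assert (Nz : ~ z ∈ d) by (rewrite E; apply in_emp).
    rewrite D in Nz. tauto.
  - assert (Top : forall y, y ∈ T -> subset m y -> m <> y -> (y ∈ s <-> y ∈ t)).
    { intros y Ty Hy Ny. apply NNPP. intros N'. apply Ny, subset_antisym; [exact Hy|].
      apply Hmax, D. tauto. }
    apply D in Hm. destruct Hm as [[H1 H2]|[H1 H2]]; [right|left]; exists m; repeat split; auto;
      apply Top; auto.
Qed.

Definition below s := sep (Pow T) (fun t => finite_set t /\ colex t s).

Lemma in_below s t : t ∈ below s <-> subset t T /\ finite_set t /\ colex t s.
Proof. unfold below, colex. rewrite sepP, in_Pow by defi. reflexivity. Qed.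

(** The deciding point [x] belongs to [s], and a member of [t] is either contained in [x] or itself
    a member of [s]. Hence all members of [t] are subsets of the finite set [bigU s]. *)
Lemma finite_below s : finite_set s -> subset s T -> finite_set (below s).
Proof.
  intros Fs Hs.
  assert (FU : finite_set (bigU s)) by (apply finite_bigU; auto; intros x Hx; now apply Hfin, T_P, Hs).
  apply (finite_subset (Pow (Pow (bigU s)))); [now apply finite_Pow, finite_Pow|].
  intros t Ht. apply in_below in Ht. destruct Ht as (Ht & _ & x & Tx & X1 & X2 & X3).
  apply in_Pow. intros y Hy. apply in_Pow.
  assert (Hx : subset x (bigU s)) by (intros z Hz; apply in_bigU; eauto).
  destruct (T_chain x y Tx (Ht y Hy)) as [H|H]; [|eapply subset_trans; eassumption].
  destruct (classic (x = y)) as [->|N]; [exact Hx|].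
  apply X3 in Hy; auto. intros z Hz. apply in_bigU. eauto.
Qed.

Lemma below_inj s t : finite_set s -> finite_set t -> subset s T -> subset t T ->
  Emb (below s) (below t) -> Emb (below t) (below s) -> s = t.
Proof.
  assert (G : forall s t, finite_set s -> finite_set t -> subset s T -> subset t T ->
    colex s t -> ~ Emb (below t) (below s)).
  { intros s' t' Fs Ft Hs Ht L E.
    apply pigeonhole in E; [|now apply finite_below|].
    - apply (colex_irrefl s'). assert (H : s' ∈ below s') by (rewrite E; now apply in_below).
      now apply in_below in H.
    - intros u Hu. apply in_below in Hu. apply in_below. intuition eauto using colex_trans. }
  intros Fs Ft Hs Ht E1 E2. apply NNPP. intros N.
  destruct (colex_total s t) as [L|L]; auto.
  - exact (G s t Fs Ft Hs Ht L E2).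
  - exact (G t s Ft Fs Ht Hs L E1).
Qed.

(** The position of [s] in the colexicographic order, expressed by the member of the tower with
    equally many predecessors. This is the injection of the finite subsets of the tower into the
    tower from which the initial structure gets its [q]. *)
Definition rank_of s x := x ∈ T /\ Emb (below s) (seg x) /\ Emb (seg x) (below s).

Lemma Def_rank_of : Def2 rank_of.
Proof. unfold rank_of, below, seg, colex. defi. Qed.

Lemma rank_of_total s : finite_set s -> subset s T -> exists x, rank_of s x.
Proof.
  intros Fs Hs. destruct (seg_exists (below s)) as (x & Hx); [now apply finite_below|].
  now exists x.
Qed.

Lemma rank_of_fun s x y : rank_of s x -> rank_of s y -> x = y.
Proof.
  intros (H1 & H2 & H3) (K1 & K2 & K3). apply seg_inj; auto; eapply Emb_trans; eassumption.
Qed.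

Lemma rank_of_inj s t x : finite_set s -> finite_set t -> subset s T -> subset t T ->
  rank_of s x -> rank_of t x -> s = t.
Proof.
  intros Fs Ft Hs Ht (H1 & H2 & H3) (K1 & K2 & K3).
  apply below_inj; auto; eapply Emb_trans; eassumption.
Qed.

End FiniteTower.

(** * Well-ordered disjoint families that embed their finite subsets *)

Section Structures.

Context {M : set_structure} {HM : ZF M}.
Context (FA : M).

Definition trip (s y D : M) := pair s (pair y D).

Lemma Def_trip : DefFun3 trip.
Proof. unfold trip. defi. Qed.
Hint Resolve Def_trip : defs.

Lemma trip_inj s y D s' y' D' : trip s y D = trip s' y' D' -> s = s' /\ y = y' /\ D = D'.
Proof.
  unfold trip. intros H. apply pair_inj in H. destruct H as [-> H]. apply pair_inj in H. tauto.
Qed.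

(* A structure [S] is a set of triples [(s, y, D)]: [s] ranges over the finite subsets of the
   family, [s ↦ y] is an injection into the family, and for [s = {x}] the set [D] is
   the initial segment of the members up to [x].  Storing whole initial segments makes plain
   inclusion of structures mean end-extension. *)
Definition fam : M -> M :=
  proj1_sig (sealed (fun S => sep FA (fun x => exists y D, trip (sing x) y D ∈ S))).
Definition leS (S x x' : M) := exists y D, trip (sing x') y D ∈ S /\ x ∈ D.

Lemma in_fam S x : x ∈ fam S <-> x ∈ FA /\ exists y D, trip (sing x) y D ∈ S.
Proof. unfold fam. unseal. rewrite sepP by defi. reflexivity. Qed.

Lemma Def_fam : DefFun1 fam.
Proof. unfold fam. unseal. defi. Qed.

Lemma Def_leS : Def3 leS.
Proof. unfold leS. defi. Qed.
Hint Resolve Def_fam Def_leS : defs.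

(** The clause on least elements does more than well-foundedness: applied to singletons and pairs it
    gives reflexivity and totality of [leS S], and with antisymmetry also transitivity. *)
Definition Good (S : M) :=
  (forall p, p ∈ S -> exists s y D, p = trip s y D /\ finite_set s /\ subset s (fam S) /\
     y ∈ fam S /\ subset D (fam S)) /\
  (forall s y D y' D', trip s y D ∈ S -> trip s y' D' ∈ S -> y = y' /\ D = D') /\
  (forall s, finite_set s -> subset s (fam S) -> exists y D, trip s y D ∈ S) /\
  (forall s s' y D D', trip s y D ∈ S -> trip s' y D' ∈ S -> s = s') /\
  (forall x, x ∈ fam S -> exists a, a ∈ x) /\
  (forall x x' a, x ∈ fam S -> x' ∈ fam S -> a ∈ x -> a ∈ x' -> x = x') /\
  (forall Y, subset Y (fam S) -> Y <> emp -> exists x, x ∈ Y /\ forall y, y ∈ Y -> leS S x y) /\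
  (forall x y, leS S x y -> leS S y x -> x = y) /\
  infinite_set (fam S).

Lemma Def_Good : Def1 Good.
Proof. unfold Good, infinite_set. defi. Qed.

Lemma fam_mono S S' : subset S S' -> subset (fam S) (fam S').
Proof.
  intros H x Hx. apply in_fam in Hx. destruct Hx as (Hx & y & D & Ht). apply in_fam. eauto 6.
Qed.

Lemma leS_mono S S' x y : subset S S' -> leS S x y -> leS S' x y.
Proof. intros H (z & D & Ht & Hx). exists z, D. auto. Qed.

Lemma leS_fam S x y : Good S -> leS S x y -> x ∈ fam S.
Proof.
  intros (G1 & _) (z & D & Ht & Hx). destruct (G1 _ Ht) as (s & y' & D' & E & _ & _ & _ & HD).
  apply trip_inj in E. destruct E as (_ & _ & ->). auto.
Qed.

(** The triple of [{y}] in [S'] is unique and is already present in [S], so the segment of an old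
    member cannot grow. *)
Lemma leS_end S S' x y : subset S S' -> Good S' -> y ∈ fam S -> leS S' x y -> leS S x y.
Proof.
  intros H (_ & G2 & _) Hy (z & D & Ht & Hx). apply in_fam in Hy.
  destruct Hy as (_ & z' & D' & Ht'). destruct (G2 _ _ _ _ _ Ht (H _ Ht')) as [-> ->].
  exists z', D'. auto.
Qed.

Lemma leS_total S x y : Good S -> x ∈ fam S -> y ∈ fam S -> leS S x y \/ leS S y x.
Proof.
  intros (_ & _ & _ & _ & _ & _ & G7 & _) Hx Hy.
  destruct (G7 (upair x y)) as (z & Hz & Hmin).
  - intros w Hw. apply in_upair in Hw. destruct Hw; now subst.
  - intros E. apply (in_emp x). rewrite <- E. apply in_upair. auto.
  - apply in_upair in Hz. destruct Hz; subst; [left|right]; apply Hmin, in_upair; auto.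
Qed.

(** Two triples, and likewise any finite subset of the united family, already live in one member of
    the chain; this settles all clauses but the least element. For that one, the minimum of the part
    of [Y] inside any stage meeting [Y] remains minimal, since later stages only append members. *)
Lemma Good_union C : (forall S, S ∈ C -> Good S) -> C <> emp -> chain C -> Good (bigU C).
Proof.
  intros HG NC CC. destruct (nonempty C NC) as [S0 HS0].
  assert (Sub : forall S, S ∈ C -> subset S (bigU C)) by (intros S HS z Hz; apply in_bigU; eauto).
  assert (FU : forall x, x ∈ fam (bigU C) -> exists S, S ∈ C /\ x ∈ fam S).
  { intros x Hx. apply in_fam in Hx. destruct Hx as (Hx & y & D & Ht). apply in_bigU in Ht.
    destruct Ht as (S & HS & Ht). exists S. split; [exact HS|]. apply in_fam. eauto. }
  assert (Two : forall S S', S ∈ C -> S' ∈ C -> exists S2, S2 ∈ C /\ subset S S2 /\ subset S' S2).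
  { intros S S' HS HS'. destruct (CC S S' HS HS'); [exists S'|exists S]; repeat split; auto; apply subset_refl. }
  assert (FinIn : forall s, finite_set s -> subset s (fam (bigU C)) ->
                    exists S, S ∈ C /\ subset s (fam S)).
  { refine (finite_induction _ _ _ _).
    - defi.
    - intros _. exists S0. split; [exact HS0|]. intros z Hz. destruct (in_emp z Hz).
    - intros s a _ _ IH Hs. destruct IH as (S & HS & HsS). { intros z Hz. apply Hs, in_ins. auto. }
      destruct (FU a) as (S' & HS' & Ha). { apply Hs, in_ins. auto. }
      destruct (Two S S' HS HS') as (S2 & HS2 & K1 & K2). exists S2. split; [exact HS2|].
      intros z Hz. apply in_ins in Hz. destruct Hz as [Hz| ->];
        [apply (fam_mono S S2 K1)|apply (fam_mono S' S2 K2)]; auto. }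
  assert (Tw : forall p p', p ∈ bigU C -> p' ∈ bigU C -> exists S, S ∈ C /\ p ∈ S /\ p' ∈ S).
  { intros p p' Hp Hp'. apply in_bigU in Hp, Hp'. destruct Hp as (S & HS & Hp), Hp' as (S' & HS' & Hp').
    destruct (Two S S' HS HS') as (S2 & HS2 & K1 & K2). exists S2. auto. }
  split; [|split; [|split; [|split; [|split; [|split; [|split; [|split]]]]]]].
  - intros p Hp. apply in_bigU in Hp. destruct Hp as (S & HS & Hp).
    destruct (HG S HS) as (G1 & _). destruct (G1 p Hp) as (s & y & D & E & K1 & K2 & K3 & K4).
    pose proof (fam_mono S _ (Sub S HS)) as FM.
    exists s, y, D. repeat split; eauto using subset_trans.
  - intros s y D y' D' Ht Ht'. destruct (Tw _ _ Ht Ht') as (S & HS & K & K').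
    destruct (HG S HS) as (_ & G2 & _). eauto.
  - intros s Fs Hs. destruct (FinIn s Fs Hs) as (S & HS & HsS).
    destruct (HG S HS) as (_ & _ & G3 & _). destruct (G3 s Fs HsS) as (y & D & Ht).
    exists y, D. now apply (Sub S HS).
  - intros s s' y D D' Ht Ht'. destruct (Tw _ _ Ht Ht') as (S & HS & K & K').
    destruct (HG S HS) as (_ & _ & _ & G4 & _). eauto.
  - intros x Hx. destruct (FU x Hx) as (S & HS & HxS).
    destruct (HG S HS) as (_ & _ & _ & _ & G5 & _). eauto.
  - intros x x' a Hx Hx'. destruct (FU x Hx) as (S & HS & HxS), (FU x' Hx') as (S' & HS' & HxS').
    destruct (Two S S' HS HS') as (S2 & HS2 & K1 & K2).
    destruct (HG S2 HS2) as (_ & _ & _ & _ & _ & G6 & _).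
    apply G6; [apply (fam_mono S S2 K1)|apply (fam_mono S' S2 K2)]; auto.
  - intros Y HY NY. destruct (nonempty Y NY) as [y0 Hy0].
    destruct (FU y0 (HY y0 Hy0)) as (S & HS & Hy0S).
    pose proof (HG S HS) as GS. pose proof GS as (_ & _ & _ & _ & _ & _ & G7 & _).
    destruct (G7 (inter Y (fam S))) as (x & Hx & Hmin).
    + intros z Hz. now apply in_inter in Hz.
    + intros E. apply (in_emp y0). rewrite <- E. now apply in_inter.
    + apply in_inter in Hx. destruct Hx as [HxY HxS]. exists x. split; [exact HxY|].
      intros y Hy. destruct (FU y (HY y Hy)) as (S' & HS' & HyS').
      destruct (classic (y ∈ fam S)) as [HyS|N].
      * apply (leS_mono S); auto. apply Hmin, in_inter. auto.
      (* Here [y] appears only at a later stage; were it below [x] there, end-extension would put it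
         into the family of [S]. *)
      * destruct (CC S S' HS HS') as [K|K]; [|destruct N; apply (fam_mono S' S K); auto].
        apply (leS_mono S'); auto.
        destruct (leS_total S' x y) as [L|L]; auto; [apply (fam_mono S S' K); auto|].
        destruct N. apply (leS_fam S y x); auto. apply (leS_end S S'); auto.
  - intros x y (z & D & Ht & Hx) (z' & D' & Ht' & Hy).
    destruct (Tw _ _ Ht Ht') as (S & HS & K & K').
    destruct (HG S HS) as (_ & _ & _ & _ & _ & _ & _ & G8 & _).
    apply G8; [exists z, D|exists z', D']; auto.
  - destruct (HG S0 HS0) as (_ & _ & _ & _ & _ & _ & _ & _ & G9). intros F. apply G9.
    eapply finite_subset; [exact F|]. apply fam_mono. auto.
Qed.

(** * Coding pairs and finite sets by members of a structure *)

Definition qv : M -> M -> M :=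
  proj1_sig (sealed (fun S s => the FA (fun y => exists D, trip s y D ∈ S))).

Lemma Def_qv : DefFun2 qv.
Proof. unfold qv, the. unseal. defi. Qed.
Hint Resolve Def_qv : defs.

(** The Kuratowski pair with [qv S] applied to each set that is formed, so the pair becomes a member
    of the family again. *)
Definition qpair (S a b : M) := qv S (upair (qv S (sing a)) (qv S (upair a b))).

Lemma Def_qpair : DefFun3 qpair.
Proof. unfold qpair. defi. Qed.
Hint Resolve Def_qpair : defs.

(** An injection of two finite sets and a member into the family. For fixed [s] and [t], the values
    over all [x] are the supply reserved for this pair; [t] will name sets of a partial copy. *)
Definition slot : M -> M -> M -> M -> M :=
  proj1_sig (sealed (fun S s t x => qpair S (qv S s) (qpair S (qv S t) x))).

Lemma Def_slot : DefFun4 slot.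
Proof. unfold slot. unseal. defi. Qed.

Section OneStructure.

Context (S : M) (HS : Good S).

Lemma qv_trip s y D : trip s y D ∈ S -> qv S s = y.
Proof.
  intros Ht. pose proof HS as (G1 & G2 & _). unfold qv. unseal. apply theP; [defi| |eauto|].
  - destruct (G1 _ Ht) as (s' & y' & D' & E & _ & _ & Hy & _). apply trip_inj in E.
    destruct E as (_ & -> & _). now apply in_fam in Hy.
  - intros y' _ [D' Ht']. now destruct (G2 _ _ _ _ _ Ht' Ht).
Qed.

Lemma qv_fam s : finite_set s -> subset s (fam S) -> qv S s ∈ fam S.
Proof.
  intros Fs Hs. pose proof HS as (G1 & _ & G3 & _). destruct (G3 s Fs Hs) as (y & D & Ht).
  rewrite (qv_trip s y D Ht). destruct (G1 _ Ht) as (s' & y' & D' & E & _ & _ & Hy & _).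
  apply trip_inj in E. destruct E as (_ & -> & _). exact Hy.
Qed.

Lemma qv_inj s t : finite_set s -> finite_set t -> subset s (fam S) -> subset t (fam S) ->
  qv S s = qv S t -> s = t.
Proof.
  intros Fs Ft Hs Ht E. pose proof HS as (_ & _ & G3 & G4 & _).
  destruct (G3 s Fs Hs) as (y & D & T1). destruct (G3 t Ft Ht) as (z & D' & T2).
  rewrite (qv_trip s y D T1), (qv_trip t z D' T2) in E. subst. eauto.
Qed.

Lemma sing_fam a : a ∈ fam S -> subset (sing a) (fam S).
Proof. intros H z Hz. apply in_sing in Hz. now subst. Qed.

Lemma upair_fam a b : a ∈ fam S -> b ∈ fam S -> subset (upair a b) (fam S).
Proof. intros H H' z Hz. apply in_upair in Hz. destruct Hz; now subst. Qed.

Lemma qpair_fam a b : a ∈ fam S -> b ∈ fam S -> qpair S a b ∈ fam S.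
Proof.
  intros Ha Hb. apply qv_fam; [apply finite_upair|].
  apply upair_fam; apply qv_fam; auto using finite_sing, finite_upair, sing_fam, upair_fam.
Qed.

Lemma qpair_inj a b a' b' : a ∈ fam S -> b ∈ fam S -> a' ∈ fam S -> b' ∈ fam S ->
  qpair S a b = qpair S a' b' -> a = a' /\ b = b'.
Proof.
  intros Ha Hb Ha' Hb' E.
  assert (F : forall a b, a ∈ fam S -> b ∈ fam S ->
    subset (upair (qv S (sing a)) (qv S (upair a b))) (fam S)).
  { intros x y Hx Hy.
    apply upair_fam; apply qv_fam; auto using finite_sing, finite_upair, sing_fam, upair_fam. }
  apply qv_inj in E; auto using finite_upair.
  (* Injectivity of [qv S] carries the equality of codes back to the actual Kuratowski pairs. *)
  assert (K : forall a b a' b', a ∈ fam S -> b ∈ fam S -> a' ∈ fam S -> b' ∈ fam S ->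
    upair (qv S (sing a)) (qv S (upair a b)) = upair (qv S (sing a')) (qv S (upair a' b')) ->
    subset (pair a b) (pair a' b')).
  { clear - HS. intros a b a' b' Ha Hb Ha' Hb' E z Hz.
    assert (Hz' : finite_set z /\ subset z (fam S) /\ qv S z ∈ upair (qv S (sing a)) (qv S (upair a b))).
    { apply in_pair in Hz.
      destruct Hz as [->| ->]; rewrite in_upair; auto using finite_sing, finite_upair, sing_fam, upair_fam. }
    destruct Hz' as (Fz & Sz & Qz). rewrite E in Qz. apply in_upair in Qz.
    apply in_pair. destruct Qz as [Qz|Qz]; [left|right]; apply qv_inj in Qz;
      auto using finite_sing, finite_upair, sing_fam, upair_fam. }
  apply pair_inj, subset_antisym; apply K; auto.
Qed.

Lemma slot_fam s t x : finite_set s -> finite_set t -> subset s (fam S) -> subset t (fam S) ->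
  x ∈ fam S -> slot S s t x ∈ fam S.
Proof. intros. unfold slot. unseal. auto using qpair_fam, qv_fam. Qed.

Lemma slot_inj s t x s' t' x' :
  finite_set s -> finite_set t -> subset s (fam S) -> subset t (fam S) -> x ∈ fam S ->
  finite_set s' -> finite_set t' -> subset s' (fam S) -> subset t' (fam S) -> x' ∈ fam S ->
  slot S s t x = slot S s' t' x' -> s = s' /\ t = t' /\ x = x'.
Proof.
  unfold slot. unseal. intros.
  match goal with E : qpair _ _ _ = _ |- _ => apply qpair_inj in E; auto using qpair_fam, qv_fam;
    destruct E as [E1 E2] end.
  apply qpair_inj in E2; auto using qv_fam. destruct E2 as [E2 ->].
  apply qv_inj in E1, E2; auto.
Qed.

End OneStructure.

End Structures.

#[global] Hint Resolve Def_trip Def_fam Def_leS Def_Good Def_qv Def_qpair Def_slot : defs.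

(** * Diagonalization *)

Section Diagonal.

Context {M : set_structure} {HM : ZF M}.
Context (A BA FA f : M).

(** A canonical member of the family, so that all blocks made for one pair [(s, t)] have a part in
    common. *)
Definition bot : M -> M := proj1_sig (sealed (fun S => qv FA S emp)).
Definition blk : M -> M -> M -> M -> M :=
  proj1_sig (sealed (fun S s t x => un (slot FA S s t (bot S)) (slot FA S s t x))).
(** Here [b] is the part of the copy built so far and [t] selects sets of it through their
    originals. Every finite set of points covered by the family and by [b] lies in such a region. *)
Definition reach (b s t : M) := sep A (fun a =>
  (exists x, x ∈ s /\ a ∈ x) \/ exists x y, x ∈ t /\ pair x y ∈ b /\ a ∈ y).
Definition bad (S b s t x : M) := exists P E,
  pair P E ∈ f /\ subset E (reach b s t) /\ blk S s t x ∈ P.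
(** Excluding [bot S] makes the block a union of two distinct members, from which [x] can be
    recovered. *)
Definition cand (S b s t x : M) := x ∈ fam FA S /\ x <> bot S /\ ~ bad S b s t x.
Definition pick (S b s t x : M) := cand S b s t x /\ forall x', cand S b s t x' -> leS S x x'.
Definition sel (S s : M) := finite_set s /\ subset s (fam FA S).
Definition blocks (S b : M) := sep (Pow A) (fun B => exists s t x,
  sel S s /\ sel S t /\ pick S b s t x /\ B = blk S s t x).
Definition newE (S b : M) := the FA (fun E => pair (fill A (blocks S b)) E ∈ f).
(** Keeping only the points of the value not covered so far makes disjointness automatic; the
    diagonal argument then has to show that something is left. *)
Definition newD (S b : M) := sep A (fun a => a ∈ newE S b /\
  (forall x, x ∈ fam FA S -> ~ a ∈ x) /\ forall x y, pair x y ∈ b -> ~ a ∈ y).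

Lemma Def_bot : DefFun1 bot.
Proof. unfold bot. unseal. defi. Qed.
Hint Resolve Def_bot : defs.
Lemma Def_blk : DefFun4 blk.
Proof. unfold blk. unseal. defi. Qed.
Lemma Def_reach : DefFun3 reach.
Proof. unfold reach. defi. Qed.
Hint Resolve Def_blk Def_reach : defs.
Lemma Def_bad : Def5 bad.
Proof. unfold bad. defi. Qed.
Hint Resolve Def_bad : defs.
Lemma Def_cand : Def5 cand.
Proof. unfold cand. defi. Qed.
Hint Resolve Def_cand : defs.
Lemma Def_pick : Def5 pick.
Proof. unfold pick. defi. Qed.
Lemma Def_sel : Def2 sel.
Proof. unfold sel. defi. Qed.
Hint Resolve Def_pick Def_sel : defs.
Lemma Def_blocks : DefFun2 blocks.
Proof. unfold blocks. defi. Qed.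
Hint Resolve Def_blocks : defs.
Lemma Def_newE : DefFun2 newE.
Proof. unfold newE, the. defi. Qed.
Hint Resolve Def_newE : defs.
Lemma Def_newD : DefFun2 newD.
Proof. unfold newD. defi. Qed.
Hint Resolve Def_newD : defs.

(** * Partial copies of the family *)

Definition GoodB (S b : M) :=
  (forall p, p ∈ b -> exists x y, p = pair x y /\ x ∈ fam FA S /\ y ∈ FA /\ (exists a, a ∈ y) /\
     forall x' a, x' ∈ fam FA S -> a ∈ x' -> ~ a ∈ y) /\
  (forall x y y', pair x y ∈ b -> pair x y' ∈ b -> y = y') /\
  (forall x y x' y' a, pair x y ∈ b -> pair x' y' ∈ b -> a ∈ y -> a ∈ y' -> x = x').

Lemma Def_GoodB : Def2 GoodB.
Proof. unfold GoodB. defi. Qed.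
Hint Resolve Def_GoodB : defs.

Definition next (S b x : M) := x ∈ fam FA S /\ ~ (exists y, pair x y ∈ b) /\
  forall x', x' ∈ fam FA S -> ~ (exists y, pair x' y ∈ b) -> leS S x x'.

Lemma Def_next : Def3 next.
Proof. unfold next. defi. Qed.
Hint Resolve Def_next : defs.

Definition stepB (S b : M) := sep (prod FA FA) (fun p =>
  p ∈ b \/ exists x, next S b x /\ p = pair x (newD S b)).

Definition PB (S : M) := sep (Pow (prod FA FA)) (GoodB S).

Lemma Def_stepB : DefFun2 stepB.
Proof. unfold stepB. defi. Qed.
Lemma Def_PB : DefFun1 PB.
Proof. unfold PB. defi. Qed.
Hint Resolve Def_stepB Def_PB : defs.

(* The new disjoint sets are added one at a time along the well-order of [S]. *)
Definition copy (S : M) := bigU (tower (PB S) emp (stepB S)).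

Lemma Def_copy : DefFun1 copy.
Proof.
  pose proof (Def_tower PB (fun _ => emp) stepB Def_PB ltac:(defi) Def_stepB) as H.
  exact (DefTerm_app1 bigU _ Def_bigU (DefTerm_app1 _ _ H (DefTerm_var 0))).
Qed.

Hypothesis (HBA : is_finite_block_partitions BA A) (HFA : is_finite_subsets FA A).
Hypothesis (f_total : forall P, P ∈ BA -> exists E, E ∈ FA /\ pair P E ∈ f).
Hypothesis (f_fun : forall P E E', pair P E ∈ f -> pair P E' ∈ f -> E = E').
Hypothesis (f_dom : forall P E, pair P E ∈ f -> P ∈ BA /\ E ∈ FA).
Hypothesis (f_fin : forall E, E ∈ FA -> exists S, (forall P, P ∈ S <-> pair P E ∈ f) /\ finite_set S).

Lemma in_blk S s t x a : a ∈ blk S s t x <-> a ∈ slot FA S s t (bot S) \/ a ∈ slot FA S s t x.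
Proof. unfold blk. unseal. apply in_un. Qed.

Lemma in_reach b s t a : a ∈ reach b s t <->
  a ∈ A /\ ((exists x, x ∈ s /\ a ∈ x) \/ exists x y, x ∈ t /\ pair x y ∈ b /\ a ∈ y).
Proof. unfold reach. rewrite sepP by defi. reflexivity. Qed.

Section OneStep.

Context (S b : M) (HS : Good FA S) (Hb : GoodB S b).

Local Lemma bot_fam : bot S ∈ fam FA S.
Proof. unfold bot. unseal. apply qv_fam; [exact HS|exact finite_emp|]. intros z Hz. destruct (in_emp z Hz). Qed.

Local Lemma fam_disj x x' a : x ∈ fam FA S -> x' ∈ fam FA S -> a ∈ x -> a ∈ x' -> x = x'.
Proof. destruct HS as (_ & _ & _ & _ & _ & G6 & _). eauto. Qed.

Local Lemma fam_FA x : x ∈ fam FA S -> x ∈ FA.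
Proof. intros H. now apply in_fam in H. Qed.

Local Lemma sel_slot s t x : sel S s -> sel S t -> x ∈ fam FA S -> slot FA S s t x ∈ fam FA S.
Proof. intros [] [] Hx. now apply slot_fam. Qed.

Local Lemma sel_slot_inj s t x s' t' x' : sel S s -> sel S t -> x ∈ fam FA S ->
  sel S s' -> sel S t' -> x' ∈ fam FA S -> slot FA S s t x = slot FA S s' t' x' ->
  s = s' /\ t = t' /\ x = x'.
Proof. intros [] [] ? [] [] ?. now apply slot_inj. Qed.

Lemma blk_meet s t x s' t' x' a : sel S s -> sel S t -> x ∈ fam FA S ->
  sel S s' -> sel S t' -> x' ∈ fam FA S -> a ∈ blk S s t x -> a ∈ blk S s' t' x' ->
  s = s' /\ t = t'.
Proof.
  intros Hs Ht Hx Hs' Ht' Hx' Ha Ha'. pose proof bot_fam as B.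
  apply in_blk in Ha, Ha'.
  destruct Ha as [Ha|Ha], Ha' as [Ha'|Ha'];
    match goal with H1 : a ∈ ?X, H2 : a ∈ ?Y |- _ =>
      assert (E : X = Y) by (apply (fam_disj X Y a); auto using sel_slot) end;
    apply sel_slot_inj in E; tauto.
Qed.

Lemma blk_inj s t x x' : sel S s -> sel S t -> x ∈ fam FA S -> x' ∈ fam FA S -> x <> bot S ->
  blk S s t x = blk S s t x' -> x = x'.
Proof.
  intros Hs Ht Hx Hx' N E. pose proof bot_fam as B.
  pose proof HS as (_ & _ & _ & _ & G5 & _).
  destruct (G5 (slot FA S s t x)) as [a Ha]; [now apply sel_slot|].
  assert (Ha' : a ∈ blk S s t x') by (rewrite <- E; apply in_blk; auto).
  apply in_blk in Ha'. destruct Ha' as [Ha'|Ha'].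
  - assert (K : slot FA S s t x = slot FA S s t (bot S))
      by (apply (fam_disj _ _ a); auto using sel_slot).
    apply sel_slot_inj in K; auto. tauto.
  - assert (K : slot FA S s t x = slot FA S s t x')
      by (apply (fam_disj _ _ a); auto using sel_slot).
    apply sel_slot_inj in K; auto. tauto.
Qed.

Lemma finite_reach s t : sel S s -> sel S t -> finite_set (reach b s t).
Proof.
  intros [Fs Hs] [Ft Ht]. destruct Hb as (B1 & B2 & B3).
  apply (finite_subset (un (bigU s)
           (sep A (fun a => exists x, x ∈ t /\ exists y, pair x y ∈ b /\ a ∈ y)))).
  - apply finite_un.
    + apply finite_bigU; [exact Fs|]. intros x Hx. apply Hs, fam_FA, HFA in Hx. tauto.
    + apply finite_Union with (R := fun x a => exists y, pair x y ∈ b /\ a ∈ y); [defi|exact Ft|].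
      intros x Hx. destruct (classic (exists y, pair x y ∈ b)) as [[y Hy]|N].
      * apply (finite_subset y).
        -- destruct (B1 _ Hy) as (x' & y' & E & _ & Hy' & _). apply pair_inj in E.
           destruct E as [_ ->]. apply HFA in Hy'. tauto.
        -- intros a Ha. apply sepP in Ha; [|defi]. destruct Ha as (_ & y' & Hy' & Ha).
           now rewrite (B2 _ _ _ Hy Hy').
      * apply (finite_subset emp); [exact finite_emp|]. intros a Ha. apply sepP in Ha; [|defi].
        destruct Ha as (_ & y & Hy & _). destruct N. eauto.
  - intros a Ha. apply in_reach in Ha. apply in_un.
    destruct Ha as (HaA & [(x & Hx & Ha)|(x & y & Hx & Hy & Ha)]).
    + left. apply in_bigU. eauto.
    + right. apply sepP; [defi|]. eauto 6.
Qed.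

(* Only finitely many partitions have their value inside [reach b s t], and the blocks
   [blk S s t x] all contain [slot S s t (bot S)], so each of them excludes at most one [x]. *)
Lemma pick_exists s t : sel S s -> sel S t -> exists x, pick S b s t x.
Proof.
  intros Hs Ht. pose proof bot_fam as B.
  set (F := sep BA (fun P => exists E, E ∈ Pow (reach b s t) /\ pair P E ∈ f)).
  assert (FF : finite_set F).
  { apply finite_Union with (R := fun E P => pair P E ∈ f); [defi| |].
    - now apply finite_Pow, finite_reach.
    - intros E HE. apply in_Pow in HE.
      destruct (f_fin E) as (SE & H1 & H2).
      + apply HFA. split.
        * intros a Ha. apply HE in Ha. apply in_reach in Ha. tauto.
        * eapply finite_subset; [|exact HE]. now apply finite_reach.
      + apply (finite_subset SE); [exact H2|]. intros P HP. apply sepP in HP; [|defi].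
        now apply H1. }
  set (N := sep (fam FA S) (fun x => x <> bot S /\ bad S b s t x)).
  assert (FN : finite_set N).
  { apply (finite_image (fun P x => blk S s t x ∈ P) N F); [defi|exact FF| |].
    - intros x x' P Hx Hx' HP HB HB'. unfold N in Hx, Hx'. apply sepP in Hx, Hx'; [|defi|defi].
      destruct Hx as (Hx & Nx & _), Hx' as (Hx' & Nx' & _).
      apply (blk_inj s t); try assumption.
      unfold F in HP. apply sepP in HP; [|defi]. destruct HP as [HP _].
      apply HBA in HP. destruct HP as [(_ & Q & _) _].
      pose proof HS as (_ & _ & _ & _ & G5 & _).
      destruct (G5 (slot FA S s t (bot S))) as [a Ha]; [now apply sel_slot|].
      apply (Q _ _ a); try assumption; apply in_blk; left; exact Ha.
    - intros x Hx. unfold N in Hx. apply sepP in Hx; [|defi].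
      destruct Hx as (Hx & Nx & P & E & HPE & HE & HB). exists P. split; [|exact HB].
      unfold F. apply sepP; [defi|]. split; [now apply f_dom in HPE|].
      exists E. rewrite in_Pow. auto. }
  set (C := sep (fam FA S) (cand S b s t)).
  assert (CP : forall x, x ∈ C <-> cand S b s t x).
  { intros x. unfold C. rewrite sepP by defi. unfold cand. tauto. }
  assert (NC : C <> emp).
  { pose proof HS as (_ & _ & _ & _ & _ & _ & _ & _ & G9).
    destruct (infinite_nonempty _ (infinite_diff _ _ (infinite_diff _ _ G9 (finite_sing (bot S))) FN))
      as [x Hx].
    rewrite !in_diff, in_sing in Hx. destruct Hx as [[Hx Nx] Nb].
    intros E. apply (in_emp x). rewrite <- E. apply CP. split; [exact Hx|]. split; [exact Nx|].
    intros Hbad. apply Nb. unfold N. apply sepP; [defi|]. auto. }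
  pose proof HS as (_ & _ & _ & _ & _ & _ & G7 & _).
  destruct (G7 C) as (x & Hx & Hmin); [|exact NC|].
  - intros x Hx. apply CP in Hx. apply Hx.
  - exists x. split; [now apply CP|]. intros x' Hx'. now apply Hmin, CP.
Qed.

Lemma pick_unique s t x x' : pick S b s t x -> pick S b s t x' -> x = x'.
Proof.
  intros [H1 H2] [H1' H2']. pose proof HS as (_ & _ & _ & _ & _ & _ & _ & G8 & _). auto.
Qed.

Lemma blk_FA s t x : sel S s -> sel S t -> x ∈ fam FA S -> blk S s t x ∈ FA.
Proof.
  intros Hs Ht Hx. pose proof bot_fam as B.
  pose proof (fam_FA _ (sel_slot s t _ Hs Ht B)) as F1.
  pose proof (fam_FA _ (sel_slot s t _ Hs Ht Hx)) as F2.
  apply HFA in F1, F2. destruct F1, F2. apply HFA. split.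
  - intros z Hz. apply in_blk in Hz. destruct Hz; auto.
  - apply (finite_subset (un (slot FA S s t (bot S)) (slot FA S s t x))); [now apply finite_un|].
    intros z Hz. now apply in_un, in_blk.
Qed.

Lemma in_blocks B : B ∈ blocks S b <-> exists s t x,
  sel S s /\ sel S t /\ pick S b s t x /\ B = blk S s t x.
Proof.
  unfold blocks. rewrite sepP by defi. split; [tauto|]. intros H. split; [|exact H].
  destruct H as (s & t & x & Hs & Ht & [[Hx _] _] & ->).
  apply in_Pow. pose proof (blk_FA s t x Hs Ht Hx) as F. apply HFA in F. tauto.
Qed.

Lemma blocks_BA : fill A (blocks S b) ∈ BA.
Proof.
  apply (fill_BA (FA := FA)); auto.
  - intros B HB. apply in_blocks in HB. destruct HB as (s & t & x & Hs & Ht & [[Hx _] _] & ->).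
    split; [now apply blk_FA|]. pose proof HS as (_ & _ & _ & _ & G5 & _).
    destruct (G5 (slot FA S s t x)) as [a Ha]; [now apply sel_slot|].
    exists a. apply in_blk. auto.
  - intros B B' a HB HB' Ha Ha'. apply in_blocks in HB, HB'.
    destruct HB as (s & t & x & Hs & Ht & Hp & ->), HB' as (s' & t' & x' & Hs' & Ht' & Hp' & ->).
    pose proof Hp as [[Hx _] _]. pose proof Hp' as [[Hx' _] _].
    destruct (blk_meet s t x s' t' x' a) as [<- <-]; auto.
    now rewrite (pick_unique s t x x').
Qed.

(** Each point costs one more member of [s] or one more index in [t], so finite induction collects
    them without a choice function. *)
Lemma finite_cover E : finite_set E ->
  (forall a, a ∈ E -> a ∈ A /\
     ((exists x, x ∈ fam FA S /\ a ∈ x) \/ exists x y, pair x y ∈ b /\ a ∈ y)) ->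
  exists s t, sel S s /\ sel S t /\ subset E (reach b s t).
Proof.
  destruct Hb as (B1 & _).
  revert E. refine (finite_induction _ _ _ _).
  - defi.
  - intros _. exists emp, emp.
    assert (K : sel S emp) by (split; [exact finite_emp|]; intros z Hz; destruct (in_emp z Hz)).
    repeat split; try apply K. intros z Hz. destruct (in_emp z Hz).
  - intros E a FE Ha IH H.
    destruct IH as (s & t & [Fs Hs] & [Ft Ht] & HE). { intros z Hz. apply H, in_ins. auto. }
    assert (K : forall s' t', subset s s' -> subset t t' -> subset E (reach b s' t')).
    { intros s' t' Ks Kt z Hz. apply HE, in_reach in Hz.
      apply in_reach. destruct Hz as (HzA & [(x & Hx & Hz)|(x & y & Hx & Hy & Hz)]);
        (split; [exact HzA|]); [left|right]; eauto 6. }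
    destruct (H a) as [HaA [(x & Hx & Hax)|(x & y & Hxy & Hay)]]; [apply in_ins; auto| |].
    + exists (ins x s), t. split; [split; [now apply finite_ins|]|split; [split; auto|]].
      * intros z Hz. apply in_ins in Hz. destruct Hz as [Hz| ->]; auto.
      * intros z Hz. apply in_ins in Hz. destruct Hz as [Hz| ->].
        -- apply (K (ins x s) t); auto using subset_refl. intros w Hw. apply in_ins. auto.
        -- apply in_reach. split; [exact HaA|]. left. exists x.
           rewrite in_ins. auto.
    + exists s, (ins x t). split; [split; auto|split; [split; [now apply finite_ins|]|]].
      * intros z Hz. apply in_ins in Hz. destruct Hz as [Hz| ->]; auto.
        destruct (B1 _ Hxy) as (x' & y' & E' & Hx' & _). apply pair_inj in E'.
        destruct E' as [-> _]. exact Hx'.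
      * intros z Hz. apply in_ins in Hz. destruct Hz as [Hz| ->].
        -- apply (K s (ins x t)); auto using subset_refl. intros w Hw. apply in_ins. auto.
        -- apply in_reach. split; [exact HaA|]. right. exists x, y.
           rewrite in_ins. auto.
Qed.

Lemma in_newD a : a ∈ newD S b <-> a ∈ A /\ a ∈ newE S b /\
  (forall x, x ∈ fam FA S -> ~ a ∈ x) /\ forall x y, pair x y ∈ b -> ~ a ∈ y.
Proof. unfold newD. rewrite sepP by defi. reflexivity. Qed.

Lemma newE_spec : newE S b ∈ FA /\ pair (fill A (blocks S b)) (newE S b) ∈ f.
Proof.
  destruct (f_total _ blocks_BA) as (E & HE & H).
  replace (newE S b) with E; [auto|]. symmetry. unfold newE. apply theP; [defi|auto|auto|].
  intros E' _ H'. eauto.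
Qed.

Lemma newD_FA : newD S b ∈ FA.
Proof.
  destruct newE_spec as [HE _]. apply HFA in HE. destruct HE as [HE FE]. apply HFA. split.
  - intros a Ha. now apply in_newD in Ha.
  - apply (finite_subset _ _ FE). intros a Ha. now apply in_newD in Ha.
Qed.

(** Otherwise the value of the diagonal partition would lie in [reach b s t] for some pair [(s, t)].
    The partition contains the block picked for this very pair, and that block was picked so as to
    occur in no partition with value in that region. *)
Lemma newD_nonempty : exists a, a ∈ newD S b.
Proof.
  apply NNPP. intros N. destruct newE_spec as [HE Hf]. apply HFA in HE. destruct HE as [HE FE].
  destruct (finite_cover _ FE) as (s & t & Hs & Ht & Hst).
  - intros a Ha. split; [auto|]. apply NNPP. intros N'. apply N. exists a. apply in_newD.
    split; [auto|]. split; [exact Ha|]. split.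
    + intros x Hx Hax. apply N'. eauto.
    + intros x y Hxy Hay. apply N'. eauto.
  - destruct (pick_exists s t Hs Ht) as [x Hx]. pose proof Hx as [(Hxf & _ & Nbad) _].
    apply Nbad. exists (fill A (blocks S b)), (newE S b). split; [exact Hf|]. split; [exact Hst|].
    apply in_fill. split.
    + pose proof (blk_FA s t x Hs Ht Hxf) as F. apply HFA in F. tauto.
    + left. apply in_blocks. eauto 7.
Qed.

Lemma next_exists x : x ∈ fam FA S -> ~ (exists y, pair x y ∈ b) -> exists x', next S b x'.
Proof.
  intros Hx Nx. pose proof HS as (_ & _ & _ & _ & _ & _ & G7 & _).
  set (Y := sep (fam FA S) (fun x => ~ exists y, pair x y ∈ b)).
  assert (YP : forall x, x ∈ Y <-> x ∈ fam FA S /\ ~ exists y, pair x y ∈ b).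
  { intros z. unfold Y. rewrite sepP by defi. reflexivity. }
  destruct (G7 Y) as (u & Hu & Hmin).
  - intros z Hz. now apply YP in Hz.
  - intros E. apply (in_emp x). rewrite <- E. now apply YP.
  - apply YP in Hu. exists u. split; [tauto|]. split; [tauto|]. intros x' Hx' Nx'.
    now apply Hmin, YP.
Qed.

Lemma in_stepB p : p ∈ stepB S b <-> p ∈ b \/ exists x, next S b x /\ p = pair x (newD S b).
Proof.
  unfold stepB. rewrite sepP by defi. split; [tauto|]. intros H. split; [|exact H].
  destruct H as [H|(x & [Hx _] & ->)].
  - destruct Hb as (B1 & _). destruct (B1 p H) as (x & y & -> & Hx & Hy & _).
    apply in_prod_pair. auto using fam_FA.
  - apply in_prod_pair. auto using fam_FA, newD_FA.
Qed.

Lemma next_unique x x' : next S b x -> next S b x' -> x = x'.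
Proof.
  intros (H1 & H2 & H3) (K1 & K2 & K3).
  pose proof HS as (_ & _ & _ & _ & _ & _ & _ & G8 & _). auto.
Qed.

Lemma pair_stepB x y : pair x y ∈ stepB S b <-> pair x y ∈ b \/ next S b x /\ y = newD S b.
Proof.
  rewrite in_stepB. split; intros [H|H]; auto.
  - destruct H as (x' & H & E). apply pair_inj in E. destruct E; subst; auto.
  - destruct H as [H ->]. eauto.
Qed.

Lemma stepB_GoodB : GoodB S (stepB S b).
Proof.
  pose proof Hb as (B1 & B2 & B3). split; [|split].
  - intros p Hp. apply in_stepB in Hp. destruct Hp as [Hp|(x & Hx & ->)]; [auto|].
    exists x, (newD S b). split; [reflexivity|]. split; [apply Hx|]. split; [exact newD_FA|].
    split; [exact newD_nonempty|]. intros x' a Hx' Ha Ha'. apply in_newD in Ha'.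
    destruct Ha' as (_ & _ & K & _). exact (K x' Hx' Ha).
  - intros x y y' Hy Hy'. apply pair_stepB in Hy, Hy'.
    destruct Hy as [Hy|[(_ & N & _) ->]], Hy' as [Hy'|[(_ & N' & _) ->]]; eauto; exfalso; eauto.
  - intros x y x' y' a Hy Hy' Ha Ha'. apply pair_stepB in Hy, Hy'.
    destruct Hy as [Hy|[Hx ->]], Hy' as [Hy'|[Hx' ->]].
    + eauto.
    + apply in_newD in Ha'. destruct Ha' as (_ & _ & _ & K). destruct (K _ _ Hy Ha).
    + apply in_newD in Ha. destruct Ha as (_ & _ & _ & K). destruct (K _ _ Hy' Ha').
    + now apply next_unique.
Qed.

End OneStep.

Lemma in_PB S b : b ∈ PB S <-> GoodB S b.
Proof.
  unfold PB. rewrite sepP, in_Pow by defi. split; [tauto|]. intros H. split; [|exact H].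
  destruct H as (B1 & _). intros p Hp. destruct (B1 p Hp) as (x & y & -> & Hx & Hy & _).
  apply in_prod_pair. apply in_fam in Hx. tauto.
Qed.

(** A fixed point of [stepB] is total: if some member had no copy, the least such member would
    receive one in the next step. *)
Lemma copy_spec S : Good FA S ->
  GoodB S (copy S) /\ forall x, x ∈ fam FA S -> exists y, pair x y ∈ copy S.
Proof.
  intros HS. destruct (bourbaki_witt (PB S) emp (stepB S)) as [H1 H2].
  - defi.
  - apply in_PB. repeat split; intros; exfalso; eapply in_emp; eassumption.
  - intros x _ z Hz. destruct (in_emp z Hz).
  - intros b Hb. apply in_PB in Hb. apply in_PB. now apply stepB_GoodB.
  - intros b Hb p Hp. apply in_PB in Hb. apply in_stepB; auto.
  - intros C HC NC CC. apply in_PB.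
    assert (HG : forall b, b ∈ C -> GoodB S b) by (intros b Hb; now apply in_PB, HC).
    assert (Tw : forall p p', p ∈ bigU C -> p' ∈ bigU C -> exists b, b ∈ C /\ p ∈ b /\ p' ∈ b).
    { intros p p' Hp Hp'. apply in_bigU in Hp, Hp'. destruct Hp as (b & Hb & Hp), Hp' as (b' & Hb' & Hp').
      destruct (CC b b' Hb Hb'); eauto. }
    split; [|split].
    + intros p Hp. apply in_bigU in Hp. destruct Hp as (b & Hb & Hp).
      destruct (HG b Hb) as (B1 & _). auto.
    + intros x y y' Hy Hy'. destruct (Tw _ _ Hy Hy') as (b & Hb & K & K').
      destruct (HG b Hb) as (_ & B2 & _). eauto.
    + intros x y x' y' a Hy Hy'. destruct (Tw _ _ Hy Hy') as (b & Hb & K & K').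
      destruct (HG b Hb) as (_ & _ & B3). eauto.
  - fold (copy S) in H1, H2. apply in_PB in H1. split; [exact H1|]. intros x Hx.
    apply NNPP. intros N. destruct (next_exists S (copy S) HS x Hx N) as [x' Hx'].
    pose proof Hx' as (_ & N' & _). apply N'. exists (newD S (copy S)).
    (* By the fixed-point equation, the pair that the step would add is already in the copy. *)
    rewrite <- H2 at 2. apply pair_stepB; auto.
Qed.

End Diagonal.

#[global] Hint Resolve Def_copy : defs.

(** * Doubling a structure *)

Section Doubling.

Context {M : set_structure} {HM : ZF M}.
Context (FA : M) (cp : M -> M).

Definition triples := prod (Pow FA) (prod FA (Pow FA)).

Definition fam2 (S : M) := sep FA (fun y => y ∈ fam FA S \/ exists x, pair x y ∈ cp S).
Definition pre (S s : M) := sep (fam FA S) (fun x => exists y, y ∈ s /\ pair x y ∈ cp S).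
(** The doubled order puts all old members first and then the copies in the order of their
    originals; for a copy [v], the set at [{v}] is the segment up to [v]. *)
Definition seg2 (S s : M) := sep FA (fun u => u ∈ fam FA S \/
  exists x x', pair x u ∈ cp S /\ x' ∈ pre S s /\ leS S x x').
(** A finite subset of the doubled family is coded by its old part together with the originals of
    its new part. If it is new, its value will be the copy of this code: the values of old subsets
    are old members, so the two kinds never collide. *)
Definition key (S s : M) := qpair FA S (qv FA S (inter s (fam FA S))) (qv FA S (pre S s)).
Definition newtrip (S s y D : M) := finite_set s /\ subset s (fam2 S) /\
  ~ subset s (fam FA S) /\ pair (key S s) y ∈ cp S /\ D = seg2 S s.
Definition dbl (S : M) := un S (sep triples (fun p => exists s y D,
  newtrip S s y D /\ p = trip s y D)).

Hypothesis (Def_cp : DefFun1 cp).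
Hint Resolve Def_cp : defs.

Lemma in_fam2 S y : y ∈ fam2 S <-> y ∈ FA /\ (y ∈ fam FA S \/ exists x, pair x y ∈ cp S).
Proof. unfold fam2. rewrite sepP by defi. reflexivity. Qed.

Lemma in_pre S s x : x ∈ pre S s <-> x ∈ fam FA S /\ exists y, y ∈ s /\ pair x y ∈ cp S.
Proof. unfold pre. rewrite sepP by defi. reflexivity. Qed.

Lemma Def_fam2 : DefFun1 fam2.
Proof. unfold fam2. defi. Qed.
Lemma Def_pre : DefFun2 pre.
Proof. unfold pre. defi. Qed.
Hint Resolve Def_fam2 Def_pre : defs.
Lemma Def_seg2 : DefFun2 seg2.
Proof. unfold seg2. defi. Qed.
Lemma Def_key : DefFun2 key.
Proof. unfold key. defi. Qed.
Hint Resolve Def_seg2 Def_key : defs.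
Lemma Def_newtrip : Def4 newtrip.
Proof. unfold newtrip. defi. Qed.
Hint Resolve Def_newtrip : defs.
Lemma Def_dbl : DefFun1 dbl.
Proof. unfold dbl. defi. Qed.

Lemma in_seg2 S s u : u ∈ seg2 S s <-> u ∈ FA /\ (u ∈ fam FA S \/
  exists x x', pair x u ∈ cp S /\ x' ∈ pre S s /\ leS S x x').
Proof. unfold seg2. rewrite sepP by defi. reflexivity. Qed.

Context (S : M) (HS : Good FA S) (Hcp : GoodB FA S (cp S)).
Hypothesis (cp_total : forall x, x ∈ fam FA S -> exists y, pair x y ∈ cp S).

Local Lemma cp_dom x y : pair x y ∈ cp S -> x ∈ fam FA S /\ y ∈ FA /\ ~ y ∈ fam FA S.
Proof.
  intros H. destruct Hcp as (B1 & _). destruct (B1 _ H) as (x' & y' & E & Hx & Hy & [a Ha] & Dj).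
  apply pair_inj in E. destruct E as [-> ->]. split; [exact Hx|]. split; [exact Hy|].
  intros Hf. exact (Dj _ a Hf Ha Ha).
Qed.

Local Lemma cp_fun x y y' : pair x y ∈ cp S -> pair x y' ∈ cp S -> y = y'.
Proof. destruct Hcp as (_ & B2 & _). eauto. Qed.

Local Lemma cp_inj x x' y : pair x y ∈ cp S -> pair x' y ∈ cp S -> x = x'.
Proof.
  intros H H'. destruct Hcp as (B1 & _ & B3). destruct (B1 _ H) as (u & v & E & _ & _ & [a Ha] & _).
  apply pair_inj in E. destruct E as [<- <-]. eauto.
Qed.

Local Lemma fam_fam2 y : y ∈ fam FA S -> y ∈ fam2 S.
Proof. intros H. apply in_fam2. split; [now apply in_fam in H|auto]. Qed.

Local Lemma cp_fam2 x y : pair x y ∈ cp S -> y ∈ fam2 S.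
Proof. intros H. apply in_fam2. split; [now apply cp_dom in H|eauto]. Qed.

Local Lemma sel_low s : finite_set s -> finite_set (inter s (fam FA S)) /\
  subset (inter s (fam FA S)) (fam FA S).
Proof.
  intros Fs. split.
  - apply (finite_subset s); [exact Fs|]. intros z Hz. now apply in_inter in Hz.
  - intros z Hz. now apply in_inter in Hz.
Qed.

Local Lemma sel_pre s : finite_set s -> finite_set (pre S s) /\ subset (pre S s) (fam FA S).
Proof.
  intros Fs. split.
  - apply (finite_image (fun y x => pair x y ∈ cp S) _ s); [defi|exact Fs| |].
    + intros x x' y _ _ _. apply cp_inj.
    + intros x Hx. apply in_pre in Hx. tauto.
  - intros x Hx. now apply in_pre in Hx.
Qed.

Local Lemma key_fam s : finite_set s -> key S s ∈ fam FA S.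
Proof.
  intros Fs. destruct (sel_low s Fs), (sel_pre s Fs). unfold key.
  apply qpair_fam; auto; apply qv_fam; auto.
Qed.

Local Lemma key_inj s s' : finite_set s -> finite_set s' -> subset s (fam2 S) ->
  subset s' (fam2 S) -> key S s = key S s' -> s = s'.
Proof.
  intros Fs Fs' Hs Hs' E. destruct (sel_low s Fs), (sel_pre s Fs), (sel_low s' Fs'), (sel_pre s' Fs').
  apply qpair_inj in E; auto; try (apply qv_fam; auto).
  destruct E as [E1 E2]. apply qv_inj in E1; auto. apply qv_inj in E2; auto.
  assert (G : forall s s', subset s (fam2 S) -> inter s (fam FA S) = inter s' (fam FA S) ->
            pre S s = pre S s' -> subset s s').
  { clear - Hcp Def_cp HM. intros s s' Hs E1 E2 z Hz. pose proof (Hs z Hz) as Hz2. apply in_fam2 in Hz2.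
    destruct Hz2 as [_ [Hf|[x Hx]]].
    - assert (K : z ∈ inter s' (fam FA S)) by (rewrite <- E1; now apply in_inter).
      now apply in_inter in K.
    - assert (K : x ∈ pre S s').
      { rewrite <- E2. apply in_pre. split; [now apply cp_dom in Hx|]. eauto. }
      apply in_pre in K. destruct K as (_ & y & Hy & Hxy). now rewrite (cp_fun _ _ _ Hx Hxy). }
  apply subset_antisym; apply G; auto.
Qed.

Lemma trip_dbl s y D : trip s y D ∈ dbl S <-> trip s y D ∈ S \/ newtrip S s y D.
Proof.
  unfold dbl. rewrite in_un, sepP by defi. split; intros [H|H]; auto.
  - destruct H as (_ & s' & y' & D' & H & E). apply trip_inj in E. destruct E as (-> & -> & ->). auto.
  - right. split; [|eauto 6]. destruct H as (Fs & Hs & _ & Hy & ->).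
    apply in_prod_pair. split.
    + apply in_Pow. intros z Hz. apply Hs in Hz. now apply in_fam2 in Hz.
    + apply in_prod_pair. split; [now apply cp_dom in Hy|]. apply in_Pow. intros z Hz.
      now apply in_seg2 in Hz.
Qed.

Local Lemma trip_S s y D : trip s y D ∈ S -> finite_set s /\ subset s (fam FA S) /\ y ∈ fam FA S /\
  subset D (fam FA S).
Proof.
  intros H. destruct HS as (G1 & _). destruct (G1 _ H) as (s' & y' & D' & E & K).
  apply trip_inj in E. destruct E as (-> & -> & ->). exact K.
Qed.

Lemma newtrip_exists s : finite_set s -> subset s (fam2 S) -> ~ subset s (fam FA S) ->
  exists y, newtrip S s y (seg2 S s).
Proof.
  intros Fs Hs N. destruct (cp_total (key S s)) as [y Hy]; [now apply key_fam|].
  exists y. repeat split; auto.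
Qed.

Lemma fam_dbl : fam FA (dbl S) = fam2 S.
Proof.
  apply extensionality. intros x. rewrite in_fam, in_fam2. split.
  - intros (Hx & y & D & Ht). split; [exact Hx|]. apply trip_dbl in Ht. destruct Ht as [Ht|Ht].
    + left. apply in_fam. eauto.
    + destruct Ht as (_ & Hs & _). specialize (Hs x). rewrite in_sing, in_fam2 in Hs.
      now apply Hs.
  - intros (Hx & H). split; [exact Hx|]. destruct (classic (x ∈ fam FA S)) as [Hf|Nf].
    + apply in_fam in Hf. destruct Hf as (_ & y & D & Ht). exists y, D. apply trip_dbl. auto.
    + destruct (newtrip_exists (sing x)) as [y Hy].
      * apply finite_sing.
      * intros z Hz. apply in_sing in Hz. subst z. apply in_fam2. auto.
      * intros K. apply Nf, K, in_sing. reflexivity.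
      * exists y, (seg2 S (sing x)). apply trip_dbl. auto.
Qed.

Lemma leS_dbl_low u v : v ∈ fam FA S -> (leS (dbl S) u v <-> leS S u v).
Proof.
  intros Hv. split.
  - intros (y & D & Ht & Hu). apply trip_dbl in Ht. destruct Ht as [Ht|Ht].
    + exists y, D. auto.
    + destruct Ht as (_ & _ & N & _). destruct N. now apply sing_fam.
  - intros (y & D & Ht & Hu). exists y, D. rewrite trip_dbl. auto.
Qed.

Lemma leS_dbl_high u x' v : pair x' v ∈ cp S -> (leS (dbl S) u v <->
  u ∈ fam FA S \/ exists x, pair x u ∈ cp S /\ leS S x x').
Proof.
  intros Hv. destruct (cp_dom _ _ Hv) as (Hx' & HvF & Nv).
  assert (K : u ∈ seg2 S (sing v) <-> u ∈ fam FA S \/ exists x, pair x u ∈ cp S /\ leS S x x').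
  { rewrite in_seg2. split.
    - intros (_ & [Hu|(x & x2 & Hxu & Hx2 & L)]); [auto|]. right. exists x. split; [exact Hxu|].
      apply in_pre in Hx2. destruct Hx2 as (_ & w & Hw & Hxw). apply in_sing in Hw. subst w.
      now rewrite (cp_inj _ _ _ Hv Hxw).
    - intros [Hu|(x & Hxu & L)].
      + split; [now apply in_fam in Hu|auto].
      + split; [now apply cp_dom in Hxu|]. right. exists x, x'. split; [exact Hxu|].
        split; [|exact L]. apply in_pre. split; [exact Hx'|]. exists v. rewrite in_sing. auto. }
  rewrite <- K. split.
  - intros (y & D & Ht & Hu). apply trip_dbl in Ht. destruct Ht as [Ht|Ht].
    + destruct Nv. apply trip_S in Ht. destruct Ht as (_ & Ht & _). now apply Ht, in_sing.
    + destruct Ht as (_ & _ & _ & _ & ->). exact Hu.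
  - intros Hu. destruct (newtrip_exists (sing v)) as [y Hy].
    + apply finite_sing.
    + intros z Hz. apply in_sing in Hz. subst z. eapply cp_fam2. eassumption.
    + intros K'. apply Nv, K', in_sing. reflexivity.
    + exists y, (seg2 S (sing v)). rewrite trip_dbl. auto.
Qed.

Lemma Good_dbl : Good FA (dbl S).
Proof.
  pose proof HS as (G1 & G2 & G3 & G4 & G5 & G6 & G7 & G8 & G9).
  pose proof Hcp as (B1 & B2 & B3).
  assert (C2 : forall x, x ∈ fam2 S -> x ∈ fam FA S \/ exists u, pair u x ∈ cp S).
  { intros x Hx. now apply in_fam2 in Hx. }
  unfold Good. rewrite fam_dbl.
  split; [|split; [|split; [|split; [|split; [|split; [|split; [|split]]]]]]].
  - intros p Hp.
    assert (Hp' : exists s y D, p = trip s y D).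
    { unfold dbl in Hp. apply in_un in Hp. destruct Hp as [Hp|Hp].
      - destruct (G1 p Hp) as (s & y & D & E & _). eauto.
      - apply sepP in Hp; [|defi]. destruct Hp as (_ & s & y & D & _ & E). eauto. }
    destruct Hp' as (s & y & D & ->). exists s, y, D. split; [reflexivity|].
    apply trip_dbl in Hp. destruct Hp as [Hp|(Fs & Hs & _ & Hy & ->)].
    + destruct (trip_S _ _ _ Hp) as (K1 & K2 & K3 & K4).
      repeat split; auto using fam_fam2; intros z Hz; apply fam_fam2; auto.
    + repeat split; auto.
      * eapply cp_fam2; eassumption.
      * intros z Hz. apply in_seg2 in Hz. destruct Hz as (Hz & [K|(x & x' & K & _)]).
        -- now apply fam_fam2.
        -- eapply cp_fam2; eassumption.
  - intros s y D y' D' Ht Ht'. apply trip_dbl in Ht, Ht'.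
    destruct Ht as [Ht|(_ & _ & N & Hy & ->)], Ht' as [Ht'|(_ & _ & N' & Hy' & ->)].
    + eauto.
    + destruct N'. now apply trip_S in Ht.
    + destruct N. now apply trip_S in Ht'.
    + split; [|reflexivity]. eauto.
  - intros s Fs Hs. destruct (classic (subset s (fam FA S))) as [K|K].
    + destruct (G3 s Fs K) as (y & D & Ht). exists y, D. rewrite trip_dbl. auto.
    + destruct (newtrip_exists s Fs Hs K) as [y Hy]. exists y, (seg2 S s). rewrite trip_dbl. auto.
  - intros s s' y D D' Ht Ht'. apply trip_dbl in Ht, Ht'.
    destruct Ht as [Ht|(Fs & Hs & N & Hy & _)], Ht' as [Ht'|(Fs' & Hs' & N' & Hy' & _)].
    + eauto.
    + apply trip_S in Ht. apply cp_dom in Hy'. tauto.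
    + apply trip_S in Ht'. apply cp_dom in Hy. tauto.
    + apply key_inj; auto. eapply cp_inj; eassumption.
  - intros x Hx. destruct (C2 x Hx) as [H|[u H]]; [auto|].
    destruct (B1 _ H) as (u' & v & E & _ & _ & K & _). apply pair_inj in E. destruct E as [_ ->].
    exact K.
  - assert (Dj : forall u x x' a, pair u x ∈ cp S -> x' ∈ fam FA S -> a ∈ x -> ~ a ∈ x').
    { intros u x x' a H Hx' Ha Ha'. destruct (B1 _ H) as (u' & v & E & _ & _ & _ & K).
      apply pair_inj in E. destruct E as [_ ->]. exact (K x' a Hx' Ha' Ha). }
    intros x x' a Hx Hx' Ha Ha'.
    destruct (C2 x Hx) as [H|[u H]], (C2 x' Hx') as [H'|[u' H']].
    + eauto.
    + destruct (Dj _ _ _ _ H' H Ha' Ha).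
    + destruct (Dj _ _ _ _ H H' Ha Ha').
    + rewrite (B3 _ _ _ _ _ H H' Ha Ha') in H. eauto.
  (* If [Y] meets the old family, the least old member of [Y] works, since copies come later;
     otherwise the copy of the least original does. *)
  - intros Y HY NY. destruct (classic (inter Y (fam FA S) = emp)) as [E|N].
    + assert (HYh : forall y, y ∈ Y -> exists x, pair x y ∈ cp S).
      { intros y Hy. destruct (C2 y (HY y Hy)) as [H|H]; [|exact H].
        destruct (in_emp y). rewrite <- E. now apply in_inter. }
      destruct (G7 (pre S Y)) as (x & Hx & Hmin).
      * intros z Hz. now apply in_pre in Hz.
      * intros E'. destruct (nonempty Y NY) as [y Hy]. destruct (HYh y Hy) as [x Hx].
        apply (in_emp x). rewrite <- E'. apply in_pre. split; [now apply cp_dom in Hx|eauto].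
      * apply in_pre in Hx. destruct Hx as (Hx & u & Hu & Hxu). exists u. split; [exact Hu|].
        intros y Hy. destruct (HYh y Hy) as [x' Hx']. apply (leS_dbl_high _ _ _ Hx'). right.
        exists x. split; [exact Hxu|]. apply Hmin, in_pre. split; [now apply cp_dom in Hx'|eauto].
    + destruct (G7 (inter Y (fam FA S))) as (x & Hx & Hmin); [|exact N|].
      * intros z Hz. now apply in_inter in Hz.
      * apply in_inter in Hx. destruct Hx as [HxY Hx]. exists x. split; [exact HxY|].
        intros y Hy. destruct (C2 y (HY y Hy)) as [H|[u H]].
        -- apply leS_dbl_low; [exact H|]. apply Hmin, in_inter. auto.
        -- apply (leS_dbl_high _ _ _ H). auto.
  - intros u v L1 L2.
    assert (Fd : forall u v, leS (dbl S) u v -> v ∈ fam2 S).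
    { intros u' v' (y & D & Ht & _). apply trip_dbl in Ht. destruct Ht as [Ht|Ht].
      - apply fam_fam2. apply trip_S in Ht. destruct Ht as (_ & Ht & _). now apply Ht, in_sing.
      - destruct Ht as (_ & K & _). apply K, in_sing. reflexivity. }
    destruct (C2 v (Fd _ _ L1)) as [Hv|[x' Hv]].
    + apply leS_dbl_low in L1; [|exact Hv]. pose proof (leS_fam FA S u v HS L1) as Hu.
      apply leS_dbl_low in L2; [|exact Hu]. auto.
    + destruct (C2 u (Fd _ _ L2)) as [Hu|[x Hu]].
      * apply leS_dbl_low in L2; [|exact Hu]. apply leS_fam with (FA := FA) in L2; [|exact HS].
        apply cp_dom in Hv. tauto.
      * apply (leS_dbl_high _ _ _ Hv) in L1. apply (leS_dbl_high _ _ _ Hu) in L2.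
        destruct L1 as [L1|(w & Hw & L1)]; [apply cp_dom in Hu; tauto|].
        destruct L2 as [L2|(w' & Hw' & L2)]; [apply cp_dom in Hv; tauto|].
        rewrite (cp_inj _ _ _ Hw Hu) in L1. rewrite (cp_inj _ _ _ Hw' Hv) in L2.
        rewrite (G8 _ _ L1 L2) in Hu. eauto.
  - intros F. apply G9. eapply finite_subset; [exact F|]. intros z. apply fam_fam2.
Qed.

Lemma dbl_grows : subset S (dbl S) /\ dbl S <> S.
Proof.
  split.
  - intros p Hp. unfold dbl. apply in_un. auto.
  - intros E. destruct HS as (_ & _ & _ & _ & _ & _ & _ & _ & G9).
    destruct (infinite_nonempty _ G9) as [x Hx]. destruct (cp_total x Hx) as [y Hy].
    destruct (cp_dom _ _ Hy) as (_ & _ & N). apply N. rewrite <- E, fam_dbl.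
    eapply cp_fam2; eassumption.
Qed.

End Doubling.

#[global] Hint Resolve Def_dbl : defs.

(** * The initial structure *)

Section Base.

Context {M : set_structure} {HM : ZF M}.
Context (FA P b : M) (Phi : M -> M).
Hypothesis (HPhi : DefFun1 Phi) (HbP : b ∈ P) (Hb : forall x, x ∈ P -> subset b x).
Hypothesis (HP : forall x, x ∈ P -> Phi x ∈ P) (Hinc : forall x, x ∈ P -> subset x (Phi x)).
Hypothesis (Hstrict : forall x, x ∈ P -> Phi x <> x).
Hypothesis (Hfin : forall x, x ∈ P -> finite_set x).
Hypothesis (Hdown : forall x y, subset b x -> subset x y -> y ∈ P -> x ∈ P).
Hypothesis (HU : forall C, subset C P -> C <> emp -> finite_set C -> bigU C ∈ P).
Hypothesis (HFA : forall x, x ∈ P -> diff (Phi x) x ∈ FA).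

Notation T := (tower P b Phi).
Notation rank := (rank_of P b Phi).

Definition gap U := diff (Phi U) U.
Definition gaps := sep FA (fun x => exists U, U ∈ T /\ x = gap U).
Definition pre0 s := sep T (fun U => gap U ∈ s).
Definition seg0 s := sep FA (fun u => exists U V, U ∈ T /\ V ∈ pre0 s /\ subset U V /\ u = gap U).
(** The family consists of the differences between consecutive members of the tower, ordered like
    the tower. A finite set [s] of them is sent to the difference at the colexicographic rank of the
    corresponding set of tower members. *)
Definition base := sep (triples FA) (fun p => exists s U, finite_set s /\ subset s gaps /\
  rank (pre0 s) U /\ p = trip s (gap U) (seg0 s)).

Lemma Def_gap : DefFun1 gap.
Proof. unfold gap. defi. Qed.
Hint Resolve Def_gap Def_rank_of : defs.
Lemma Def_pre0 : DefFun1 pre0.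
Proof. unfold pre0. defi. Qed.
Hint Resolve Def_pre0 : defs.
Lemma Def_seg0 : DefFun1 seg0.
Proof. unfold seg0. defi. Qed.
Hint Resolve Def_seg0 : defs.

Local Lemma TP x : x ∈ T -> x ∈ P.
Proof. now apply tower_sub. Qed.

Lemma gap_nonempty U : U ∈ T -> exists a, a ∈ gap U.
Proof.
  intros H. apply TP in H. apply NNPP. intros N. apply (Hstrict U H).
  apply subset_antisym; [|auto]. intros z Hz. apply NNPP. intros Nz. apply N. exists z.
  now apply in_diff.
Qed.

(** Of two distinct members of the tower, one contains the successor of the other and hence the
    whole gap of the other. *)
Lemma gap_meet U V a : U ∈ T -> V ∈ T -> a ∈ gap U -> a ∈ gap V -> U = V.
Proof.
  assert (G : forall U V, U ∈ T -> V ∈ T -> a ∈ gap U -> a ∈ gap V -> subset U V).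
  { intros U' V' HU' HV' Ha Ha'. apply in_diff in Ha, Ha'.
    destruct (tower_cmp P b Phi HPhi HbP Hb HP Hinc U' V' HU' HV') as [H|H]; [exact H|].
    destruct Ha as [_ Na]. destruct Na. now apply H. }
  intros HU' HV' Ha Ha'. apply subset_antisym; auto.
Qed.

Lemma gap_inj U V : U ∈ T -> V ∈ T -> gap U = gap V -> U = V.
Proof.
  intros HU' HV' E. destruct (gap_nonempty U HU') as [a Ha]. apply (gap_meet U V a); auto.
  now rewrite <- E.
Qed.

Lemma in_gaps x : x ∈ gaps <-> exists U, U ∈ T /\ x = gap U.
Proof.
  unfold gaps. rewrite sepP by defi. split; [tauto|]. intros (U & H & ->).
  split; [|eauto]. now apply HFA, TP.
Qed.

Lemma in_pre0 s U : U ∈ pre0 s <-> U ∈ T /\ gap U ∈ s.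
Proof. unfold pre0. rewrite sepP by defi. reflexivity. Qed.

Lemma in_seg0 s u : u ∈ seg0 s <-> exists U V, U ∈ T /\ V ∈ pre0 s /\ subset U V /\ u = gap U.
Proof.
  unfold seg0. rewrite sepP by defi. split; [tauto|]. intros H. split; [|exact H].
  destruct H as (U & V & H & _ & _ & ->). now apply HFA, TP.
Qed.

Lemma finite_pre0 s : finite_set s -> finite_set (pre0 s) /\ subset (pre0 s) T.
Proof.
  intros Fs. split.
  - apply (finite_image (fun x U => x = gap U) _ s); [defi|exact Fs| |].
    + intros U V x HU' HV' _ E E'. apply in_pre0 in HU', HV'. apply gap_inj; [tauto|tauto|congruence].
    + intros U HU'. apply in_pre0 in HU'. exists (gap U). tauto.
  - intros U HU'. now apply in_pre0 in HU'.
Qed.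

Lemma pre0_inj s s' : subset s gaps -> subset s' gaps -> pre0 s = pre0 s' -> s = s'.
Proof.
  assert (G : forall s s', subset s gaps -> pre0 s = pre0 s' -> subset s s').
  { intros t t' Ht E x Hx. destruct (proj1 (in_gaps x) (Ht x Hx)) as (U & HU' & ->).
    assert (K : U ∈ pre0 t') by (rewrite <- E; now apply in_pre0). now apply in_pre0 in K. }
  intros Hs Hs' E. apply subset_antisym; auto.
Qed.

Lemma trip_base s y D : trip s y D ∈ base <->
  finite_set s /\ subset s gaps /\ (exists U, rank (pre0 s) U /\ y = gap U) /\ D = seg0 s.
Proof.
  unfold base. rewrite sepP by defi. split.
  - intros (_ & s' & U & H1 & H2 & H3 & E). apply trip_inj in E. destruct E as (-> & -> & ->). eauto 6.
  - intros (H1 & H2 & (U & H3 & ->) & ->). split; [|eauto 7].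
    apply in_prod_pair. split.
    + apply in_Pow. intros x Hx. apply H2, in_gaps in Hx. destruct Hx as (V & HV & ->).
      now apply HFA, TP.
    + apply in_prod_pair. split.
      * apply HFA, TP. apply H3.
      * apply in_Pow. intros x Hx. apply in_seg0 in Hx. destruct Hx as (V & _ & HV & _ & _ & ->).
        now apply HFA, TP.
Qed.

Lemma base_total s : finite_set s -> subset s gaps -> exists U, rank (pre0 s) U.
Proof. intros Fs Hs. destruct (finite_pre0 s Fs). now apply rank_of_total. Qed.

Lemma fam_base : fam FA base = gaps.
Proof.
  apply extensionality. intros x. rewrite in_fam. split.
  - intros (_ & y & D & Ht). apply trip_base in Ht. destruct Ht as (_ & Hs & _).
    now apply Hs, in_sing.
  - intros Hx. split.
    + apply in_gaps in Hx. destruct Hx as (U & HU' & ->). now apply HFA, TP.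
    + assert (Hs : subset (sing x) gaps) by (intros z Hz; apply in_sing in Hz; now subst).
      destruct (base_total (sing x) (finite_sing x) Hs) as [U HU'].
      exists (gap U), (seg0 (sing x)). apply trip_base. repeat split; auto.
      * apply finite_sing.
      * eauto.
Qed.

Lemma leS_base U V : U ∈ T -> V ∈ T -> (leS base (gap U) (gap V) <-> subset U V).
Proof.
  intros HU' HV'. split.
  - intros (y & D & Ht & Hu). apply trip_base in Ht. destruct Ht as (_ & _ & _ & ->).
    apply in_seg0 in Hu. destruct Hu as (U2 & V2 & H1 & H2 & H3 & E).
    apply in_pre0 in H2. destruct H2 as [H2 E2]. apply in_sing in E2.
    apply gap_inj in E, E2; auto. now subst.
  - intros H.
    assert (Hs : subset (sing (gap V)) gaps).
    { intros z Hz. apply in_sing in Hz. subst z. apply in_gaps. eauto. }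
    destruct (base_total (sing (gap V)) (finite_sing _) Hs) as [W HW].
    exists (gap W), (seg0 (sing (gap V))). split.
    + apply trip_base. split; [apply finite_sing|]. split; [exact Hs|]. split; [eauto|reflexivity].
    + apply in_seg0. exists U, V. repeat split; auto. apply in_pre0. split; [exact HV'|].
      now apply in_sing.
Qed.

Lemma leS_base_gaps x y : leS base x y -> x ∈ gaps /\ y ∈ gaps.
Proof.
  intros (z & D & Ht & Hx). apply trip_base in Ht. destruct Ht as (_ & Hs & _ & ->). split.
  - apply in_seg0 in Hx. destruct Hx as (U & _ & H & _ & _ & ->). apply in_gaps. eauto.
  - now apply Hs, in_sing.
Qed.

Lemma Good_base : Good FA base.
Proof.
  unfold Good. rewrite fam_base.
  split; [|split; [|split; [|split; [|split; [|split; [|split; [|split]]]]]]].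
  - intros p Hp. pose proof Hp as Hp'. unfold base in Hp'. apply sepP in Hp'; [|defi].
    destruct Hp' as (_ & s & U & Fs & Hs & HU' & ->).
    exists s, (gap U), (seg0 s). repeat split; auto.
    + apply in_gaps. exists U. split; [apply HU'|reflexivity].
    + intros x Hx. apply in_seg0 in Hx. destruct Hx as (V & _ & HV & _ & _ & ->).
      apply in_gaps. eauto.
  - intros s y D y' D' Ht Ht'. apply trip_base in Ht, Ht'.
    destruct Ht as (_ & _ & (U & H & ->) & ->), Ht' as (_ & _ & (U' & H' & ->) & ->).
    split; [|reflexivity]. f_equal. eapply rank_of_fun; eauto.
  - intros s Fs Hs. destruct (base_total s Fs Hs) as [U HU']. exists (gap U), (seg0 s).
    apply trip_base. eauto 6.
  - intros s s' y D D' Ht Ht'. apply trip_base in Ht, Ht'.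
    destruct Ht as (Fs & Hs & (U & H & ->) & _), Ht' as (Fs' & Hs' & (U' & H' & E) & _).
    apply gap_inj in E; [|apply H|apply H']. subst U'.
    destruct (finite_pre0 s Fs), (finite_pre0 s' Fs').
    apply pre0_inj; auto. eapply rank_of_inj; eauto.
  - intros x Hx. apply in_gaps in Hx. destruct Hx as (U & HU' & ->). now apply gap_nonempty.
  - intros x x' a Hx Hx' Ha Ha'. apply in_gaps in Hx, Hx'.
    destruct Hx as (U & HU' & ->), Hx' as (V & HV' & ->). f_equal. eapply gap_meet; eauto.
  - intros Y HY NY.
    destruct (finite_tower_least P b Phi) with (Y := pre0 Y) as (U & HU' & Hmin); auto.
    + intros U HU'. now apply in_pre0 in HU'.
    + intros E. destruct (nonempty Y NY) as [y Hy].
      destruct (proj1 (in_gaps y) (HY y Hy)) as (U & HU' & ->).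
      apply (in_emp U). rewrite <- E. now apply in_pre0.
    + apply in_pre0 in HU'. exists (gap U). split; [tauto|]. intros y Hy.
      destruct (proj1 (in_gaps y) (HY y Hy)) as (V & HV' & ->).
      apply leS_base; [tauto|exact HV'|]. now apply Hmin, in_pre0.
  - intros x y L1 L2. destruct (leS_base_gaps x y L1) as [Hx Hy]. apply in_gaps in Hx, Hy.
    destruct Hx as (U & HU' & ->), Hy as (V & HV' & ->).
    apply leS_base in L1, L2; auto. f_equal. now apply subset_antisym.
  - intros F. apply (finite_tower_infinite P b Phi); auto.
    apply (finite_image (fun x U => x = gap U) T gaps); [defi|exact F| |].
    + intros U V x HU' HV' _ E E'. apply gap_inj; congruence.
    + intros U HU'. exists (gap U). split; [|reflexivity]. apply in_gaps. eauto.
Qed.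

End Base.

(** * From a bounded function to a structure equal to its own doubling *)

Theorem theorem3p4 (M : set_structure) (HM : ZF M) (A BA FA : M)
  (HA : infinite_set A)
  (HBA : is_finite_block_partitions BA A)
  (HFA : is_finite_subsets FA A) :
  ~ exists f : M, is_function f BA FA /\ boundedly_finite_to_one f FA.
Proof.
  intros (f & [F1 F2] & k & Hk & F3).
  assert (f_dom : forall P E, pair P E ∈ f -> P ∈ BA /\ E ∈ FA).
  { intros P E H. destruct (F1 _ H) as (P' & E' & HP & HE & Eq).
    apply is_ordered_pairE, pair_inj in Eq. destruct Eq as [-> ->]. auto. }
  assert (f_total : forall P, P ∈ BA -> exists E, E ∈ FA /\ pair P E ∈ f).
  { intros P HP. destruct (F2 P HP) as (E & HE & _). apply maps_toE in HE. exists E.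
    split; [now apply f_dom in HE|exact HE]. }
  assert (f_fun : forall P E E', pair P E ∈ f -> pair P E' ∈ f -> E = E').
  { intros P E E' H H'. destruct (F2 P) as (E0 & _ & U); [now apply f_dom in H|].
    rewrite <- (U E), <- (U E'); [reflexivity| |]; now apply maps_toE. }
  assert (f_fib : forall E, E ∈ FA -> exists S, (forall P, P ∈ S <-> pair P E ∈ f) /\ Emb S k).
  { intros E HE. destruct (F3 E HE) as (S & HS & HSk). exists S.
    split; [|now apply has_at_most_Emb]. intros P. now rewrite (HS P), maps_toE. }
  assert (f_fin : forall E, E ∈ FA ->
            exists S, (forall P, P ∈ S <-> pair P E ∈ f) /\ finite_set S).
  { intros E HE. destruct (f_fib E HE) as (S & HS & HSk). exists S. split; [exact HS|].
    eapply finite_Emb; [exact HSk|]. now apply finite_natural. }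
  destruct (plus_grows HA HBA HFA f_total f_dom Hk f_fib) as (U0 & HU0 & Hgrow).
  (* Starting the tower at [U0] keeps it among the sets for which [U⁺ ≠ U] is known. *)
  set (P0 := sep FA (fun U => subset U0 U)).
  assert (P0P : forall U, U ∈ P0 <-> U ∈ FA /\ subset U0 U)
    by (intros U; unfold P0; rewrite sepP by defi; reflexivity).
  assert (plusP : forall U, U ∈ FA -> plus A BA f U ∈ FA /\ subset U (plus A BA f U))
    by (intros; now apply plus_FA).
  assert (HG0 : Good FA (base FA P0 U0 (plus A BA f))).
  { apply Good_base.
    - defi.
    - apply P0P. split; [exact HU0|apply subset_refl].
    - intros x Hx. now apply P0P in Hx.
    - intros x Hx. apply P0P in Hx. apply P0P. split; [now apply plusP|].
      eapply subset_trans; [apply Hx|]. now apply plusP.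
    - intros x Hx. apply P0P in Hx. now apply plusP.
    - intros x Hx. apply P0P in Hx. now apply Hgrow.
    - intros x Hx. apply P0P in Hx. destruct Hx as [Hx _]. apply HFA in Hx. tauto.
    - intros x y Hx Hxy Hy. apply P0P in Hy. destruct Hy as [Hy _]. apply HFA in Hy.
      destruct Hy as [Hy Fy]. apply P0P. split; [|exact Hx]. apply HFA.
      split; [eapply subset_trans; eassumption|eapply finite_subset; eassumption].
    - intros C HC NC FC. destruct (nonempty C NC) as [c Hc]. apply P0P. split.
      + apply HFA. split.
        * intros z Hz. apply in_bigU in Hz. destruct Hz as (x & Hx & Hz). apply HC, P0P in Hx.
          destruct Hx as [Hx _]. apply HFA in Hx. now apply Hx.
        * apply finite_bigU; [exact FC|]. intros x Hx. apply HC, P0P in Hx.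
          destruct Hx as [Hx _]. apply HFA in Hx. tauto.
      + intros z Hz. apply in_bigU. exists c. split; [exact Hc|]. apply HC, P0P in Hc. now apply Hc.
    - intros x Hx. apply P0P in Hx. destruct Hx as [Hx _]. apply plusP in Hx.
      destruct Hx as [Hx _]. apply HFA in Hx. destruct Hx as [HxA Fx]. apply HFA. split.
      + intros z Hz. apply in_diff in Hz. now apply HxA.
      + eapply finite_subset; [exact Fx|]. intros z Hz. now apply in_diff in Hz. }
  set (S0 := base FA P0 U0 (plus A BA f)) in *.
  set (cp := copy A FA f).
  assert (Dcp : DefFun1 cp) by (unfold cp; auto with defs nocore).
  (* Bounding structures by [triples FA] makes them form a set, and requiring them to extend [S0]
     gives that set a least element. *)
  set (PS := sep (Pow (triples FA)) (fun S => Good FA S /\ subset S0 S)).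
  assert (PSP : forall S, S ∈ PS <-> Good FA S /\ subset S0 S).
  { intros S. unfold PS. rewrite sepP, in_Pow by defi. split; [tauto|]. intros H. split; [|exact H].
    destruct H as [(G1 & _) _]. intros p Hp. destruct (G1 p Hp) as (s & y & D & -> & _ & Hs & Hy & HD).
    assert (FF : subset (fam FA S) FA) by (intros z Hz; now apply in_fam in Hz).
    apply in_prod_pair. rewrite in_Pow, in_prod_pair, in_Pow.
    split; [|split]; [apply (subset_trans _ _ _ Hs FF)|now apply FF|apply (subset_trans _ _ _ HD FF)]. }
  assert (Hcp : forall S, Good FA S -> GoodB FA S (cp S) /\
            forall x, x ∈ fam FA S -> exists y, pair x y ∈ cp S).
  { intros S HS. eapply copy_spec; eauto. }
  destruct (bourbaki_witt PS S0 (dbl FA cp)) as [H1 H2].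
  - defi.
  - apply PSP. split; [exact HG0|apply subset_refl].
  - intros S HS. now apply PSP in HS.
  - intros S HS. apply PSP in HS. destruct HS as [HS HS0]. destruct (Hcp S HS) as [K1 K2].
    apply PSP. split; [now apply Good_dbl|]. eapply subset_trans; [exact HS0|]. now apply dbl_grows.
  - intros S HS. apply PSP in HS. destruct HS as [HS _]. destruct (Hcp S HS) as [K1 K2].
    now apply dbl_grows.
  - intros C HC NC CC. destruct (nonempty C NC) as [c Hc]. apply PSP. split.
    + apply Good_union; auto. intros S HS. now apply HC, PSP in HS.
    + intros z Hz. apply in_bigU. exists c. split; [exact Hc|]. apply HC, PSP in Hc. now apply Hc.
  (* At the fixed point doubling adds nothing, whereas the copy of any member lies outside the old
     family. *)
  - apply PSP in H1. destruct H1 as [HS _]. destruct (Hcp _ HS) as [K1 K2].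
    revert H2. now apply dbl_grows.
Qed.
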